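(* Let $X$ be a skip-free Hunt process on $E$ (setting in the context). There exists a continuous, strictly increasing, real-valued function $\mathbf s$ on $E$ such that for all $a,x,b\in E$ with $a<x<b$, $$\mathbf P_x(T_b<T_a)=\frac{\mathbf s(x)-\mathbf s(a)}{\mathbf s(b)-\mathbf s(a)}.$$ If $\tilde{\mathbf s}$ is another function with the same properties, then $\tilde{\mathbf s}=\alpha\mathbf s+\beta$ for some $\alpha>0$ and $\beta\in\mathbb R$.
   Context: Let $E\subset[-\infty,\infty]$ with $l:=\inf E$, $r:=\sup E$, such that $E\cup\{l,r\}$ is closed in $[-\infty,\infty]$. Adjoin a cemetery $\partial$: an extra isolated point if $l,r\in E$; identified with $l$ (resp. $r$) if exactly $l$ (resp. $r$) is missing from $E$; the one-point compactification point if $l,r\notin E$. A skip-free Hunt process on $E$ is a Hunt process $X=(\Omega,\mathscr F_t,\theta_t,X_t,\mathbf P_x,\zeta)$ on $E\cup\{\partial\}$ with lifetime $\zeta$ such that: (SF) for every $x\in E$, $\mathbf P_x$-a.s., $(X_{t-}\wedge X_t,\,X_{t-}\vee X_t)\cap E=\emptyset$ for all $t<\zeta$; (SR) $\mathbf P_x(T_y<\infty)>0$ for all $x,y\in E$, where $T_y:=\inf\{t>0:X_t=y\}$; (SK) if $\mathbf P_x(\zeta<\infty)>0$ for some $x\in E$, then $l\notin E$ or $r\notin E$, and $\mathbf P_x(X_{\zeta-}\notin E,\zeta<\infty)=\mathbf P_x(\zeta<\infty)$. *)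

(* Defs.v *)
From HB Require Import structures.
From mathcomp Require Import all_boot all_order all_algebra.
From mathcomp Require Import all_classical all_reals all_analysis.
Set Implicit Arguments. Unset Strict Implicit. Unset Printing Implicit Defensive.
Import Order.TTheory GRing.Theory Num.Theory.
Import numFieldNormedType.Exports.
Local Open Scope classical_set_scope.
Local Open Scope ring_scope.

Section SkipFreeHunt.
Context {R : realType}.

(** States of E ∪ {∂}: [Some x] is the point x ∈ E ⊆ [-oo,+oo], [None] is
    the cemetery ∂.  [Some x] with x ∉ E is never visited. *)
Definition state := option (\bar R).

Definition lE (E : set (\bar R)) : \bar R := ereal_inf E.
Definition rE (E : set (\bar R)) : \bar R := ereal_sup E.

Definition admissible_state_space (E : set (\bar R)) : Prop :=
  closed (E `|` [set lE E; rE E]).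

Definition in_state (E : set (\bar R)) (s : state) : Prop :=
  match s with Some x => E x | None => True end.

Definition hcomp (x : \bar R) : R :=
  match x with EFin y => y / (1 + `|y|) | EPInf => 1 | ENInf => -1 end.

(** A topological embedding of E ∪ {∂} (with the topology of the paper) into
    R × R:
    - l, r ∈ E : ∂ is an extra isolated point;
    - exactly l ∉ E (resp. r ∉ E) : ∂ is identified with l (resp. r);
    - l, r ∉ E : ∂ is the point at infinity of the one-point
      compactification (E ∪ {l,r} with l and r glued, drawn on a circle). *)
Definition emb (E : set (\bar R)) (s : state) : R * R :=
  let l := lE E in let r := rE E in
  let angle x := pi * (2 * ((hcomp x - hcomp l) / (hcomp r - hcomp l)) - 1) in
  if `[< E l >] && `[< E r >] then
    match s with Some x => (hcomp x, 0) | None => (3, 0) end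
  else if `[< E r >] then
    match s with Some x => (hcomp x, 0) | None => (hcomp l, 0) end
  else if `[< E l >] then
    match s with Some x => (hcomp x, 0) | None => (hcomp r, 0) end
  else
    match s with Some x => (cos (angle x), sin (angle x)) | None => (-1, 0) end.

(** the cemetery read as a point of [-oo,+oo] when it is identified with
    l (resp. r) *)
Definition ext (E : set (\bar R)) (s : state) : \bar R :=
  match s with
  | Some x => x
  | None => if `[< E (lE E) >] then rE E else lE E
  end.

Definition borelS (E : set (\bar R)) (B : set state) : Prop :=
  exists B' : set (R * R)%type, measurable B' /\ B = emb E @^-1` B'.

Section Process.
Context {d : measure_display} {Omega : measurableType d}.

Definition Xat (X : R -> Omega -> state) (tau : \bar R) (w : Omega) : state :=
  match tau with EFin t => X t w | _ => None end.

Definition lifetime (X : R -> Omega -> state) (w : Omega) : \bar R :=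
  ereal_inf [set t%:E | t in [set t | 0 <= t /\ X t w = None]].

Definition hitting (X : R -> Omega -> state) (y : \bar R) (w : Omega) : \bar R :=
  ereal_inf [set t%:E | t in [set t | 0 < t /\ X t w = Some y]].

Definition filtration (F : R -> set (set Omega)) : Prop :=
  [/\ forall t, 0 <= t -> sigma_algebra setT (F t),
      forall s t, 0 <= s -> s <= t -> F s `<=` F t,
      forall t, 0 <= t -> F t `<=` measurable &
      forall t, 0 <= t -> F t = \bigcap_(u in [set u | t < u]) F u].

Definition stopping_time (F : R -> set (set Omega)) (tau : Omega -> \bar R) :=
  (forall w, (0 <= tau w)%E) /\
  forall t, 0 <= t -> F t [set w | (tau w <= t%:E)%E].

Definition F_at (F : R -> set (set Omega)) (tau : Omega -> \bar R)
    (L : set Omega) : Prop :=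
  measurable L /\ forall t, 0 <= t -> F t (L `&` [set w | (tau w <= t%:E)%E]).

Record hunt_process (E : set (\bar R)) (F : R -> set (set Omega))
    (theta : R -> Omega -> Omega) (X : R -> Omega -> state)
    (P : state -> probability Omega R) : Prop := {
  hunt_filtration : filtration F;
  hunt_values : forall t w, 0 <= t -> in_state E (X t w);
  hunt_adapted : forall t B, 0 <= t -> borelS E B -> F t (X t @^-1` B);
  hunt_shift : forall s t w, 0 <= s -> 0 <= t -> X s (theta t w) = X (s + t) w;
  hunt_absorbing : forall s t w, 0 <= s -> s <= t -> X s w = None -> X t w = None;
  hunt_normal : forall x, in_state E x -> P x [set w | X 0 w = x] = 1%E;
  hunt_measurable : forall t B (c : R), 0 <= t -> borelS E B ->
    borelS E [set x | (P x (X t @^-1` B) <= c%:E)%E];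
  hunt_right_continuous : forall w t, 0 <= t ->
    (fun u => emb E (X u w)) @ t^'+ --> emb E (X t w);
  hunt_left_limits : forall x, in_state E x ->
    {ae P x, forall w, forall t, 0 < t ->
       exists s, in_state E s /\ (fun u => emb E (X u w)) @ t^'- --> emb E s};
  hunt_strong_markov : forall x sigma L t B, in_state E x ->
    stopping_time F sigma -> F_at F sigma L -> 0 <= t -> borelS E B ->
    P x (L `&` [set w | (sigma w < +oo)%E] `&`
         [set w | B (Xat X (sigma w + t%:E)%E w)]) =
    (\int[P x]_(w in L `&` [set w | (sigma w < +oo)%E])
        P (Xat X (sigma w) w) (X t @^-1` B))%E;
  hunt_quasi_left_continuous : forall x (sn : nat -> Omega -> \bar R) sigma,
    in_state E x -> (forall n, stopping_time F (sn n)) -> stopping_time F sigma ->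
    (forall w n, (sn n w <= sn n.+1 w)%E) ->
    (forall w, (fun n => sn n w) @ \oo --> sigma w) ->
    {ae P x, forall w, (sigma w < +oo)%E ->
       (fun n => emb E (Xat X (sn n w) w)) @ \oo --> emb E (Xat X (sigma w) w)};
  (* hitting times of points are stopping times (standard consequence of the
     usual augmentation of the filtration) *)
  hunt_hitting_stopping : forall y, E y -> stopping_time F (hitting X y)
}.

Definition skip_free_hunt (E : set (\bar R)) (F : R -> set (set Omega))
    (theta : R -> Omega -> Omega) (X : R -> Omega -> state)
    (P : state -> probability Omega R) : Prop :=
  [/\ hunt_process E F theta X P,
   forall x, E x ->
     {ae P (Some x), forall w, forall t s1 v, 0 < t -> (t%:E < lifetime X w)%E ->
        in_state E s1 -> (fun u => emb E (X u w)) @ t^'- --> emb E s1 ->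
        X t w = Some v ->
        forall z, E z ->
          ~ ((Order.min (ext E s1) v < z)%E /\ (z < Order.max (ext E s1) v)%E)},
   forall x y, E x -> E y ->
     (0 < P (Some x) [set w | (hitting X y w < +oo)%E])%E &
   (exists x, E x /\ (0 < P (Some x) [set w | (lifetime X w < +oo)%E])%E) ->
     (~ E (lE E) \/ ~ E (rE E)) /\
     forall x, E x ->
       {ae P (Some x), forall w, (lifetime X w < +oo)%E ->
          forall s1, in_state E s1 ->
          (fun u => emb E (X u w)) @ (fine (lifetime X w))^'- --> emb E s1 ->
          s1 = None}].

Definition scale_function (E : set (\bar R)) (X : R -> Omega -> state)
    (P : state -> probability Omega R) (s : \bar R -> R) : Prop :=
  [/\ {within E, continuous s},
      forall x y, E x -> E y -> (x < y)%E -> s x < s y &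
      forall a x b, E a -> E x -> E b -> (a < x)%E -> (x < b)%E ->
        P (Some x) [set w | (hitting X b w < hitting X a w)%E] =
        ((s x - s a) / (s b - s a))%:E].

End Process.
End SkipFreeHunt.

(* Main.v *)
Require Import Defs.
From mathcomp Require Import all_boot all_order all_algebra.
From mathcomp Require Import all_classical all_reals all_analysis.
From mathcomp Require Import measurable_realfun ring lra.
Set Implicit Arguments. Unset Strict Implicit. Unset Printing Implicit Defensive.
Import Order.TTheory GRing.Theory Num.Theory.
Import numFieldNormedType.Exports.
Local Open Scope classical_set_scope.
Local Open Scope ring_scope.

(** Idea. Put psi_q(x,y) = E_x exp(-q T_y). Skip-freeness and quasi-left-continuity
    force the process to visit every point of E that lies between two visited
    points. The strong Markov property then makes psi_q multiplicative along a
    monotone triple of points and gives, for a < x < b, two linear equations for the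
    Laplace transforms of T_b on {T_b < T_a} and of T_a on {T_a < T_b}; solving them,
    E_x[exp(-q T_b); T_b < T_a]
      = psi_q(x,b) (1 - psi_q(a,x) psi_q(x,a)) / (1 - psi_q(a,b) psi_q(b,a)).
    Letting q tend to 0, the probabilities P_x(T_b < T_a) are multiplicative in b.
    A zero-one argument shows that X leaves ]a,b[ almost surely through a or b, so
    that P_x(T_a < T_b) = 1 - P_x(T_b < T_a), and these probabilities on growing
    intervals [a,b] differ by affine maps only; normalizing at two reference points
    yields s. Its continuity is that of T_y in y, i.e. quasi-left-continuity.

    The strong Markov property is only available at one deterministic time after a
    stopping time. It is transferred to hitting times through resolvents: if z is
    hit before the superlevel set {> c} is entered, then the discounted occupation
    of {> c} from x is E_x exp(-q T_z) times the one from z, and the latter cancels. *)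

(** * The order coordinate and the topology of the state space *)

Section Topology.
Context {R : realType}.
Implicit Types (E : set (\bar R)) (x v : \bar R) (s : @state R).

(** The Markov hypothesis controls one fixed time after a stopping time, not a functional of the
    whole later path. Discounted occupation times are integrals of such one-time probabilities,
    which is why they serve as the transported quantity. Cancelling them at [z] requires a level
    that is not exceeded before [z] is hit, yet is exceeded with positive probability from [z]. No
    such level exists when [z] is the extreme point of [E] in the direction of motion and also an
    accumulation point of [E]; every result for such a [z] is a limit over points short of it. The
    cemetery is the other obstacle. Glued to a missing end, it is not separated from live points by
    the order. The coordinate jumps there, and paths keep right-continuous coordinates only because
    dead paths stay dead. Leaving []a,b[] by dying must be excluded too: (SK) places death at a
    missing end, and the compact image of [[a,b]] avoids that point. Affinity of the hitting
    probabilities combines two product rules: [P_x(T_b < T_a)] is multiplicative in the target [b],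
    and its complement, read in the reversed order, is multiplicative in [a]. *)

Lemma hcompE x : hcomp x = contract x.
Proof. by case: x. Qed.

(** With [t = 2 b] the quotient is [tan b], and [b] lies in the range where [atan] inverts [tan].
    This yields an inverse of the circle parametrization that is continuous away from abscissa [-1],
    where the cemetery sits. *)
Lemma half_angle_atan (t : R) : - pi < t < pi ->
  cos t != -1 /\ t = 2 * atan (sin t / (1 + cos t)).
Proof.
move=> /andP[t1 t2]; pose b := t / 2.
have tb : t = b *+ 2 by rewrite /b; field.
have bI : - (pi / 2) < b < pi / 2 by rewrite /b; apply/andP; split; lra.
have cb := cos_gt0_pihalf bI.
have ->: cos t = 2 * cos b ^+ 2 - 1 by rewrite tb cos_mulr2n; ring.
have ->: sin t = 2 * cos b * sin b by rewrite tb sin_mulr2n; ring.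
have cb2 : 0 < cos b ^+ 2 by rewrite exprn_gt0.
split; first by apply/eqP => h; lra.
have -> : 2 * cos b * sin b / (1 + (2 * cos b ^+ 2 - 1)) = tan b.
  rewrite /tan; field; apply/andP; split; first by rewrite gt_eqF.
  by apply/eqP => h; lra.
by rewrite tanK ?in_itv //= tb; ring.
Qed.

Definition angle E (u : R) : R :=
  pi * (2 * ((u - contract (lE E)) / (contract (rE E) - contract (lE E))) - 1).

(** The embedding of live points as a function of the contracted coordinate. Being defined on all of
    [R], it allows plain continuity and compactness arguments. *)
Definition embc E (u : R) : R * R :=
  if `[< E (lE E) >] || `[< E (rE E) >] then (u, 0)
  else (cos (angle E u), sin (angle E u)).

Lemma emb_Some E x : emb E (Some x) = embc E (contract x).
Proof.
by rewrite /emb /embc /angle !hcompE; case: asboolP; case: asboolP.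
Qed.

Lemma angle_continuous E : continuous (angle E).
Proof.
move=> u; rewrite /angle; apply: cvgMl_tmp.
apply: (@cvgB _ R^o); last exact: cvg_cst.
apply: cvgMl_tmp; apply: cvgMr_tmp.
by apply: (@cvgB _ R^o); [exact: cvg_id | exact: cvg_cst].
Qed.

Lemma embc_continuous E : continuous (embc E).
Proof.
rewrite /embc; case: (_ || _) => u.
  apply: (@cvg_pair _ _ _ (nbhs u) (nbhs u) (nbhs (0 : R)) _ _ _ id (cst 0)).
    exact: cvg_id.
  exact: cvg_cst.
apply: (@cvg_pair _ _ _ (nbhs u) (nbhs (cos (angle E u))) (nbhs (sin (angle E u)))).
  apply: (@continuous_cvg _ _ _ _ _ (angle E) cos).
    exact: continuous_cos.
  exact: angle_continuous.
apply: (@continuous_cvg _ _ _ _ _ (angle E) sin).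
  exact: continuous_sin.
exact: angle_continuous.
Qed.

Lemma lE_le E x : E x -> (lE E <= x)%E.
Proof. by move=> Ex; apply: ge_ereal_inf; exists x. Qed.

Lemma le_rE E x : E x -> (x <= rE E)%E.
Proof. by move=> Ex; apply: ereal_sup_ubound. Qed.

Lemma lE_lt E x : ~ E (lE E) -> E x -> (lE E < x)%E.
Proof.
move=> nl Ex; rewrite lt_neqAle lE_le // andbT.
by apply/eqP => h; apply: nl; rewrite h.
Qed.

Lemma lt_rE E x : ~ E (rE E) -> E x -> (x < rE E)%E.
Proof.
move=> nl Ex; rewrite lt_neqAle le_rE // andbT.
by apply/eqP => h; apply: nl; rewrite -h.
Qed.

Lemma angleI E (u : R) : contract (lE E) < u -> u < contract (rE E) ->
  - pi < angle E u < pi.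
Proof.
move=> h1 h2; have p0 := pi_gt0 R; rewrite /angle.
set d := (_ / _).
have d1 : 0 < d by rewrite /d divr_gt0 // subr_gt0 // (lt_trans h1).
have d2 : d < 1 by rewrite /d ltr_pdivrMr ?mul1r ?subr_gt0 ?(lt_trans h1)// ltrD2r.
by apply/andP; split; nra.
Qed.

(** When the cemetery is a missing end, [u] differs from that end; in the glued case the angle stays
    strictly inside []-pi, pi[], where the cosine is not [-1]. *)
Lemma emb_None_neq E (u : R) : ~ (E (lE E) /\ E (rE E)) ->
  (~ E (lE E) -> contract (lE E) < u) -> (~ E (rE E) -> u < contract (rE E)) ->
  embc E u <> emb E None.
Proof.
move=> nb hl hr; rewrite /embc /emb !hcompE.
case: (asboolP (E (lE E))) => El; case: (asboolP (E (rE E))) => Er /=.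
- by case: nb.
- by case=> h; have := hr Er; rewrite h ltxx.
- by case=> h; have := hl El; rewrite h ltxx.
- case=> h _; have [+ _] := half_angle_atan (angleI (hl El) (hr Er)).
  by rewrite h eqxx.
Qed.

(* Near [emb E (Some v)] the embedding is inverted continuously; in the glued
   case the inverse is the half-angle formula. *)
Lemma emb_near E v (e : R) : E v -> 0 < e -> exists2 d : R, 0 < d &
  forall s, in_state E s -> ball (emb E (Some v)) d (emb E s) ->
  exists2 x, s = Some x & `|contract x - contract v| < e.
Proof.
move=> Ev e0.
have hc (x : \bar R) : -1 <= contract x <= 1.
  by have := contract_le1 x; rewrite ler_norml.
have := hc v; have := hc (lE E); have := hc (rE E) => /andP[r1 r2] /andP[l1 l2] /andP[v1 v2].
have lv := lE_le Ev; have vr := le_rE Ev.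
rewrite -le_contract in lv; rewrite -le_contract in vr.
case: (asboolP (E (lE E))) => El.
  case: (asboolP (E (rE E))) => Er.
    (* The isolated cemetery has abscissa 3, at distance at least 2 from [[-1, 1]], so radius 1
       excludes it. *)
    exists (Num.min e 1); first by rewrite lt_min e0 ltr01.
    move=> s; rewrite /emb !hcompE; do 2 rewrite asboolT //=.
    case: s => [x|] Es [/= b1 b2]; move: b1; rewrite /ball/= lt_min => /andP[b1 b3].
      by exists x => //; rewrite hcompE distrC in b1.
    by move: b3; rewrite ltr_norml => /andP[? ?]; exfalso; lra.
  have := lt_rE Er Ev; rewrite -lt_contract => vr'.
  exists (Num.min e (contract (rE E) - contract v)).
    by rewrite lt_min e0 subr_gt0.
  move=> s; rewrite /emb !hcompE (asboolT El) (asboolF Er) /=.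
  case: s => [x|] Es [/= b1 b2]; move: b1; rewrite /ball/= lt_min => /andP[b1 b3].
    by exists x => //; rewrite hcompE distrC in b1.
  by move: b3; rewrite ltr_norml => /andP[? ?]; exfalso; lra.
have := lE_lt El Ev; rewrite -lt_contract => lv'.
case: (asboolP (E (rE E))) => Er.
  exists (Num.min e (contract v - contract (lE E))).
    by rewrite lt_min e0 subr_gt0.
  move=> s; rewrite /emb !hcompE (asboolF El) (asboolT Er) /=.
  case: s => [x|] Es [/= b1 b2]; move: b1; rewrite /ball/= lt_min => /andP[b1 b3].
    by exists x => //; rewrite hcompE distrC in b1.
  by move: b3; rewrite ltr_norml => /andP[? ?]; exfalso; lra.
have := lt_rE Er Ev; rewrite -lt_contract => vr'.
have embE x : emb E (Some x) = (cos (angle E (contract x)), sin (angle E (contract x))).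
  by rewrite emb_Some /embc (asboolF El) (asboolF Er).
have inI x : E x -> - pi < angle E (contract x) < pi.
  by move=> Ex; apply: angleI; rewrite lt_contract; [exact: lE_lt|exact: lt_rE].
pose g (z : R * R) : R := 2 * atan (z.2 / (1 + z.1)).
have [cv gv] := half_angle_atan (inI _ Ev).
have c1 : 1 + cos (angle E (contract v)) != 0.
  by rewrite addrC -[1]opprK subr_eq0.
pose zv := emb E (Some v).
have cfst : z.1 @[z --> zv] --> zv.1 by exact: cvg_fst.
have csnd : z.2 @[z --> zv] --> zv.2 by exact: cvg_snd.
have gcv : g z @[z --> zv] --> g zv.
  apply: cvgMl_tmp; apply: continuous_cvg; first exact: continuous_atan.
  apply: cvgM => //; apply: cvgV; first by rewrite /zv embE.
  by apply: (@cvgD _ R^o) => //; exact: cvg_cst.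
pose d := contract (rE E) - contract (lE E).
have d0 : 0 < d by rewrite subr_gt0 (lt_trans lv').
have p0 := pi_gt0 R.
have e'0 : 0 < 2 * pi * e / d by rewrite divr_gt0 // !mulr_gt0.
(* The angle has slope [2 * pi / d] in the contracted coordinate, hence the tolerance. The condition
   [-1 < z.1] excludes the glued cemetery [(-1, 0)]. *)
have : \forall z \near zv, `|g zv - g z| < 2 * pi * e / d /\ -1 < z.1.
  near=> z; split; near: z.
    by move/cvgrPdist_lt : gcv; apply.
  apply: (cvgr_gt zv.1) => //; rewrite /zv embE /=.
  by rewrite lt_neqAle eq_sym cv cos_geN1.
move=> /nbhs_ballP[dl /= dl0 H]; exists dl => // s Es /H[].
case: s Es => [x|] Ex; last first.
  by move=> _; rewrite /emb (asboolF El) (asboolF Er) /= ltxx.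
move=> h _; exists x => //.
move: h; rewrite /zv !embE /g /= -gv.
have [_ <-] := half_angle_atan (inI _ Ex).
have -> : angle E (contract v) - angle E (contract x) =
   2 * pi / d * (contract v - contract x).
  by rewrite /angle -/d; field; rewrite gt_eqF.
have h0 : 0 < 2 * pi / d by rewrite divr_gt0 // mulr_gt0.
rewrite normrM (gtr0_norm h0) -mulrAC.
rewrite (_ : 2 * pi * e / d = 2 * pi / d * e); last by rewrite mulrAC.
by rewrite mulrAC ltr_pM2l // distrC.
Unshelve. all: by end_near. Qed.

Lemma emb_inj E v s : E v -> in_state E s -> emb E s = emb E (Some v) -> s = Some v.
Proof.
move=> Ev Es h.
have [x sx] : exists x, s = Some x.
  have [d d0 /(_ s Es)] := emb_near Ev (@ltr01 R).
  by rewrite h => /(_ (ballxx _ d0))[x]; exists x.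
rewrite sx; congr Some; apply: contract_inj; apply/eqP; rewrite -subr_eq0 -normr_eq0.
rewrite eq_le normr_ge0 andbT; apply/ler_addgt0Pr => e e0; rewrite add0r.
have [d d0 /(_ s Es)] := emb_near Ev e0.
by rewrite h => /(_ (ballxx _ d0))[y]; rewrite sx => -[->] /ltW.
Qed.

(* The sign [b] treats upward and downward crossings at once; the cemetery is
   sent to [-2], below all values of [coord]. *)
Definition coord (b : bool) x : R := if b then contract x else - contract x.

Definition coordS b s : R := if s is Some x then coord b x else -2.

Lemma coord_ge b x : -1 <= coord b x.
Proof.
have := contract_le1 x; rewrite ler_norml /coord => /andP[? ?].
by case: b => //; lra.
Qed.

Lemma coord_inj b x y : coord b x = coord b y -> x = y.
Proof. by rewrite /coord; case: b => [|/oppr_inj]; exact: contract_inj. Qed.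

Lemma coordS_Some b s x : coordS b s = coord b x -> s = Some x.
Proof.
case: s => [y /coord_inj ->//|/= h].
by have := coord_ge b x; rewrite -h => ?; exfalso; lra.
Qed.

Lemma coordS_alive b s (c : R) : -2 <= c -> c < coordS b s -> exists x, s = Some x.
Proof. by case: s => [x|]/=; [exists x | move=> ? ?; exfalso; lra]. Qed.

Lemma emb_near_coord b E v (e : R) : E v -> 0 < e -> exists2 d : R, 0 < d &
  forall s, in_state E s -> ball (emb E (Some v)) d (emb E s) ->
  `|coordS b s - coord b v| < e.
Proof.
move=> Ev e0; have [d d0 H] := emb_near Ev e0; exists d => // s Es /(H _ Es)[x -> ].
by rewrite /coord /=; case: b => //; rewrite -opprD normrN.
Qed.

(** An open set is the countable union of the balls it contains with rational centre and radius
    [1/(n+1)], and each such ball is a product of intervals. *)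
Lemma open_measurable_prod (O : set (R * R)) : open O -> measurable O.
Proof.
move=> oO.
pose B (p : rat * rat * nat) : set (R * R) :=
  ball ((ratr p.1.1 : R), (ratr p.1.2 : R)) (p.2.+1%:R^-1).
have mB p : measurable (B p).
  rewrite (_ : B p = ball (ratr p.1.1 : R) (p.2.+1%:R^-1) `*` ball (ratr p.1.2 : R) (p.2.+1%:R^-1)) //.
  by apply: measurableX; apply: open_measurable; exact: ball_open.
rewrite (_ : O = \bigcup_(p in [set p | B p `<=` O]) B p).
  rewrite bigcup_mkcond; apply: countable_bigcupT_measurable => [|p]; first exact: countableP.
  by case: ifP => _; [exact: mB | exact: measurable0].
apply/seteqP; split => [[x y] Oxy|z [p /= h]]; last exact: h.
have /nbhs_ballP[e /= e0 He] : nbhs (x, y) O by exact: open_nbhs_nbhs.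
pose n := Num.trunc (2 / e).
have hn : n.+1%:R^-1 < e / 2.
  rewrite -[ltRHS]invrK ltf_pV2 ?posrE ?invr_gt0 ?divr_gt0 // invf_div.
  by rewrite truncnS_gt // divr_ge0 // ltW.
have n0 : 0 < n.+1%:R^-1 :> R by rewrite invr_gt0.
pose w : R := n.+1%:R^-1; rewrite -/w in hn n0.
have dens (u : R) : exists q : rat, `|ratr q - u| < w.
  have : u - w < u + w by lra.
  move=> /rat_in_itvoo[q]; rewrite in_itv /= => /andP[q1 q2]; exists q.
  by rewrite ltr_norml; apply/andP; split; lra.
have [q1 h1] := dens x; have [q2 h2] := dens y.
exists (q1, q2, n); last by split.
move=> /= [a b] [/= ha hb]; apply: He; split => /=; rewrite /ball/= -/w in ha hb *.
- rewrite (_ : x - a = - (ratr q1 - x) + (ratr q1 - a)); last ring.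
  apply: (le_lt_trans (ler_normD _ _)); rewrite normrN; lra.
- rewrite (_ : y - b = - (ratr q2 - y) + (ratr q2 - b)); last ring.
  apply: (le_lt_trans (ler_normD _ _)); rewrite normrN; lra.
Qed.

(* The open set [O] realizes a superlevel set of the coordinate. *)
Lemma borelS_coord b E (c : R) : -2 <= c -> exists2 B, borelS E B &
  forall s, in_state E s -> B s <-> c < coordS b s.
Proof.
move=> c2.
pose O : set (R * R) := [set z | exists U : set (R * R), [/\ open U, U z &
   forall s, in_state E s -> U (emb E s) -> c < coordS b s]].
have oO : open O.
  rewrite openE => z [U [oU Uz H]].
  have : nbhs z U by exact: open_nbhs_nbhs.
  by apply: filterS => y Uy; exists U.
exists (emb E @^-1` O).
  by exists O; split => //; exact: open_measurable_prod.
move=> s Es; split; first by case=> U [_ Us H]; exact: H.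
move=> cs; have [v sv] := coordS_alive c2 cs; rewrite sv in Es cs *.
have e0 : 0 < coord b v - c by rewrite subr_gt0.
have [d d0 H] := emb_near_coord b Es e0.
exists (ball (emb E (Some v)) d)°; split; first exact: open_interior.
  exact: nbhsx_ballx.
move=> s' Es' /interior_subset /(H _ Es'); rewrite ltr_norml => /andP[? ?]; lra.
Qed.

Lemma emb_borel (x : @state R) E : borelS E (emb E @^-1` [set emb E x]).
Proof.
exists [set emb E x]; split => //.
rewrite (_ : [set _] = [set (emb E x).1] `*` [set (emb E x).2]).
  exact: measurableX.
by apply/seteqP; split => [[a b]|[a b]] /= => [<-|[-> ->]] //; case: (emb E x).
Qed.
End Topology.

(** * Closure properties of sigma-algebras of events *)

Section SigmaAlgebra.
Context {T : Type} (G : set (set T)).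
Hypothesis sG : sigma_algebra setT G.

Lemma sigma_set0 : G set0. Proof. by case: sG. Qed.

Lemma sigma_setC A : G A -> G (~` A).
Proof. by case: sG => _ h _ /h; rewrite setTD. Qed.

Lemma sigma_setT : G setT.
Proof. by rewrite -setC0; apply/sigma_setC/sigma_set0. Qed.

Lemma sigma_bigcup (A : nat -> set T) : (forall n, G (A n)) -> G (\bigcup_n A n).
Proof. by case: sG => _ _; apply. Qed.

Lemma sigma_bigcap (A : nat -> set T) : (forall n, G (A n)) -> G (\bigcap_n A n).
Proof.
move=> h; rewrite -[X in G X]setCK setC_bigcap; apply: sigma_setC.
by apply: sigma_bigcup => n; exact: sigma_setC.
Qed.

Lemma sigma_setU A B : G A -> G B -> G (A `|` B).
Proof.
move=> GA GB; rewrite -bigcup2E; apply: sigma_bigcup => -[//|[//|n]].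
exact: sigma_set0.
Qed.

Lemma sigma_setI A B : G A -> G B -> G (A `&` B).
Proof.
move=> GA GB; rewrite -[X in G X]setCK setCI; apply: sigma_setC.
by apply: sigma_setU; exact: sigma_setC.
Qed.

Lemma sigma_bigcup_rat (A : rat -> set T) (D : set rat) :
  (forall q, D q -> G (A q)) -> G (\bigcup_(q in D) A q).
Proof.
move=> h.
pose B (n : nat) := if unpickle n is Some q then
   (if `[< D q >] then A q else set0) else set0.
rewrite (_ : \bigcup_(q in D) A q = \bigcup_n B n).
  apply: sigma_bigcup => n; rewrite /B; case: unpickle => [q|]; last exact: sigma_set0.
  by case: asboolP => [/h//|_]; exact: sigma_set0.
apply/seteqP; split => [x [q Dq Ax]|x [n _]].
  by exists (pickle q); [exact: I | rewrite /B pickleK (asboolT Dq)].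
rewrite /B; case: (unpickle n) => [q|[]]; case: (asboolP (D q)) => [Dq Ax|_ []].
by exists q.
Qed.
End SigmaAlgebra.

Section OneSided.
Context {R : realType}.

Lemma at_right_ex (t : R) (A : set R) : (t^'+) A ->
  exists2 e : R, 0 < e & forall u, t < u -> u < t + e -> A u.
Proof.
rewrite /at_right /within /= => /nbhs_ballP[e /= e0 He]; exists e => // u tu ue.
by apply: He => //; rewrite /ball/= ltr_norml; apply/andP; split; lra.
Qed.

Lemma at_left_ex (t : R) (A : set R) : (t^'-) A ->
  exists2 e : R, 0 < e & forall u, t - e < u -> u < t -> A u.
Proof.
rewrite /at_left /within /= => /nbhs_ballP[e /= e0 He]; exists e => // u tu ue.
by apply: He => //; rewrite /ball/= ltr_norml; apply/andP; split; lra.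
Qed.

(* only nonnegative times matter *)
Definition leftlim (y : R -> R) (t l : R) := forall e, 0 < e ->
  exists2 dl, 0 < dl & forall u, 0 <= u -> t - dl < u -> u < t -> `|y u - l| < e.

Lemma invS_lt (e : R) : 0 < e -> exists n : nat, n.+1%:R^-1 < e.
Proof.
move=> e0; exists (Num.trunc e^-1).
rewrite -[ltRHS]invrK ltf_pV2 ?posrE ?invr_gt0 //.
by rewrite truncnS_gt // ?invr_ge0 // ltW.
Qed.

Lemma rat_between (a b : R) : a < b -> exists q : rat, a < ratr q < b.
Proof. by move=> /rat_in_itvoo[q]; rewrite in_itv /=; exists q. Qed.
End OneSided.

Lemma measurable_gt {R : realType} {d} {T : measurableType d} (f : T -> R) :
  (forall c, measurable [set w | c < f w]) -> measurable_fun setT f.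
Proof.
move=> mf; apply: (measurability _ (RGenOInfty.measurableE R)).
move=> _ [_ [x ->] <-]; rewrite setTI (_ : _ @^-1` _ = [set w | x < f w]) //.
by apply/seteqP; split => w /=; rewrite in_itv /= andbT.
Qed.

(** * Paths *)

Section Paths.
Context {R : realType} {E : set (\bar R)}
  {d : measure_display} {Omega : measurableType d}
  {F : R -> set (set Omega)} {theta : R -> Omega -> Omega}
  {X : R -> Omega -> @state R} {P : @state R -> probability Omega R}.
Hypothesis HP : hunt_process E F theta X P.

Let Y b t w := coordS b (X t w).

Lemma sigmaF t : 0 <= t -> sigma_algebra setT (F t).
Proof. by case: (hunt_filtration HP) => h _ _ _; exact: h. Qed.

Lemma F_mono s t A : 0 <= s -> s <= t -> F s A -> F t A.
Proof. by move=> s0 st; case: (hunt_filtration HP) => _ h _ _; exact: h. Qed.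

Lemma F_meas t A : 0 <= t -> F t A -> measurable A.
Proof. by move=> t0; case: (hunt_filtration HP) => _ _ h _; exact: h. Qed.

Lemma F_right t A : 0 <= t -> (forall u, t < u -> F u A) -> F t A.
Proof.
by move=> t0 h; case: (hunt_filtration HP) => _ _ _ -> // u /= tu; exact: h.
Qed.

Lemma dead_le s t w : 0 <= s -> s <= t -> X s w = None -> X t w = None.
Proof. exact: (hunt_absorbing HP). Qed.

Lemma alive_le s t w x : 0 <= s -> s <= t -> X t w = Some x ->
  exists2 y, E y & X s w = Some y.
Proof.
move=> s0 st Xt; case Xs : (X s w) => [y|]; last by rewrite (dead_le s0 st Xs) in Xt.
by exists y => //; have := hunt_values HP w s0; rewrite Xs.
Qed.

Lemma valE t w v : 0 <= t -> X t w = Some v -> E v.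
Proof. by move=> t0 h; have := hunt_values HP w t0; rewrite h. Qed.

(** The coordinate is discontinuous at the cemetery, but a path that is dead at [t] remains dead, so
    the topology is needed only at live points. *)
Lemma Y_rc b w (t e : R) : 0 <= t -> 0 < e -> exists2 dl, 0 < dl &
  forall u, t <= u -> u < t + dl -> `|Y b u w - Y b t w| < e.
Proof.
move=> t0 e0; rewrite /Y; case Xt : (X t w) => [v|]; last first.
  exists 1 => // u tu _; by rewrite (dead_le t0 tu Xt) subrr normr0.
have Ev := valE t0 Xt.
have [d0 d00 H] := emb_near_coord b Ev e0.
have := hunt_right_continuous HP (w := w) t0; rewrite Xt.
move=> /(_ _ (nbhsx_ballx _ _ d00))/at_right_ex[dl dl0 Hd].
exists dl => // u; rewrite le_eqVlt => /predU1P[<- _|tu ue].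
  by rewrite Xt subrr normr0.
apply: H; last exact: Hd.
by apply: (hunt_values HP); lra.
Qed.

Lemma X_left w t s (e : R) : 0 <= t -> 0 < e ->
  (fun u => emb E (X u w)) @ t^'- --> emb E s ->
  exists2 dl, 0 < dl & forall u, 0 <= u -> t - dl < u -> u < t -> ball (emb E s) e (emb E (X u w)).
Proof.
move=> t0 e0 /(_ _ (nbhsx_ballx _ _ e0))/at_left_ex[dl dl0 H].
by exists dl => // u _; exact: H.
Qed.

Lemma Y_left b w t v : 0 <= t -> E v ->
  (fun u => emb E (X u w)) @ t^'- --> emb E (Some v) ->
  leftlim (fun u => Y b u w) t (coord b v).
Proof.
move=> t0 Ev h e e0; have [d0 d00 H] := emb_near_coord b Ev e0.
have [dl dl0 Hd] := X_left t0 d00 h.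
by exists dl => // u u0 ut tu; apply: H; [exact: (hunt_values HP)|exact: Hd].
Qed.

Lemma ltY_F b t c : 0 <= t -> -2 <= c -> F t [set w | c < Y b t w].
Proof.
move=> t0 c2; have [B bB HB] := @borelS_coord _ b E c c2.
rewrite (_ : [set _ | _] = X t @^-1` B); first exact: (hunt_adapted HP).
by apply/seteqP; split => w /=; move/(HB (X t w) (hunt_values HP w t0)).
Qed.

Lemma Y_ge b t w : -2 <= Y b t w.
Proof.
by rewrite /Y; case: (X t w) => [x|] //=; have := coord_ge b x; lra.
Qed.

Lemma measurable_Y b t : 0 <= t -> measurable_fun setT (Y b t).
Proof.
move=> t0; apply: measurable_gt => c; have [c2|c2] := leP (-2) c.
  by apply: (F_meas t0); exact: ltY_F.
rewrite (_ : [set _ | _] = setT) //; apply/seteqP; split => // w _ /=.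
exact: lt_le_trans (Y_ge b t w).
Qed.

Lemma start_ae x : E x -> {ae P (Some x), forall w, X 0 w = Some x}.
Proof.
move=> Ex; have eq1 : [set w | X 0 w = Some x] = X 0 @^-1` (emb E @^-1` [set emb E (Some x)]).
  apply/seteqP; split => w /= => [->//|].
  by move/(emb_inj Ex (hunt_values HP w (lexx 0))).
have m0 : measurable [set w | X 0 w = Some x].
  rewrite eq1; apply: (@F_meas 0) => //; apply: (hunt_adapted HP) => //.
  exact: emb_borel.
exists (~` [set w | X 0 w = Some x]); split => //; first exact: measurableC.
have P1 := hunt_normal HP (x := Some x) Ex.
by rewrite probability_setC // P1 subee.
Qed.

(** Live coordinates are at least [-1] and the cemetery has [-2]: right-continuity with tolerance 1
    leaves no room for dying at once. *)
Lemma lifetime_gt w t v : 0 <= t -> X t w = Some v -> (t%:E < lifetime X w)%E.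
Proof.
move=> t0 Xt; have [dl dl0 H] := @Y_rc true w t 1 t0 ltr01.
apply: (@lt_le_trans _ _ (t + dl)%:E); first by rewrite lte_fin ltrDl.
apply/ereal_infP => _ /= [s [s0 Xs] <-]; rewrite lee_fin leNgt; apply/negP => st.
have [ts|st'] := leP t s; last by have := dead_le s0 (ltW st') Xs; rewrite Xt.
have := H s ts st; rewrite /Y Xs Xt /= ltr_norml => /andP[h _].
by have := coord_ge true v; rewrite /coord /= => h'; lra.
Qed.

(** The point to exclude is a left limit at the cemetery when the path is alive at [t]. An isolated
    cemetery is far from the earlier live positions. A cemetery read by [ext] as a missing end of
    [E] has points of [E] between itself and [X t w], and these would be skipped. *)
Lemma skip_ae x : E x ->
  {ae P (Some x), forall w, forall t s1 v, 0 < t -> (t%:E < lifetime X w)%E ->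
        in_state E s1 -> (fun u => emb E (X u w)) @ t^'- --> emb E s1 ->
        X t w = Some v ->
        forall z, E z ->
          ~ ((Order.min (ext E s1) v < z)%E /\ (z < Order.max (ext E s1) v)%E)} ->
  {ae P (Some x), forall w, forall t v', 0 < t -> X t w = Some v' ->
     exists v, [/\ E v, forall b, leftlim (fun u => Y b u w) t (coord b v) &
       forall b z, E z -> ~ (coord b v < coord b z < coord b v') /\
                          ~ (coord b v' < coord b z < coord b v)]}.
Proof.
move=> Ex SF; have LL := hunt_left_limits HP (x := Some x) Ex.
apply: filterS2 SF LL => w SF LL t v' t0 Xt.
have t0' := ltW t0.
have [s1 [Es1 cv]] := LL t t0.
have Ev' := valE t0' Xt.
have {}SF := SF t s1 v' t0 (lifetime_gt t0' Xt) Es1 cv Xt.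
case: s1 Es1 cv SF => [v|] Ev cv SF.
  exists v; split => //; first by move=> b; exact: Y_left.
  move=> b z Ez; have := SF z Ez; rewrite /= => h.
  split=> /andP[h1 h2]; apply: h; rewrite gt_min lt_max; move: h1 h2; rewrite /coord;
    case: b; rewrite ?ltrN2 !lt_contract => -> ->; by rewrite ?orbT.
exfalso; case: (asboolP (E (lE E))) => El.
  case: (asboolP (E (rE E))) => Er.
    have [dl dl0 H] := X_left t0' ltr01 cv.
    pose u := Num.max 0 (t - dl / 2).
    have u0 : 0 <= u by rewrite le_max lexx.
    have ut : u < t by rewrite gt_max t0 /= ltrBlDr ltrDl divr_gt0.
    have du : t - dl < u by rewrite lt_max; apply/orP; right; lra.
    have [y Ey Xu] := alive_le u0 (ltW ut) Xt.
    have := H u u0 du ut; rewrite Xu /emb !hcompE (asboolT El) (asboolT Er) /=.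
    move=> [/= + _]; rewrite /ball /= ltr_norml => /andP[_ h].
    by have := contract_le1 y; rewrite ler_norml => /andP[_ ?]; lra.
  have vr := lt_rE Er Ev'.
  have [z Ez vz] := ereal_sup_gt vr.
  apply: (SF z Ez); rewrite /= (asboolT El); split.
    by rewrite gt_min vz orbT.
  by rewrite lt_max lt_rE.
have vl := lE_lt El Ev'.
have [z Ez vz] := ereal_inf_lt vl.
apply: (SF z Ez); rewrite /= (asboolF El); split.
  by rewrite gt_min lE_lt.
by rewrite lt_max vz orbT.
Qed.

End Paths.

(* [lra] does not accept extended-real equations in the context. *)
Ltac rlra := repeat match goal with H : @eq (\bar _) _ _ |- _ => clear H end; lra.

Lemma null_ae {d} {T : measurableType d} {R : realType} (mu : {measure set T -> \bar R})
  (A : set T) : measurable A -> mu A = 0%E -> {ae mu, forall w, ~ A w}.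
Proof. by move=> mA A0; exists A; split => // w /= /contrapT. Qed.

Lemma cvg_ereal_below {R : realType} (u : nat -> \bar R) (l : \bar R) :
  (0 <= l)%E -> (\forall n \near \oo, (u n <= l)%E) ->
  (forall a : R, (a%:E < l)%E -> \forall n \near \oo, (a%:E < u n)%E) ->
  u @ \oo --> l.
Proof.
case: l => [l||] // l0 ul lu; last by apply/cvgeyPgt => a; apply: lu; rewrite ltry.
apply/fine_cvgP; split.
  have := lu (l - 1); rewrite lte_fin ltrBlDr ltrDl ltr01 => /(_ isT).
  by apply: filterS2 ul => n; case: (u n).
apply/cvgrPdist_lt => e e0; have := lu (l - e).
rewrite lte_fin ltrBlDr ltrDl => /(_ e0); apply: filterS2 ul => n /=.
case: (u n) => [r| |] //; rewrite lee_fin lte_fin /= => h1 h2.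
by rewrite ger0_norm ?subr_ge0 //; rlra.
Qed.

(** * Hitting times *)

Section Passage.
Context {R : realType} {E : set (\bar R)}
  {d : measure_display} {Omega : measurableType d}
  {F : R -> set (set Omega)} {theta : R -> Omega -> Omega}
  {X : R -> Omega -> @state R} {P : @state R -> probability Omega R}.
Hypothesis HP : hunt_process E F theta X P.

Let Y b t w := coordS b (X t w).

(** If death has positive probability, (SK) makes the cemetery the left limit at the lifetime. A
    path confined to [[a,b]] has that left limit in a compact set which misses the cemetery. *)
Lemma no_death_inside :
  ((exists x, E x /\ (0 < P (Some x) [set w | (lifetime X w < +oo)%E])%E) ->
     (~ E (lE E) \/ ~ E (rE E)) /\
     forall x, E x ->
       {ae P (Some x), forall w, (lifetime X w < +oo)%E ->
          forall s1, in_state E s1 ->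
          (fun u => emb E (X u w)) @ (fine (lifetime X w))^'- --> emb E s1 ->
          s1 = None}) ->
  forall x, E x -> {ae P (Some x), forall w, forall a b, E a -> E b ->
     (forall u, 0 <= u -> X u w <> None -> contract a <= Y true u w <= contract b) ->
     forall u, 0 <= u -> X u w <> None}.
Proof.
move=> SK x Ex.
have lifeE w u : 0 <= u -> X u w = None -> (lifetime X w <= u%:E)%E.
  by move=> u0 Xu; apply: ge_ereal_inf; exists u%:E => //; exists u.
have [p0|p0] := eqVneq (P (Some x) [set w | (lifetime X w < +oo)%E]) 0%E.
  have mA : measurable [set w | (lifetime X w < +oo)%E].
    (* By absorption, death is visible at integer times, and being alive is the condition
       [-2 < Y]. *)
    rewrite (_ : [set _ | _] = \bigcup_(n in [set: nat]) (~` [set w | -2 < Y true n%:R w])).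
      apply: bigcup_measurable => n _; apply: measurableC.
      by apply: (F_meas HP (ler0n R n)); exact: (ltY_F HP true (ler0n R n) (lexx _)).
    apply/seteqP; split => [w /= /ereal_inf_lt[_ [t [t0 Xt] <-] _]|w [n _ /= h]].
      have tn : t <= (Num.trunc t).+1%:R by apply: ltW; exact: truncnS_gt.
      exists (Num.trunc t).+1 => //=.
      by rewrite /Y (dead_le HP t0 tn Xt) /= ltxx.
    have Xn : X n%:R w = None.
      case Xn : (X n%:R w) => [v|//]; exfalso; apply: h; rewrite /Y Xn /=.
      by have := contract_le1 v; rewrite ler_norml => /andP[? ?]; rlra.
    by apply: le_lt_trans (lifeE _ _ (ler0n R n) Xn) _; rewrite ltry.
  apply: filterS (null_ae mA p0) => w h a b _ _ _ u u0 Xu; apply: h.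
  by apply: le_lt_trans (lifeE _ _ u0 Xu) _; rewrite ltry.
have p0' : (0 < P (Some x) [set w | (lifetime X w < +oo)%E])%E by rewrite lt0e p0 measure_ge0.
have [nE /(_ x Ex) SKx] := SK (ex_intro _ x (conj Ex (p0'))).
have LL := hunt_left_limits HP (x := Some x) Ex.
apply: filterS3 SKx LL (start_ae HP Ex) => w SKw LL X0 a b Ea Eb H u u0 Xu.
have ltu : (lifetime X w < +oo)%E by apply: le_lt_trans (lifeE _ _ u0 Xu) _; rewrite ltry.
have lt0 : (0 < lifetime X w)%E := lifetime_gt HP (lexx 0) X0.
have := SKw ltu.
case lz : (lifetime X w) lt0 => [z||] // z0; last by rewrite lz in ltu.
rewrite lte_fin in z0; rewrite /=.
have [s1 [Es1 cv]] := LL z z0.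
move=> /(_ s1 Es1 cv) s1E; rewrite {}s1E {Es1} in cv.
pose K : set (R * R) := embc E @` `[contract a, contract b].
have cK : closed K.
  apply: compact_closed; first exact: norm_hausdorff.
  apply: continuous_compact; last exact: segment_compact.
  by apply: continuous_subspaceT; exact: embc_continuous.
have : K (emb E None).
  apply: (closed_cvg (F := z^'-) (u_ := fun u => emb E (X u w))) cK _ _ cv.
  near=> t.
  have t0 : 0 <= t by apply: ltW; near: t; exact: nbhs_left_gt.
  have tz : t < z by near: t; exact: nbhs_left_lt.
  have Xt : X t w <> None.
    by move=> /(lifeE _ _ t0); rewrite lz lee_fin leNgt tz.
  have := H t t0 Xt; rewrite /Y; case: (X t w) Xt => // v _ /= h.
  by exists (contract v); rewrite ?emb_Some //= in_itv.
move=> [c]; rewrite /= in_itv /= => /andP[ac cb]; apply: emb_None_neq.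
- by move=> [? ?]; case: nE.
- by move=> nl; apply: lt_le_trans ac; rewrite lt_contract; exact: lE_lt.
- by move=> nr; apply: le_lt_trans cb _; rewrite lt_contract; exact: lt_rE.
Unshelve. all: by end_near. Qed.

(** The inequality is strict so that, by right-continuity, an entry is witnessed at rational
    times. *)
Definition entry b c w : \bar R :=
  ereal_inf [set t%:E | t in [set t | 0 <= t /\ c < Y b t w]].

Lemma entry_ge0 b c w : (0 <= entry b c w)%E.
Proof. by apply/ereal_infP => _ [t [t0 _] <-]; rewrite lee_fin. Qed.

Lemma entry_le b c w t : 0 <= t -> c < Y b t w -> (entry b c w <= t%:E)%E.
Proof. by move=> t0 ct; apply: ge_ereal_inf; exists t%:E => //; exists t. Qed.

Lemma entry_attained b c w t : entry b c w = t%:E -> c <= Y b t w.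
Proof.
move=> h; have t0 : 0 <= t by rewrite -lee_fin -h entry_ge0.
rewrite leNgt; apply/negP => lt; have e0 : 0 < c - Y b t w by rewrite subr_gt0.
have [dl dl0 H] := Y_rc HP b w t0 e0.
have : (entry b c w < (t + dl)%:E)%E by rewrite h lte_fin ltrDl.
move=> /ereal_inf_lt[_ [s [s0 cs] <-]]; rewrite lte_fin => sdl.
have ts : t <= s by rewrite -lee_fin -h; exact: entry_le.
have := H s ts sdl; rewrite ltr_norml -/(Y b s w) -/(Y b t w) => /andP[_ ?]; rlra.
Qed.

(** The event [entry < v] is a countable union over rational times before [v]; passing from [<] to
    [<=] costs an arbitrarily small delay, which the right-continuity of the filtration absorbs. *)
Lemma entry_stopping b c : -2 <= c -> stopping_time F (entry b c).
Proof.
move=> c2; split=> [w|t t0]; first exact: entry_ge0.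
apply: (F_right HP) => // u tu; have u0 : 0 <= u by exact: le_trans (ltW tu).
have lts v : 0 < v -> v <= u -> F u [set w | (entry b c w < v%:E)%E].
  move=> v0 vu.
  have -> : [set w | (entry b c w < v%:E)%E] = \bigcup_(q in [set q : rat | 0 <= (ratr q : R) < v]) [set w | c < Y b (ratr q) w]; last first.
    apply: (sigma_bigcup_rat (sigmaF HP u0)) => q /andP[q0 qv].
    by apply: (F_mono HP q0 _ (ltY_F HP b q0 c2)); apply: ltW; exact: lt_le_trans vu.
  apply/seteqP; split => [w /= /ereal_inf_lt[_ [s [s0 cs] <-]]|w [q /= /andP[q0 qv] cq]].
    rewrite lte_fin => sv; have e0 : 0 < Y b s w - c by rewrite subr_gt0.
    have [dl dl0 H] := Y_rc HP b w s0 e0.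
    have [q /andP[q1 q2]] : exists q : rat, s < ratr q < Num.min v (s + dl).
      by apply: rat_between; rewrite lt_min sv ltrDl.
    move: q2; rewrite lt_min => /andP[q2 q3]; exists q => /=.
      by rewrite q2 (le_trans s0 (ltW q1)).
    have := H _ (ltW q1) q3; rewrite ltr_norml -/(Y b s w) -/(Y b (ratr q) w) => /andP[? _]; rlra.
  by apply: le_lt_trans (entry_le q0 cq) _; rewrite lte_fin.
rewrite [X in F u X](_ : _ = \bigcap_(n in [set: nat]) [set w | (entry b c w < (t + (u - t) * n.+1%:R^-1)%:E)%E]).
  apply: (sigma_bigcap (sigmaF HP u0)) => n; have n0 : 0 < n.+1%:R^-1 :> R by rewrite invr_gt0.
  have n1 : n.+1%:R^-1 <= 1 :> R by rewrite invf_le1 // ler1n.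
  move: (n.+1%:R^-1 : R) n0 n1 => q n0 n1.
  have h1 : 0 < (u - t) * q by rewrite mulr_gt0 ?subr_gt0.
  have h2 : (u - t) * q <= u - t by rewrite ler_piMr // subr_ge0 ltW.
  move: ((u - t) * q) h1 h2 => p h1 h2.
  by apply: lts; rlra.
apply/seteqP; split => [w /= h n _ /=|w h /=].
  by apply: le_lt_trans h _; rewrite lte_fin ltrDl mulr_gt0 ?subr_gt0 // invr_gt0.
have hu : 0 < u - t by rewrite subr_gt0.
apply/lee_addgt0Pr => e e0; have [n hn] := invS_lt (divr_gt0 e0 hu).
apply: ltW; apply: lt_le_trans (h n I) _; rewrite -EFinD lee_fin lerD2l mulrC.
by rewrite -ler_pdivlMr // ltW.
Qed.

Lemma hitting_ge0 y w : (0 <= hitting X y w)%E.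
Proof. by apply/ereal_infP => _ [t [t0 _] <-]; rewrite lee_fin ltW. Qed.

Lemma hitting_le y w t : 0 < t -> X t w = Some y -> (hitting X y w <= t%:E)%E.
Proof. by move=> t0 Xt; apply: ge_ereal_inf; exists t%:E => //; exists t. Qed.

(** Visits to [y] occur at times decreasing to [t], or at [t] itself, and right-continuity transfers
    the value [y] to time [t]. *)
Lemma hitting_attained y w t : hitting X y w = t%:E -> X t w = Some y.
Proof.
move=> h; have t0 : 0 <= t by rewrite -lee_fin -h hitting_ge0.
apply: (@coordS_Some _ true); apply/eqP; rewrite -subr_eq0 -normr_eq0 eq_le normr_ge0 andbT.
apply/ler_addgt0Pr => e e0; rewrite add0r.
have [dl dl0 H] := Y_rc HP true w t0 e0.
have : (hitting X y w < (t + dl)%:E)%E by rewrite h lte_fin ltrDl.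
move=> /ereal_inf_lt[_ [s [s0 Xs] <-]]; rewrite lte_fin => sdl.
have ts : t <= s by rewrite -lee_fin -h; exact: hitting_le.
by have := H s ts sdl; rewrite Xs /= distrC => /ltW.
Qed.

Lemma hitting_neq y z w : y <> z -> (hitting X y w < +oo)%E ->
  hitting X y w <> hitting X z w.
Proof.
move=> yz; have := hitting_ge0 y w.
case h : (hitting X y w) => [t||] // _ _ /esym hz; apply: yz.
have := hitting_attained h; rewrite (hitting_attained hz) => -[] //.
Qed.

Definition skip_path w := forall t v', 0 < t -> X t w = Some v' ->
     exists v, [/\ E v, forall b, leftlim (fun u => Y b u w) t (coord b v) &
       forall b z, E z -> ~ (coord b v < coord b z < coord b v') /\
                          ~ (coord b v' < coord b z < coord b v)].

Let lev b y (n : nat) : R := coord b y - n.+1%:R^-1.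

Lemma lev_lt b y n : lev b y n < coord b y.
Proof. by rewrite /lev ltrBlDr ltrDl invr_gt0. Qed.

Lemma lev_cvg b y (c : R) : c < coord b y -> exists n, c < lev b y n.
Proof.
move=> h; have /invS_lt[n hn] : 0 < coord b y - c by rewrite subr_gt0.
by exists n; rewrite /lev ltrBrDr -ltrBrDl.
Qed.

Lemma lev_mono b y n m : (n <= m)%N -> lev b y n <= lev b y m.
Proof. by move=> nm; rewrite lerB // lef_pV2 ?posrE // ler_nat. Qed.

Lemma lev_ge b y n : -2 <= lev b y n.
Proof.
have := coord_ge b y; have : n.+1%:R^-1 <= 1 :> R by rewrite invf_le1 // ler1n.
by rewrite /lev; set q := _^-1; rlra.
Qed.

Lemma entry_mono b c c' w : c <= c' -> (entry b c w <= entry b c' w)%E.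
Proof.
move=> cc; apply: ereal_inf_le_tmp => _ [t [t0 ct] <-]; exists t => //; split => //.
exact: le_lt_trans ct.
Qed.

(* The entry times into [lev b y n] announce the hitting time of [y]: at their
   limit the process either arrives continuously (quasi-left-continuity) or
   jumps, and a jump cannot pass over [y]. *)
Lemma hitting_announced b x y : {ae P (Some x), forall w, skip_path w} ->
  E x -> E y -> coord b x < coord b y ->
  {ae P (Some x), forall w,
     hitting X y w = ereal_sup (range (fun n => entry b (lev b y n) w))}.
Proof.
move=> SF Ex Ey xy.
pose sg w := ereal_sup (range (fun n => entry b (lev b y n) w)).
have le_sg w n : (entry b (lev b y n) w <= sg w)%E.
  by apply: ereal_sup_ubound; exists n.
have sg_ge0 w : (0 <= sg w)%E by apply: le_trans (entry_ge0 b (lev b y 0) w) _.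
have st_sg : stopping_time F sg.
  split => // t t0.
  rewrite [X in F t X](_ : _ = \bigcap_(n in [set: nat]) [set w | (entry b (lev b y n) w <= t%:E)%E]).
    apply: (sigma_bigcap (sigmaF HP t0)) => n.
    by have [_] := entry_stopping b (lev_ge b y n); apply.
  apply/seteqP; split => [w /= h n _ /=|w h /=]; first exact: le_trans h.
  by apply/ereal_supP => _ [n _ <-]; exact: h.
have mono w n : (entry b (lev b y n) w <= entry b (lev b y n.+1) w)%E.
  by apply: entry_mono; exact: lev_mono.
have mono2 w n m : (n <= m)%N -> (entry b (lev b y n) w <= entry b (lev b y m) w)%E.
  by move=> nm; apply: entry_mono; exact: lev_mono.
have QL := @hunt_quasi_left_continuous _ _ _ _ _ _ _ _ HP (Some x)
  (fun n => entry b (lev b y n)) sg Ex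
  (fun n => entry_stopping b (lev_ge b y n)) st_sg mono
  (fun w => ereal_nondecreasing_cvgn (mono2 w)).
apply: filterS3 QL SF (start_ae HP Ex) => w QL SF X0.
apply/eqP; rewrite eq_le; apply/andP; split; last first.
  apply/ereal_supP => _ [n _ <-]; apply/ereal_infP => _ [t [t0 Xt] <-].
  by apply: entry_le; rewrite ?ltW // /Y Xt /= lev_lt.
rewrite -/(sg w); case sz : (sg w) (sg_ge0 w) => [z||] // z0; last by rewrite leey.
rewrite lee_fin in z0.
(* From index [N] on the levels lie above the starting point, so that these entries take a positive
   time. *)
have [N xN] := lev_cvg xy.
have fin n : exists2 t, 0 <= t <= z & entry b (lev b y n) w = t%:E.
  have := le_sg w n; rewrite sz; have := entry_ge0 b (lev b y n) w.
  by case: (entry _ _ _) => [t||] //; rewrite !lee_fin => t0 tz; exists t => //; rewrite t0.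
have z0' : 0 < z.
  rewrite lt_neqAle z0 andbT; apply/negP => /eqP z0'.
  have [t] := fin N; rewrite -z0' => /le_anti <- /entry_attained.
  by rewrite /Y X0 /=; rlra.
apply: contrapT => nle.
have noty u : 0 < u -> u <= z -> X u w <> Some y.
  move=> u0 uz Xu; apply: nle; apply: le_trans (hitting_le u0 Xu) _.
  by rewrite lee_fin.
have below u : 0 <= u -> u < z -> Y b u w < coord b y.
  move=> u0 uz; rewrite ltNge; apply/negP => yu.
  suff : (sg w <= u%:E)%E by rewrite sz lee_fin leNgt uz.
  apply/ereal_supP => _ [n _ <-]; apply: entry_le => //.
  exact: lt_le_trans (lev_lt b y n) yu.
(* A value at or above these levels cannot be the cemetery. *)
have levN2 n : (N <= n)%N -> -1 < lev b y n.
  move=> Nn; apply: le_lt_trans (coord_ge b x) _; apply: (lt_le_trans xN).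
  exact: lev_mono.
(* If all entries precede [z], the coordinates at these entries are squeezed between [lev b y n] and
   [coord b y], and quasi-left-continuity forces [X z w = Some y]. *)
have [alllt|] := pselect (forall n, (entry b (lev b y n) w < z%:E)%E).
  apply: (noty z) => //; apply: (emb_inj Ey); first exact: (hunt_values HP).
  have := QL; rewrite sz ltry => /(_ isT) /= cv.
  apply: (cvg_unique _ cv) => /=; first exact: norm_hausdorff.
  rewrite emb_Some.
  have -> : contract y = if b then coord b y else - coord b y.
    by rewrite /coord; case: b {sg le_sg sg_ge0 st_sg mono mono2 QL sz xy fin xN levN2 noty nle below alllt cv N}; rewrite ?opprK.
  pose tn n := fine (entry b (lev b y n) w).
  have tnE n : entry b (lev b y n) w = (tn n)%:E.
    by rewrite /tn; have [t _ ->] := fin n.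
  have tnI n : 0 <= tn n < z.
    have := alllt n; rewrite tnE lte_fin => ->; rewrite andbT.
    by have [t /andP[? _]] := fin n; rewrite tnE => -[->].
  have cY : (fun n => Y b (tn n) w) @ \oo --> coord b y.
    apply/cvgrPdist_lt => e e0.
    have [M hM] : exists M, coord b y - e < lev b y M by apply: lev_cvg; rlra.
    exists M => // n /= Mn; have /andP[t0 tz] := tnI n.
    have h1 := below _ t0 tz; have h2 := entry_attained (tnE n).
    have h3 := lev_mono b y Mn; rewrite ger0_norm; rlra.
  have cE : (fun n => embc E (if b then Y b (tn n) w else - Y b (tn n) w)) @ \oo -->
     embc E (if b then coord b y else - coord b y).
    apply: (@continuous_cvg _ _ _ _ _ _ (embc E)); first exact: embc_continuous.
    by case: (b) cY => // cY; exact: cvgN.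
  apply: cvg_trans cE; apply: near_eq_cvg; exists N => // n /= Nn.
  rewrite tnE /=; have h2 := entry_attained (tnE n); have h1 := levN2 _ Nn.
  move: h2; rewrite /Y; case: (X (tn n) w) => [v|] /=; last by move=> h2; exfalso; rlra.
  by rewrite emb_Some /coord; case: (b) => //; rewrite opprK.
(* Otherwise the entries are eventually equal to [z]: the path jumps at [z], to a point at or beyond
   [y]. *)
move=> /existsNP[M /negP]; rewrite -leNgt => hM.
have entz n : (M <= n)%N -> entry b (lev b y n) w = z%:E.
  move=> Mn; apply/eqP; rewrite eq_le -{1}sz le_sg /=; apply: le_trans hM _.
  exact: mono2.
have Yz : coord b y <= Y b z w.
  rewrite leNgt; apply/negP => h; have [K hK] := lev_cvg h.
  have := entry_attained (entz (maxn M K) (leq_maxl _ _)).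
  by have := lev_mono b y (leq_maxr M K); rlra.
have [v Xz] : exists v, X z w = Some v.
  by apply: (@coordS_alive _ b _ (-2)) => //; rewrite -/(Y b z w); have := coord_ge b y; rlra.
have yv : coord b y < coord b v.
  rewrite lt_neqAle; move: Yz; rewrite /Y Xz /= => ->; rewrite andbT.
  by apply/eqP => /coord_inj h; apply: (noty z) => //; rewrite h.
(* The jump ends strictly beyond [y], so its left limit cannot be short of [y]. But then level
   [lev b y M] was exceeded before [z]. *)
have [v1 [Ev1 ll noE]] := SF z v z0' Xz.
have v1y : coord b y <= coord b v1.
  rewrite leNgt; apply/negP => h; have [+ _] := noE b y Ey.
  by apply; rewrite h yv.
have e0 : 0 < M.+1%:R^-1 :> R by rewrite invr_gt0.
have [dl dl0 H] := ll b _ e0.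
pose u := Num.max 0 (z - dl / 2).
have u0 : 0 <= u by rewrite le_max lexx.
have uz : u < z by rewrite gt_max z0' /= ltrBlDr ltrDl divr_gt0.
have du : z - dl < u by rewrite lt_max; apply/orP; right; rlra.
have := H u u0 du uz; rewrite ltr_norml => /andP[h _].
have : (entry b (lev b y M) w <= u%:E)%E.
  apply: entry_le => //; rewrite ltrBrDr addrC in h.
  by apply: le_lt_trans h; rewrite /lev lerB.
by rewrite entz // lee_fin leNgt uz.
Qed.
End Passage.

Lemma measurable_bool {d} {T : measurableType d} {R : realType} (b : T -> bool) :
  measurable_fun setT b -> measurable_fun setT (fun x => (b x)%:R : R).
Proof.
move=> mb; rewrite (_ : (fun x => _) = (fun x => if b x then 1 else 0)).
  by apply: measurable_fun_ifT => //; exact: measurable_cst.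
by apply/funext => x; case: (b x).
Qed.

(** * Discounted occupation *)

Section TimeIntegral.
Context {R : realType}.
Implicit Types (s q : R) (phi : R -> \bar R).
Notation mu := (@lebesgue_measure R).

Lemma lebesgue_measure_shift s (A : set R) : measurable A ->
  mu ((fun t => s + t) @^-1` A) = mu A.
Proof.
move=> mA.
pose f (t : measurableTypeR R) : measurableTypeR R := s + t.
have mf : measurable_fun setT f by apply: measurable_funD => //; exact: measurable_cst.
pose m' := (pushforward mu f : measure (measurableTypeR R) R); pose m := m' mf.
suff H X : ocitv X -> mu X = m X by have := lebesgue_measure_unique H mA => ->.
move=> [[a b] _ <-] /=; rewrite /m /m' /pushforward /=.
rewrite [X in _ = mu X](_ : _ = `](a - s), (b - s)]%classic); last first.
  by apply/seteqP; split => t /=; rewrite !in_itv /= /f => /andP[? ?]; apply/andP; split; lra.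
rewrite !lebesgue_measure_itv /= !lte_fin ltrD2r; case: ifP => // _.
by rewrite -!EFinB; congr (_%:E); lra.
Qed.

Lemma integral_shift s phi : measurable_fun setT phi -> (forall t, 0 <= phi t)%E ->
  (\int[mu]_t phi (s + t)%R = \int[mu]_t phi t)%E.
Proof.
move=> mphi phi0.
pose f (t : measurableTypeR R) : measurableTypeR R := s + t.
have mf : measurable_fun setT f by apply: measurable_funD => //; exact: measurable_cst.
pose m' := (pushforward mu f : measure (measurableTypeR R) R); pose m := m' mf.
have := @ge0_integral_pushforward _ _ _ _ _ _ mf mu setT phi measurableT mphi (fun t _ => phi0 t).
rewrite preimage_setT => <-.
apply: (@eq_measure_integral _ _ _ _ _ m) => A mA _.
exact: (lebesgue_measure_shift s mA).
Qed.

Lemma pdf_shift q s t : 0 <= s -> 0 <= t ->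
  exponential_pdf q (s + t) = expR (- (q * s)) * exponential_pdf q t.
Proof.
move=> s0 t0; rewrite !exponential_pdfE ?addr_ge0 //.
by rewrite mulNr mulrDr opprD expRD mulNr; ring.
Qed.

(** The memoryless property of the exponential law: shifting by [s] costs the factor [exp(-q s)]. *)
Lemma integral_pdf_shift q s phi : 0 < q -> 0 <= s -> measurable_fun setT phi ->
  (forall t, 0 <= phi t)%E -> (forall t, (t < s)%R -> phi t = 0%E) ->
  (\int[mu]_t ((exponential_pdf q t)%:E * phi t) =
   (expR (- (q * s))%R)%:E * \int[mu]_t ((exponential_pdf q t)%:E * phi (s + t)%R))%E.
Proof.
move=> q0 s0 mphi phi0 phis.
have pdf0 t : (0 <= (exponential_pdf q t)%:E)%E by rewrite lee_fin exponential_pdf_ge0 // ltW.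
have mpdf : measurable_fun setT (fun t : R => (exponential_pdf q t)%:E).
  by apply/measurable_EFinP; exact: measurable_exponential_pdf.
rewrite -(integral_shift s); last 2 first.
- exact: emeasurable_funM.
- by move=> t; rewrite mule_ge0.
rewrite -ge0_integralZl //; last 2 first.
- apply: emeasurable_funM => //; apply: (measurableT_comp mphi).
  by apply: measurable_funD => //; exact: measurable_cst.
- by move=> t _; rewrite mule_ge0.
apply: eq_integral => t _; rewrite muleA -EFinM.
have [t0|t0] := leP 0 t; first by rewrite pdf_shift.
by rewrite phis ?mule0 //; lra.
Qed.

Lemma integral_pdf_ge q s : 0 < q -> 0 <= s ->
  (\int[mu]_t (exponential_pdf q t * (s <= t)%R%:R)%:E = (expR (- (q * s))%R)%:E)%E.
Proof.
move=> q0 s0.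
under eq_integral do rewrite EFinM.
rewrite (@integral_pdf_shift q s (fun t => (s <= t)%R%:R%:E)) //; last 2 first.
- apply/measurable_EFinP; apply: measurable_bool.
  by apply: measurable_fun_ler => //; exact: measurable_cst.
- by move=> t ts; rewrite leNgt ts.
rewrite -[RHS]mule1 -(integral_exponential_pdf q0); congr (_ * _)%E.
apply: eq_integral => t _; have [t0|t0] := leP 0 t; first by rewrite lerDl t0 mule1.
by rewrite lt0_exponential_pdf // mul0e.
Qed.

(** The discount [exp(-q T)] with [exp(-oo) = 0]; the value at [-oo] is a default, as times are
    nonnegative. *)
Definition ex q (T : \bar R) : R := if T is t%:E then expR (- (q * t)) else 0.

Lemma ex_ge0 q T : 0 <= ex q T.
Proof. by case: T => //= t; exact: expR_ge0. Qed.

Lemma ex_le1 q T : 0 <= q -> (0 <= T)%E -> ex q T <= 1.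
Proof.
move=> q0; case: T => //= t t0; rewrite -[leRHS]expR0 ler_expR oppr_le0 mulr_ge0 //.
Qed.

Lemma measurable_ex q : measurable_fun setT (ex q).
Proof.
apply: measurable_gt => c; have [c0|c0] := leP 0 c; last first.
  rewrite (_ : [set _ | _] = setT) //; apply/seteqP; split => // T _ /=.
  exact: lt_le_trans (ex_ge0 q T).
rewrite (_ : [set _ | _] = EFin @` [set t | c < expR (- (q * t))]).
  apply: measurable_image_EFin.
  have mf : measurable_fun setT (fun t : R => expR (- (q * t))).
    apply: measurableT_comp; first exact: measurable_expR.
    by apply: measurable_funN; apply: measurable_funM => //; exact: measurable_cst.
  have := mf measurableT _ (measurable_itv `]c, +oo[); rewrite setTI.
  rewrite (_ : _ @^-1` _ = [set t | c < expR (- (q * t))]) //.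
  by apply/seteqP; split => t /=; rewrite in_itv /= andbT.
apply/seteqP; split => [[t||]|_ [t ct <-]] //=; last 2 first.
- by rewrite ltNge c0.
- by rewrite ltNge c0.
by move=> h; exists t.
Qed.

(** The discount is the probability that an exponential clock rings at or after [T]; it is thus
    expressed through the conditions [T <= t]. *)
Lemma exE q T : 0 < q -> (0 <= T)%E ->
  (\int[mu]_t (exponential_pdf q t * (T <= t%:E)%E%:R)%:E = (ex q T)%:E)%E.
Proof.
move=> q0; case: T => [s||] //= s0.
  by under eq_integral do rewrite lee_fin; exact: integral_pdf_ge.
by apply: integral0_eq => t _; rewrite /= mulr0.
Qed.

(** The least multiple of [1/(n+1)] strictly greater than [t]: a countably valued approximation of
    [t] from the right. *)
Definition grid (n : nat) (t : R) : R := ((Num.floor (t * n.+1%:R))%:~R + 1) / n.+1%:R.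

Lemma grid_gt n t : t < grid n t.
Proof.
rewrite /grid ltr_pdivlMr ?ltr0n //; have := floorD1_gt (t * n.+1%:R).
by rewrite intrD.
Qed.

Lemma grid_le n t : grid n t <= t + n.+1%:R^-1.
Proof.
rewrite /grid mulrDl mul1r lerD2r ler_pdivrMr ?ltr0n //.
exact: floor_le.
Qed.

(** On each strip where the floor is [k], the rounded time is constant, so measurability at fixed
    times is enough. *)
Lemma measurable_grid {d d'} {T : measurableType d} {U : measurableType d'}
    (Z : R -> T -> U) n :
  (forall t, measurable_fun setT (Z t)) ->
  measurable_fun setT (fun p : R * T => Z (grid n p.1) p.2).
Proof.
move=> mZ _ B mB; rewrite setTI.
pose I (k : int) : set R := [set t | Num.floor (t * n.+1%:R) = k].
have mI k : measurable (I k).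
  rewrite (_ : I k = `[k%:~R / n.+1%:R, (k + 1)%:~R / n.+1%:R[%classic); first exact: measurable_itv.
  apply/seteqP; split => t /=; rewrite in_itv /= ler_pdivrMr ?ltr0n // ltr_pdivlMr ?ltr0n //.
    by move=> <-; rewrite floor_le floorD1_gt.
  exact: floor_def.
rewrite (_ : _ @^-1` B = \bigcup_(k in [set: int]) (I k `*` (Z ((k%:~R + 1) / n.+1%:R) @^-1` B))).
  apply: countable_bigcupT_measurable => [|k]; first exact: countableP.
  by apply: measurableX => //; have := mZ ((k%:~R + 1) / n.+1%:R) measurableT B mB; rewrite setTI.
apply/seteqP; split => [[t w] /= Bz|[t w] /= [k _ [/= <-]]] //.
by exists (Num.floor (t * n.+1%:R)).
Qed.

Lemma measurable_right_cont {d} {T : measurableType d} (Z : R -> T -> R) :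
  (forall t, measurable_fun setT (Z t)) ->
  (forall w t e, 0 < e -> exists2 dl, 0 < dl &
     forall u, t <= u -> u < t + dl -> `|Z u w - Z t w| < e) ->
  measurable_fun setT (fun p : R * T => Z p.1 p.2).
Proof.
move=> mZ rc; apply: (@measurable_fun_cvg _ _ _ _ (fun n p => Z (grid n p.1) p.2)).
  by move=> n; exact: measurable_grid.
move=> [t w] _ /=; apply/cvgrPdist_lt => e e0.
have [dl dl0 H] := rc w t e e0; have [n hn] := invS_lt dl0.
exists n => // m /= nm; rewrite distrC; apply: H; first exact/ltW/grid_gt.
apply: le_lt_trans (grid_le m t) _; rewrite ltrD2l; apply: le_lt_trans hn.
by rewrite lef_pV2 ?posrE ?ltr0n // ler_nat.
Qed.
End TimeIntegral.

Lemma emeasurable_gt {R : realType} {d} {T : measurableType d} (f : T -> \bar R) :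
  (forall c : R, measurable [set w | (c%:E < f w)%E]) -> measurable_fun setT f.
Proof.
move=> mf; apply: (measurability _ (ErealGenOInfty.measurableE R)).
move=> _ [_ [x ->] <-]; rewrite setTI (_ : _ @^-1` _ = [set w | (x%:E < f w)%E]) //.
by apply/seteqP; split => w /=; rewrite in_itv /= andbT.
Qed.

Section LayerCake.
Context {R : realType} {d : measure_display} {T : measurableType d}.
Variable P : probability T R.
Notation mu := (@lebesgue_measure R).

(** Fubini applied to [exE]. It replaces the discount by the events [S <= t], which belong to the
    past of [S] and can therefore enter the strong Markov property. *)
Lemma layer_cake q (S : T -> \bar R) (g : T -> R) : 0 < q ->
  measurable_fun setT S -> (forall w, 0 <= S w)%E ->
  measurable_fun setT g -> (forall w, 0 <= g w) ->
  (\int[P]_w (ex q (S w) * g w)%:E =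
   \int[mu]_t ((exponential_pdf q t)%:E * \int[P]_w ((S w <= t%:E)%E%:R * g w)%:E))%E.
Proof.
move=> q0 mS S0 mg g0.
have pdf0 t : 0 <= exponential_pdf q t by rewrite exponential_pdf_ge0 // ltW.
have mle : measurable_fun setT (fun p : T * R => ((S p.1 <= p.2%:E)%E%:R : R)).
  apply: measurable_bool; apply: measurable_fun_lee.
    by apply: measurableT_comp => //; exact: measurable_fst.
  by apply/measurable_EFinP; exact: measurable_snd.
pose f (p : T * R) : \bar R :=
  (exponential_pdf q p.2 * (S p.1 <= p.2%:E)%E%:R * g p.1)%:E.
have mf : measurable_fun setT f.
  apply/measurable_EFinP; apply: measurable_funM.
    apply: measurable_funM => //; apply: measurableT_comp; last exact: measurable_snd.
    exact: measurable_exponential_pdf.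
  by apply: measurableT_comp => //; exact: measurable_fst.
have f0 p : (0 <= f p)%E by rewrite lee_fin !mulr_ge0.
transitivity (\int[P]_w \int[mu]_t f (w, t))%E.
  apply: eq_integral => w _; rewrite /f /=.
  under eq_integral do rewrite EFinM.
  rewrite ge0_integralZr //.
  - by rewrite exE // EFinM.
  - apply/measurable_EFinP; apply: measurable_funM; first exact: measurable_exponential_pdf.
    apply: measurable_bool; apply: measurable_fun_lee; first exact: measurable_cst.
    by apply/measurable_EFinP.
  - by move=> t _; rewrite lee_fin mulr_ge0.
  - by rewrite lee_fin.
rewrite (@fubini_tonelli _ _ _ _ _ P mu f mf f0); apply: eq_integral => t _; rewrite /f /=.
rewrite -ge0_integralZl //.
- by apply: eq_integral => w _; rewrite -EFinM mulrA.
- apply/measurable_EFinP; apply: measurable_funM => //.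
  by apply: measurable_bool; apply: measurable_fun_lee => //; exact: measurable_cst.
- by move=> w _; rewrite lee_fin mulr_ge0.
- by rewrite lee_fin.
Qed.
End LayerCake.

(** * Joint measurability of paths and the Markov property at a point *)

Section Potential.
Context {R : realType} {E : set (\bar R)}
  {d : measure_display} {Omega : measurableType d}
  {F : R -> set (set Omega)} {theta : R -> Omega -> Omega}
  {X : R -> Omega -> @state R} {P : @state R -> probability Omega R}.
Hypothesis HP : hunt_process E F theta X P.
Notation mu := (@lebesgue_measure R).

Let Y b t w := coordS b (X t w).

(* [Y] extended to negative times by the value of the cemetery *)
Definition Yp (b : bool) (t : R) (w : Omega) : R := if 0 <= t then Y b t w else -2.

Lemma measurable_Yp b t : measurable_fun setT (Yp b t).
Proof.
rewrite /Yp; have [t0|t0] := leP 0 t; last exact: measurable_cst.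
exact: (measurable_Y HP).
Qed.

Lemma Yp_joint b : measurable_fun setT (fun p : R * Omega => Yp b p.1 p.2).
Proof.
apply: (measurable_right_cont (Z := Yp b)) => [t|w t e e0].
  exact: measurable_Yp.
rewrite /Yp; have [t0|t0] := leP 0 t.
  have [dl dl0 H] := Y_rc HP b w t0 e0; exists dl => // u tu ud.
  by rewrite (le_trans t0 tu); exact: H.
exists (- t); first by rewrite oppr_gt0.
by move=> u _; rewrite subrr => u0; rewrite leNgt u0 /= subrr normr0.
Qed.

Lemma measurable_stopping S : stopping_time F S -> measurable_fun setT S.
Proof.
move=> [S0 hS]; apply: emeasurable_gt => c; have [c0|c0] := leP 0 c.
  rewrite (_ : [set _ | _] = ~` [set w | (S w <= c%:E)%E]).
    by apply: measurableC; apply: (F_meas HP c0); exact: hS.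
  by apply/seteqP; split => w /=; rewrite ltNge => /negP.
rewrite (_ : [set _ | _] = setT) //; apply/seteqP; split => // w _ /=.
by apply: lt_le_trans (S0 w); rewrite lte_fin.
Qed.

Lemma stopping_le_meas S r : stopping_time F S -> measurable [set w | (S w <= r%:E)%E].
Proof.
move=> stS; have := emeasurable_fun_infty_c measurableT (measurable_stopping stS) r%:E.
by rewrite setTI.
Qed.

Lemma F_at_le S L r : stopping_time F S -> F_at F S L ->
  F_at F S (L `&` [set w | (S w <= r%:E)%E]).
Proof.
move=> stS [mL hL]; split; first by apply: measurableI => //; exact: stopping_le_meas.
move=> t t0; rewrite -setIA.
rewrite (_ : [set w | (S w <= r%:E)%E] `&` _ = [set w | (S w <= (Num.min r t)%:E)%E]).
  have [r0|r0] := leP 0 r.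
    have m0 : 0 <= Num.min r t by rewrite le_min r0.
    by apply: (F_mono HP m0 _ (hL _ m0)); rewrite ge_min lexx orbT.
  rewrite (_ : _ `&` _ = set0); first exact: (sigma_set0 (sigmaF HP t0)).
  apply/seteqP; split => // w [_ /=]; rewrite leNgt => /negP; apply.
  case: stS => S0 _; apply: lt_le_trans (S0 w); rewrite lte_fin.
  by apply: le_lt_trans r0; rewrite ge_min lexx.
apply/seteqP; split => w /=; rewrite EFin_min le_min; first by case=> -> ->.
by move=> /andP[].
Qed.

Section AtStoppingTime.
Variables (x y : \bar R) (S : Omega -> \bar R) (L : set Omega) (b : bool) (c : R).
Hypotheses (Ex : E x) (stS : stopping_time F S) (FL : F_at F S L)
  (LS : forall w, L w -> (S w < +oo)%E /\ Xat X (S w) w = Some y) (c2 : -2 <= c).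

(** On [L] the process sits at [y] at time [S], so the integrand in the strong Markov property is
    constant. *)
Lemma markov_at_point t : 0 <= t ->
  P (Some x) (L `&` [set w | c < Yp b (fine (S w) + t) w]) =
  (P (Some y) [set w | (c < Yp b t w)%R] * P (Some x) L)%E.
Proof.
move=> t0; have [B bB HB] := @borelS_coord _ b E c c2.
have [mL _] := FL; have S0 := stS.1.
have LE : L `&` [set w | (S w < +oo)%E] = L.
  by apply/seteqP; split => [w []//|w Lw]; split => //; have [] := LS Lw.
have := hunt_strong_markov HP (x := Some x) Ex stS FL t0 bB.
rewrite LE => SM.
rewrite (_ : _ `&` _ = L `&` [set w | B (Xat X (S w + t%:E)%E w)]); last first.
  apply/seteqP; split => w [Lw /=]; have [+ _] := LS Lw; have := S0 w;
    case: (S w) => [s||] //= s0 _; have st0 : 0 <= s + t by [rewrite addr_ge0];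
    rewrite /Yp st0 => h; split => //=; apply/(HB _ (hunt_values HP w st0)) => //.
rewrite SM; transitivity (\int[P (Some x)]_(w in L) (cst (P (Some y) [set w | (c < Yp b t w)%R]) w))%E.
  apply: eq_integral => w; rewrite inE => Lw; have [_ ->] := LS Lw.
  congr (P _ _); apply/seteqP; split => v /=; rewrite /Yp t0 => /HB; apply;
  exact: (hunt_values HP).
by rewrite integral_cst.
Qed.

Lemma measurable_shifted t :
  measurable_fun setT (fun w => ((c < Yp b (fine (S w) + t) w)%R%:R : R)).
Proof.
apply: measurable_bool; apply: measurable_fun_ltr; first exact: measurable_cst.
have mp : measurable_fun setT (fun w => (fine (S w) + t, w) : R * Omega).
  apply: measurable_fun_pair; last exact: measurable_id.
  apply: measurable_funD => //; apply: measurableT_comp; first exact: fine_measurable.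
  exact: measurable_stopping.
exact: (measurableT_comp (Yp_joint b) mp).
Qed.

End AtStoppingTime.
End Potential.

Lemma indic_bool {T : Type} {R : realType} (p : T -> bool) (w : T) :
  \1_[set w | p w] w = (p w)%:R :> R.
Proof. by rewrite indicE; congr (_%:R); congr nat_of_bool; apply/idP/idP; rewrite inE. Qed.

Lemma probability_indic {d} {T : measurableType d} {R : realType} (Q : probability T R)
  (A : set T) : measurable A -> Q A = (\int[Q]_w (\1_A w)%:E)%E.
Proof. by move=> mA; rewrite integral_indic // setIT. Qed.

(** * Resolvents and discounted occupation after a stopping time *)

Section Resolvent.
Context {R : realType} {E : set (\bar R)}
  {d : measure_display} {Omega : measurableType d}
  {F : R -> set (set Omega)} {theta : R -> Omega -> Omega}
  {X : R -> Omega -> @state R} {P : @state R -> probability Omega R}.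
Hypothesis HP : hunt_process E F theta X P.
Notation mu := (@lebesgue_measure R).
Variables (q : R) (b : bool) (c : R).
Hypotheses (q0 : 0 < q) (c2 : -2 <= c).

Let Y b t w := coordS b (X t w).
Let Z := @Yp R d Omega X.

Definition occupation (w : Omega) : \bar R :=
  (\int[mu]_t (exponential_pdf q t * (c < Z b t w)%R%:R)%:E)%E.

(** [q] times the usual [q]-resolvent of the superlevel set: the probability of being above [c] at
    an independent exponential time. *)
Definition resolvent (y : \bar R) : \bar R :=
  (\int[mu]_t ((exponential_pdf q t)%:E * P (Some y) [set w | (c < Z b t w)%R]))%E.

Let J := occupation.
Let U := resolvent.

Let pdf0 t : 0 <= exponential_pdf q t.
Proof. by rewrite exponential_pdf_ge0 // ltW. Qed.

Lemma measurable_level t : measurable [set w | c < Z b t w].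
Proof.
have := measurable_Yp HP b t measurableT (measurable_itv `]c, +oo[); rewrite setTI.
by congr measurable; apply/seteqP; split => w /=; rewrite in_itv /= andbT.
Qed.

Lemma joint_level : measurable_fun setT
  (fun p : R * Omega => (exponential_pdf q p.1 * (c < Z b p.1 p.2)%R%:R)%:E).
Proof.
apply/measurable_EFinP; apply: measurable_funM.
  by apply: measurableT_comp; [exact: measurable_exponential_pdf | exact: measurable_fst].
apply: measurable_bool; apply: measurable_fun_ltr; first exact: measurable_cst.
exact: (Yp_joint HP).
Qed.

Lemma joint_level0 (p : R * Omega) :
  (0 <= (exponential_pdf q p.1 * (c < Z b p.1 p.2)%R%:R)%:E)%E.
Proof. by rewrite lee_fin mulr_ge0. Qed.

Lemma occupation_ge0 w : (0 <= J w)%E.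
Proof. by apply: integral_ge0 => t _; rewrite lee_fin mulr_ge0. Qed.

Lemma measurable_occupation : measurable_fun setT J.
Proof. exact: (@measurable_fun_fubini_tonelli_G _ _ _ _ _ mu _ joint_level joint_level0). Qed.

Lemma occupation_le1 w : (J w <= 1)%E.
Proof.
rewrite -(integral_exponential_pdf q0); apply: ge0_le_integral => //.
- by move=> t _; rewrite lee_fin mulr_ge0.
- exact: (measurable_fun_pair1 w joint_level).
- by apply/measurable_EFinP; exact: measurable_exponential_pdf.
- by move=> t _; rewrite lee_fin ler_piMr //; case: (_ < _).
Qed.

Lemma resolventE y : U y = (\int[P (Some y)]_w J w)%E.
Proof.
rewrite /U /J /occupation.
rewrite -(@fubini_tonelli _ _ _ _ _ mu (P (Some y)) _ joint_level joint_level0).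
apply: eq_integral => t _; rewrite /=.
under eq_integral do rewrite EFinM.
rewrite ge0_integralZl //; last 2 first.
- apply/measurable_EFinP; apply: measurable_bool; apply: measurable_fun_ltr => //.
  exact: (measurable_Yp HP).
- by rewrite lee_fin.
congr (_ * _)%E; rewrite probability_indic; last exact: measurable_level.
by apply: eq_integral => w _; rewrite indic_bool.
Qed.

Lemma Yp_gt_time t w : c < Z b t w -> 0 <= t.
Proof. by rewrite /Z /Yp; case: (leP 0 t) => // _; rewrite ltNge c2. Qed.

Lemma occupation_delay w s : 0 <= s -> (forall u, 0 <= u -> u < s -> Y b u w <= c) ->
  J w = ((expR (- (q * s))%R)%:E *
         \int[mu]_t (exponential_pdf q t * (c < Z b (s + t) w)%R%:R)%:E)%E.
Proof.
move=> s0 hs; rewrite /J /occupation.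
under eq_integral do rewrite EFinM.
under [in RHS]eq_integral do rewrite EFinM.
apply: (@integral_pdf_shift _ q s (fun t => ((c < Z b t w)%R%:R)%:E)) => //.
- apply/measurable_EFinP; apply: measurable_bool; apply: measurable_fun_ltr => //.
  exact: (measurable_fun_pair1 w (Yp_joint HP b)).
- move=> t ts; have [//|ct] := leP (Z b t w) c.
  by have t0 := Yp_gt_time ct; move: ct; rewrite /Z /Yp t0 ltNge hs.
Qed.

Lemma occupation_zero w : (forall u, 0 <= u -> Y b u w <= c) -> J w = 0%E.
Proof.
move=> h; apply: integral0_eq => t _; case: (ltP c (Z b t w)) => [ct|]; last by rewrite mulr0.
have t0 := Yp_gt_time ct.
by move: ct; rewrite /Z /Yp t0 ltNge h.
Qed.

(** Fubini fixes the delay [t] after [S], and [layer_cake] fixes a bound [r] on [S]. For fixed [t]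
    and [r] the claim is [markov_at_point] on [L] restricted to [S <= r]. *)
Lemma potential_finite x y S L : E x -> stopping_time F S -> F_at F S L ->
  (forall w, L w -> (S w < +oo)%E /\ Xat X (S w) w = Some y) ->
  (\int[P (Some x)]_w ((ex q (S w) * \1_L w)%:E *
      \int[mu]_t (exponential_pdf q t * (c < Z b (fine (S w) + t) w)%R%:R)%:E) =
   \int[P (Some x)]_w (ex q (S w) * \1_L w)%:E * U y)%E.
Proof.
move=> Ex stS FL LS; have [mL _] := FL; have mS := measurable_stopping HP stS.
have mex : measurable_fun setT (fun w => ex q (S w) * \1_L w).
  apply: measurable_funM; last exact: measurable_indic.
  exact: (measurableT_comp (measurable_ex q) mS).
have ex0 w : 0 <= ex q (S w) * \1_L w by rewrite mulr_ge0 // ex_ge0.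
pose f (p : Omega * R) : \bar R := (ex q (S p.1) * \1_L p.1 *
  (exponential_pdf q p.2 * (c < Z b (fine (S p.1) + p.2) p.1)%R%:R))%:E.
have mf : measurable_fun setT f.
  apply/measurable_EFinP; apply: measurable_funM.
    exact: (measurableT_comp mex measurable_fst).
  apply: measurable_funM.
    by apply: measurableT_comp; [exact: measurable_exponential_pdf | exact: measurable_snd].
  apply: measurable_bool; apply: measurable_fun_ltr => //.
  have mp : measurable_fun setT (fun p : Omega * R => (fine (S p.1) + p.2, p.1) : R * Omega).
    apply: measurable_fun_pair; last exact: measurable_fst.
    apply: measurable_funD; last exact: measurable_snd.
    apply: measurableT_comp; first exact: fine_measurable.
    by apply: measurableT_comp => //; exact: measurable_fst.
  exact: (measurableT_comp (Yp_joint HP b) mp).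
have f0 p : (0 <= f p)%E by rewrite lee_fin !mulr_ge0 // ex_ge0.
transitivity (\int[P (Some x)]_w \int[mu]_t f (w, t))%E.
  apply: eq_integral => w _; rewrite /f /=.
  under [RHS]eq_integral do rewrite EFinM.
  rewrite ge0_integralZl //.
  - apply/measurable_EFinP; apply: measurable_funM; first exact: measurable_exponential_pdf.
    apply: measurable_bool; apply: measurable_fun_ltr => //.
    have mp : measurable_fun setT (fun t : R => (fine (S w) + t, w) : R * Omega).
      by apply: measurable_fun_pair => //; exact: measurable_funD.
    exact: (measurableT_comp (Yp_joint HP b) mp).
  - by move=> t _; rewrite lee_fin mulr_ge0.
  - by rewrite lee_fin.
rewrite (@fubini_tonelli _ _ _ _ _ (P (Some x)) mu f mf f0).
rewrite muleC -ge0_integralZr //; last 3 first.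
- apply: emeasurable_funM; first by apply/measurable_EFinP; exact: measurable_exponential_pdf.
  have := @measurable_fun_fubini_tonelli_F _ _ _ _ _ (P (Some y))
    (fun p : R * Omega => ((c < Z b p.1 p.2)%R%:R)%:E).
  rewrite /fubini_F => H; apply: eq_measurable_fun (H _ _) => [t _||//].
    rewrite /= probability_indic; last exact: measurable_level.
    by apply: eq_integral => w _; rewrite indic_bool.
  apply/measurable_EFinP; apply: measurable_bool; apply: measurable_fun_ltr => //.
  exact: (Yp_joint HP).
- by move=> t _; rewrite mule_ge0 // lee_fin.
- by apply: integral_ge0 => w _; rewrite lee_fin.
apply: eq_integral => t _; rewrite /f /=.
(* The exponential density gives no mass to negative delays. *)
have [t0|t0] := leP 0 t; last first.
  rewrite lt0_exponential_pdf // !mul0e; apply: integral0_eq => w _.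
  by rewrite mul0r mulr0.
have mg := measurable_shifted HP b c stS t.
transitivity (\int[P (Some x)]_w ((exponential_pdf q t)%:E *
    (ex q (S w) * (\1_L w * (c < Z b (fine (S w) + t) w)%R%:R))%:E))%E.
  by apply: eq_integral => w _; rewrite -EFinM; congr (_%:E); ring.
rewrite ge0_integralZl //; last 3 first.
- apply/measurable_EFinP; apply: measurable_funM.
    exact: (measurableT_comp (measurable_ex q) mS).
  by apply: measurable_funM => //; exact: measurable_indic.
- by move=> w _; rewrite lee_fin !mulr_ge0 // ex_ge0.
- by rewrite lee_fin.
rewrite -muleA; congr (_ * _)%E.
have mg' : measurable_fun setT (fun w => \1_L w * (c < Z b (fine (S w) + t) w)%R%:R : R).
  by apply: measurable_funM => //; exact: measurable_indic.
have g'0 w : 0 <= \1_L w * (c < Z b (fine (S w) + t) w)%R%:R :> R by rewrite mulr_ge0.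
rewrite (layer_cake _ q0 mS stS.1 mg' g'0).
have mL1 : measurable_fun setT (\1_L : Omega -> R) by exact: measurable_indic.
have L0 w : 0 <= \1_L w :> R by [].
rewrite (layer_cake _ q0 mS stS.1 mL1 L0).
have mle r : measurable_fun setT (fun w => (S w <= r%:E)%E%:R : R).
  by apply: measurable_bool; apply: measurable_fun_lee => //; exact: measurable_cst.
rewrite -ge0_integralZl //; last 2 first.
- apply: emeasurable_funM; first by apply/measurable_EFinP; exact: measurable_exponential_pdf.
  have := @measurable_fun_fubini_tonelli_F _ _ _ _ _ (P (Some x))
    (fun p : R * Omega => ((S p.2 <= p.1%:E)%E%:R * \1_L p.2)%:E).
  rewrite /fubini_F; apply => /=; last by move=> p; rewrite lee_fin mulr_ge0.
  apply/measurable_EFinP; apply: measurable_funM.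
    apply: measurable_bool; apply: measurable_fun_lee.
      by apply: measurableT_comp => //; exact: measurable_snd.
    by apply/measurable_EFinP; exact: measurable_fst.
  by apply: measurableT_comp; [exact: measurable_indic | exact: measurable_snd].
- by move=> r _; rewrite mule_ge0 ?lee_fin //; apply: integral_ge0 => w _; rewrite lee_fin mulr_ge0.
apply: eq_integral => r _; rewrite [RHS]muleCA; congr (_ * _)%E.
(* The restricted event still belongs to the past of [S]. *)
pose L' := L `&` [set w | (S w <= r%:E)%E].
have FL' : F_at F S L' by exact: (F_at_le HP r stS FL).
have LS' w : L' w -> (S w < +oo)%E /\ Xat X (S w) w = Some y by move=> [Lw _]; exact: LS.
have := markov_at_point HP b Ex stS FL' LS' c2 t0.
have [mL' _] := FL'.
have E1 w : (S w <= r%:E)%E%:R * \1_L w = \1_L' w :> R.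
  by rewrite /L' indicI /= mulrC indic_bool.
rewrite [X in P (Some x) X = _ -> _](_ : _ = L' `&` [set w | c < Z b (fine (S w) + t) w]) //.
rewrite probability_indic; last first.
  apply: measurableI => //.
  have := mg measurableT _ (measurable_itv `]0, +oo[); rewrite setTI.
  congr measurable; apply/seteqP; split => w /=; rewrite in_itv /= andbT.
    by rewrite -/(Z b _ w); case: (c < Z b _ w) => //=; rewrite ltxx.
  by move=> h; rewrite /Z in h; rewrite h ltr01.
move=> H; transitivity (\int[P (Some x)]_w (\1_(L' `&` [set w0 | (c < Z b (fine (S w0) + t) w0)%R]) w)%:E)%E.
  by apply: eq_integral => w _; congr (_%:E); rewrite indicI /= mulrA E1 indic_bool.
apply: (etrans H); rewrite [LHS]muleC [RHS]muleC; congr (_ * _)%E; rewrite probability_indic //.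
by apply: eq_integral => w _; rewrite E1.
Qed.

(* The occupation of [(c, +oo)] only starts at the stopping time [S], where the
   strong Markov property applies. *)
Lemma potential x y S L : E x -> stopping_time F S -> F_at F S L ->
  (forall w, L w -> (S w < +oo)%E -> Xat X (S w) w = Some y) ->
  {ae P (Some x), forall w, L w -> forall u, 0 <= u -> (u%:E < S w)%E -> Y b u w <= c} ->
  (\int[P (Some x)]_w ((\1_L w)%:E * J w) =
   \int[P (Some x)]_w (ex q (S w) * \1_L w)%:E * U y)%E.
Proof.
move=> Ex stS FL LS hY; have [mL hL] := FL; have mS := measurable_stopping HP stS.
(* Where [S] is infinite the discount is 0, and almost surely on [L] the level is never exceeded, so
   the occupation is 0 as well. *)
pose L0 := L `&` [set w | (S w < +oo)%E].
have mL0 : measurable L0.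
  apply: measurableI => //; have := emeasurable_fun_infty_o measurableT mS +oo%E.
  by rewrite setTI.
have FL0 : F_at F S L0.
  split => // t t0; rewrite (_ : L0 `&` _ = L `&` [set w | (S w <= t%:E)%E]); first exact: hL.
  apply/seteqP; split => w /=; first by case=> -[].
  by move=> [Lw St]; split => //; split => //=; apply: le_lt_trans St _; rewrite ltry.
have LS0 w : L0 w -> (S w < +oo)%E /\ Xat X (S w) w = Some y.
  by move=> [Lw Sw]; split => //; exact: LS.
have exL0 w : ex q (S w) * \1_L w = ex q (S w) * \1_L0 w.
  rewrite /L0 indicI /= indic_bool; case: (S w) => [s||] /=; rewrite ?mul0r //.
  by rewrite ltry mulr1.
under [in RHS]eq_integral do rewrite exL0.
rewrite -(potential_finite Ex stS FL0 LS0).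
have mexL0 : measurable_fun setT (fun w => ex q (S w) * \1_L0 w).
  apply: measurable_funM; last exact: measurable_indic.
  exact: (measurableT_comp (measurable_ex q) mS).
have mK : measurable_fun setT (fun w =>
   \int[mu]_t (exponential_pdf q t * (c < Z b (fine (S w) + t) w)%R%:R)%:E)%E.
  have := @measurable_fun_fubini_tonelli_F _ _ _ _ _ mu (fun p : Omega * R =>
     (exponential_pdf q p.2 * (c < Z b (fine (S p.1) + p.2) p.1)%R%:R)%:E).
  rewrite /fubini_F; apply => /=; last by move=> p; rewrite lee_fin mulr_ge0.
  apply/measurable_EFinP; apply: measurable_funM.
    by apply: measurableT_comp; [exact: measurable_exponential_pdf | exact: measurable_snd].
  apply: measurable_bool; apply: measurable_fun_ltr => //.
  have mp : measurable_fun setT (fun p : Omega * R => (fine (S p.1) + p.2, p.1) : R * Omega).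
    apply: measurable_fun_pair; last exact: measurable_fst.
    apply: measurable_funD; last exact: measurable_snd.
    apply: measurableT_comp; first exact: fine_measurable.
    by apply: measurableT_comp => //; exact: measurable_fst.
  exact: (measurableT_comp (Yp_joint HP b) mp).
apply: ge0_ae_eq_integral => //.
- apply: emeasurable_funM; first by apply/measurable_EFinP; exact: measurable_indic.
  exact: measurable_occupation.
- by apply: emeasurable_funM => //; apply/measurable_EFinP.
- by move=> w _; rewrite mule_ge0 // ?lee_fin // occupation_ge0.
- move=> w _; rewrite mule_ge0 // ?lee_fin ?mulr_ge0 ?ex_ge0 //.
  by apply: integral_ge0 => t _; rewrite lee_fin mulr_ge0.
apply: filterS hY => w hY _; rewrite -exL0.
have [Lw|nLw] := pselect (L w); last first.
  by rewrite indicE memNset // mulr0 !mul0e.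
rewrite indicE mem_set // mulr1 mul1e.
have := stS.1 w; have := hY Lw; case: (S w) => [s||] //= h s0.
  apply: occupation_delay => // u u0 us; exact: h.
rewrite mul0e; apply: occupation_zero => u u0.
by apply: h => //; rewrite ltry.
Qed.
End Resolvent.

Lemma integral_gt0 {d} {T : measurableType d} {R : realType} (mu : {measure set T -> \bar R})
    (A : set T) (f : T -> \bar R) :
  measurable A -> (0 < mu A)%E -> measurable_fun setT f -> (forall w, 0 <= f w)%E ->
  (forall w, A w -> (0 < f w)%E) -> (0 < \int[mu]_w f w)%E.
Proof.
move=> mA A0 mf f0 fA; rewrite lt0e integral_ge0 // andbT; apply/eqP => I0.
have [+ _] := ae_eq_integral_abs mu measurableT mf.
have -> : (\int[mu]_w `|f w| = 0)%E.
  by rewrite -[RHS]I0; apply: eq_integral => w _; rewrite gee0_abs.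
move=> /(_ erefl) [N [mN N0 hN]]; move: A0; rewrite lt0e => /andP[/eqP A0 _].
apply: A0; apply: (subset_measure0 mA mN) => // w Aw; apply: hN => /= /(_ I) h.
by have := fA w Aw; rewrite h ltxx.
Qed.

(** * Real-valued expectations of fractions *)

Section Expectation.
Context {d : measure_display} {T : measurableType d} {R : realType}.
Variable Q : probability T R.
Implicit Types f g : T -> R.

(** The common bound 1 makes every expectation a real number and every pointwise limit dominated. *)
Definition frac f := measurable_fun setT f /\ forall w, 0 <= f w <= 1.

Definition ev f : R := fine (\int[Q]_w (f w)%:E)%E.

Lemma frac_mul f g : frac f -> frac g -> frac (fun w => f w * g w).
Proof.
move=> [mf f1] [mg g1]; split; first exact: measurable_funM.
move=> w; have /andP[? ?] := f1 w; have /andP[? ?] := g1 w.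
by rewrite mulr_ge0 //= mulr_ile1.
Qed.

Lemma frac_indic (A : set T) : measurable A -> frac (\1_A).
Proof.
move=> mA; split; first exact: measurable_indic.
by move=> w; rewrite indicE ler0n lern1 leq_b1.
Qed.

Lemma frac_integrable f : frac f -> Q.-integrable setT (EFin \o f).
Proof.
move=> [mf f1]; apply: (le_integrable measurableT _ _ (finite_measure_integrable_cst Q 1 measurableT)).
  exact/measurable_EFinP.
move=> w _ /=; have /andP[f0 f1'] := f1 w.
by rewrite lee_fin ger0_norm // normr1.
Qed.

Lemma evE f : frac f -> (\int[Q]_w (f w)%:E = (ev f)%:E)%E.
Proof. by move=> hf; rewrite /ev fineK //; exact: (integrable_fin_num measurableT (frac_integrable hf)). Qed.

Lemma ev_le f g : frac f -> frac g -> {ae Q, forall w, f w <= g w} -> ev f <= ev g.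
Proof.
move=> hf hg fg; rewrite -lee_fin -!evE //; apply: ae_ge0_le_integral => //.
- by move=> w _; rewrite lee_fin; have /andP[] := hf.2 w.
- by apply/measurable_EFinP; case: hf.
- by move=> w _; rewrite lee_fin; have /andP[] := hg.2 w.
- by apply/measurable_EFinP; case: hg.
- by apply: filterS fg => w fg _; rewrite lee_fin.
Qed.

Lemma ev_eq f g : frac f -> frac g -> {ae Q, forall w, f w = g w} -> ev f = ev g.
Proof.
move=> hf hg fg; apply/eqP; rewrite eq_le; apply/andP; split; apply: ev_le => //;
  by apply: filterS fg => w ->.
Qed.

Lemma ev_indic (A : set T) : measurable A -> (ev (\1_A))%:E = Q A.
Proof. by move=> mA; rewrite -evE; [rewrite -probability_indic | exact: frac_indic]. Qed.

Lemma ev_cst1 : ev (cst 1) = 1.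
Proof.
rewrite /ev; transitivity (fine (1 * Q setT)%E); last by rewrite probability_setT mul1e.
by congr fine; exact: (integral_cst Q measurableT 1%E).
Qed.

Lemma ev_ge0 f : frac f -> 0 <= ev f.
Proof.
by move=> hf; rewrite fine_ge0 //; apply: integral_ge0 => w _; rewrite lee_fin; have /andP[] := hf.2 w.
Qed.

Lemma frac_cst1 : frac (cst 1).
Proof. by split; [exact: measurable_cst | move=> w; rewrite /= ler01 lexx]. Qed.

Lemma ev_le1 f : frac f -> ev f <= 1.
Proof.
move=> hf; rewrite -ev_cst1; apply: ev_le => //; first exact: frac_cst1.
by apply: aeW => w; have /andP[] := hf.2 w.
Qed.

Lemma ev_add f g h : frac f -> frac g -> frac h ->
  {ae Q, forall w, f w = g w + h w} -> ev f = ev g + ev h.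
Proof.
move=> hf hg hh e.
have mg : measurable_fun setT (EFin \o g) by apply/measurable_EFinP; case: hg.
have mh : measurable_fun setT (EFin \o h) by apply/measurable_EFinP; case: hh.
have g0 w : (0 <= (g w)%:E)%E by rewrite lee_fin; have /andP[] := hg.2 w.
have h0 w : (0 <= (h w)%:E)%E by rewrite lee_fin; have /andP[] := hh.2 w.
apply: EFin_inj; rewrite EFinD -!evE // -ge0_integralD //.
apply: ge0_ae_eq_integral => //.
- by apply/measurable_EFinP; case: hf.
- exact: emeasurable_funD.
- by move=> w _; rewrite lee_fin; have /andP[] := hf.2 w.
- by move=> w _; rewrite adde_ge0.
- by apply: filterS e => w e _; rewrite e EFinD.
Qed.

Lemma ev_gt0 f (A : set T) : frac f -> measurable A -> (0 < Q A)%E ->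
  (forall w, A w -> 0 < f w) -> 0 < ev f.
Proof.
move=> hf mA A0 fA; rewrite -lte_fin -evE //; apply: (integral_gt0 mA A0).
- by apply/measurable_EFinP; case: hf.
- by move=> w; rewrite lee_fin; have /andP[] := hf.2 w.
- by move=> w Aw; rewrite lte_fin fA.
Qed.

Lemma ev_cvg (f_ : nat -> T -> R) f : (forall n, frac (f_ n)) -> frac f ->
  {ae Q, forall w, f_ ^~ w @ \oo --> f w} -> (fun n => ev (f_ n)) @ \oo --> ev f.
Proof.
move=> hn hf e.
have [] := @dominated_convergence _ _ _ Q setT measurableT (fun n w => (f_ n w)%:E)
  (EFin \o f) (EFin \o cst 1).
- by move=> n; apply/measurable_EFinP; case: (hn n).
- by apply/measurable_EFinP; case: hf.
- by apply: filterS e => w e _; apply/fine_cvgP; split; [exact: nearW | exact: e].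
- exact: finite_measure_integrable_cst.
- apply: aeW => w n _; rewrite lee_fin /=; have /andP[f0 f1] := (hn n).2 w.
  by rewrite ger0_norm.
move=> _ _ /=; rewrite (evE hf) => /fine_cvgP[_].
by apply: cvg_trans; apply: near_eq_cvg; near=> n.
Unshelve. all: by end_near. Qed.
End Expectation.

Section Exponential.
Context {R : realType}.

Lemma ex_cvg (q : R) (u : nat -> \bar R) (l : \bar R) : 0 < q -> (0 <= l)%E ->
  u @ \oo --> l -> (fun n => ex q (u n)) @ \oo --> ex q l.
Proof.
move=> q0; case: l => [l||] // l0.
  move=> /fine_cvgP[fu cu]; rewrite /=.
  have : (fun n => expR (- (q * fine (u n)))) @ \oo --> expR (- (q * l)).
    apply: continuous_cvg; first exact: continuous_expR.
    by apply: cvgN; apply: cvgMl_tmp.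
  apply: cvg_trans; apply: near_eq_cvg; apply: filterS fu => n.
  by case: (u n).
move=> /cvgeyPgt cu; rewrite /=; apply/cvgrPdist_lt => e e0.
have /cvgrPdist_lt/(_ e e0)[M [_ HM]] := @cvgr_expR R.
apply: filterS (cu ((Num.max 0 M + 1) / q)) => n.
case: (u n) => [r||] //=; last by rewrite subrr normr0.
rewrite lte_fin ltr_pdivrMr // => h; apply: HM; rewrite mulrC.
by apply: le_lt_trans h; apply: ler_wpDr => //; rewrite le_max lexx orbT.
Qed.

(** Vanishing discount keeps exactly the information whether [T] is finite; this turns Laplace
    transforms into probabilities. *)
Lemma ex0_cvg (T : \bar R) : (0 <= T)%E ->
  (fun n => ex (n.+1%:R^-1) T) @ \oo --> ((T < +oo)%E%:R : R).
Proof.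
case: T => [t||] //= t0; last exact: cvg_cst.
rewrite ltry /= -[X in _ --> X]expR0.
apply: continuous_cvg; first exact: continuous_expR.
rewrite -oppr0; apply: cvgN; rewrite -[X in _ --> X](mul0r t).
by apply: cvgMr_tmp; exact: cvg_harmonic.
Qed.
End Exponential.

Lemma cvg_ereal_gt {R : realType} (u : nat -> \bar R) (l : \bar R) (a : R) :
  (a%:E < l)%E -> u @ \oo --> l -> \forall n \near \oo, (a%:E < u n)%E.
Proof.
case: l => [l||] // al; last by move=> /cvgey_gt.
move=> /fine_cvgP[fu cu]; rewrite lte_fin in al.
by apply: filterS2 fu (cvgr_gt l cu a al) => n /=; case: (u n).
Qed.

(** * The strong Markov property at hitting times *)

Section StrongMarkovHitting.
Context {R : realType} {E : set (\bar R)}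
  {d : measure_display} {Omega : measurableType d}
  {F : R -> set (set Omega)} {theta : R -> Omega -> Omega}
  {X : R -> Omega -> @state R} {P : @state R -> probability Omega R}.
Hypothesis HP : hunt_process E F theta X P.
Hypothesis SF : forall x, E x -> {ae P (Some x), forall w, @skip_path R E d Omega X w}.
Hypothesis SR : forall x y, E x -> E y ->
  (0 < P (Some x) [set w | (hitting X y w < +oo)%E])%E.

Let Y b t w := coordS b (X t w).
Let T y w := hitting X y w.
Let stT y : E y -> stopping_time F (T y) := fun Ey => hunt_hitting_stopping HP Ey.

(** A path at or beyond [y] at time [t] has entered all levels below [y] by then, and the supremum
    of these entries is [T y]. *)
Lemma crossing b x y : E x -> E y -> coord b x < coord b y ->
  {ae P (Some x), forall w, forall t, 0 <= t -> coord b y <= Y b t w -> (T y w <= t%:E)%E}.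
Proof.
move=> Ex Ey xy; apply: filterS (hitting_announced HP (SF Ex) Ex Ey xy) => w h t t0 yt.
rewrite /T h; apply/ereal_supP => _ [n _ <-]; apply: entry_le => //.
by apply: lt_le_trans yt; rewrite ltrBlDr ltrDl invr_gt0.
Qed.

Lemma below_hitting b x y : E x -> E y -> coord b x < coord b y ->
  {ae P (Some x), forall w, forall t, 0 <= t -> (t%:E < T y w)%E -> Y b t w < coord b y}.
Proof.
move=> Ex Ey xy; apply: filterS (crossing Ex Ey xy) => w h t t0 tT.
by rewrite ltNge; apply/negP => /(h t t0); rewrite leNgt tT.
Qed.

Lemma hitting_order b x y z : E x -> E y -> coord b x < coord b y -> coord b y < coord b z ->
  {ae P (Some x), forall w, (T z w < +oo)%E -> (T y w < T z w)%E}.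
Proof.
move=> Ex Ey xy yz; apply: filterS (crossing Ex Ey xy) => w h Tz.
have := hitting_ge0 (X := X) z w; rewrite -/(T z w); case Tzt : (T z w) Tz => [t||] // _ t0.
have Xt := hitting_attained HP Tzt.
rewrite lt_neqAle; apply/andP; split.
  apply/negP => /eqP Tyt; have := hitting_attained HP Tyt; rewrite Xt => -[zy].
  by move: yz; rewrite zy ltxx.
by apply: h => //; rewrite /Y Xt /= ltW.
Qed.

(** [T (zn n) <= T z] once [zn n] is beyond [x]. Conversely [T z] is the supremum of entries into
    levels below [z], and each such entry precedes [T (zn n)] for large [n]. No monotonicity of [zn]
    is involved. *)
Lemma hitting_cvg b x z (zn : nat -> \bar R) : E x -> E z -> (forall n, E (zn n)) ->
  coord b x < coord b z -> (forall n, coord b (zn n) < coord b z) ->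
  (fun n => coord b (zn n)) @ \oo --> coord b z ->
  {ae P (Some x), forall w, (fun n => T (zn n) w) @ \oo --> T z w}.
Proof.
move=> Ex Ez Ezn xz zlt zcv.
have H1 : {ae P (Some x), forall w, forall n, coord b x < coord b (zn n) ->
   forall t, 0 <= t -> coord b (zn n) <= Y b t w -> (T (zn n) w <= t%:E)%E}.
  apply: ae_foralln => n; have [xn|xn] := ltP (coord b x) (coord b (zn n)).
    by apply: filterS (crossing Ex (Ezn n) xn) => w h _.
  by apply: aeW.
apply: filterS2 H1 (hitting_announced HP (SF Ex) Ex Ez xz) => w H1 H2.
have ev_gt c : c < coord b z -> \forall n \near \oo, c < coord b (zn n).
  by move=> cz; exact: (cvgr_gt (coord b z) zcv).
apply: cvg_ereal_below; first exact: hitting_ge0.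
  apply: filterS (ev_gt _ xz) => n xn.
  have := hitting_ge0 (X := X) z w; rewrite -/(T z w); case Tzt : (T z w) => [t||] // t0; last by rewrite leey.
  apply: H1 => //; have Xt := hitting_attained HP Tzt.
  by rewrite /Y Xt /= ltW.
move=> a; rewrite /T H2 => /ereal_sup_gt[_ [m _ <-] am].
have lm : coord b z - m.+1%:R^-1 < coord b z by rewrite ltrBlDr ltrDl invr_gt0.
apply: filterS (ev_gt _ lm) => n mn; apply: (lt_le_trans am).
apply/ereal_infP => _ [t [t0 Xt] <-]; apply: entry_le; first exact: ltW.
by rewrite Xt.
Qed.

Lemma F_at_setT S : stopping_time F S -> F_at F S setT.
Proof. by move=> [_ hS]; split => // t t0; rewrite setTI; exact: hS. Qed.

Lemma F_at_setI S L M : F_at F S L -> F_at F S M -> F_at F S (L `&` M).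
Proof.
move=> [mL hL] [mM hM]; split; first exact: measurableI.
move=> t t0; rewrite setIIl; apply: (sigma_setI (sigmaF HP t0)); [exact: hL | exact: hM].
Qed.

(** When [S < S'] and [S <= t], either [t] itself precedes [S'] or some rational up to [t] separates
    [S] from [S']. *)
Lemma F_at_lt S S' : stopping_time F S -> stopping_time F S' ->
  F_at F S [set w | (S w < S' w)%E].
Proof.
move=> stS stS'; split.
  have := measurable_lte measurableT (measurable_stopping HP stS) (measurable_stopping HP stS').
  by rewrite setTI.
move=> t t0; have sF := sigmaF HP t0.
have gtF u : 0 <= u -> u <= t -> F t [set w | (u%:E < S' w)%E].
  move=> u0 ut; apply: (F_mono HP u0 ut).
  rewrite (_ : [set _ | _] = ~` [set w | (S' w <= u%:E)%E]).
    by apply: (sigma_setC (sigmaF HP u0)); exact: stS'.2.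
  by apply/seteqP; split => w /=; rewrite ltNge => /negP.
have leF u : 0 <= u -> u <= t -> F t [set w | (S w <= u%:E)%E].
  by move=> u0 ut; apply: (F_mono HP u0 ut); exact: stS.2.
rewrite (_ : _ `&` _ = ([set w | (S w <= t%:E)%E] `&` [set w | (t%:E < S' w)%E]) `|`
  \bigcup_(r in [set r : rat | 0 <= (ratr r : R) <= t])
     ([set w | (S w <= (ratr r : R)%:E)%E] `&` [set w | ((ratr r : R)%:E < S' w)%E])).
  apply: (sigma_setU sF); first by apply: (sigma_setI sF); [exact: leF | exact: gtF].
  apply: (sigma_bigcup_rat sF) => r /andP[r0 rt].
  by apply: (sigma_setI sF); [exact: leF | exact: gtF].
apply/seteqP; split => [w /= [lt St]|w /= [[St tS']|[r /andP[r0 rt] [/= Sr rS']]]].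
- have [tS'|S't] := ltP (t%:E)%E (S' w); [by left | right].
  have := stS.1 w; move: lt St S't; case Sw : (S w) => [s||] //; case S'w : (S' w) => [s'||] //.
  rewrite !lte_fin !lee_fin => ss' st s't s0; have [r /andP[sr rs']] := rat_between ss'.
  exists r => /=; first by rewrite (le_trans s0 (ltW sr)) (le_trans (ltW rs') s't).
  by split; rewrite /= ?Sw ?S'w ?lee_fin ?lte_fin // ltW.
- by split => //; exact: le_lt_trans tS'.
- by split; [exact: le_lt_trans rS' | apply: le_trans Sr _; rewrite lee_fin].
Qed.

Lemma F_at_later S S' L : stopping_time F S -> stopping_time F S' -> F_at F S L ->
  (forall w, L w -> (S w < S' w)%E) -> F_at F S' L.
Proof.
move=> stS stS' [mL hL] lt; split => // t t0.
rewrite (_ : L `&` _ = (L `&` [set w | (S w <= t%:E)%E]) `&` [set w | (S' w <= t%:E)%E]).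
  by apply: (sigma_setI (sigmaF HP t0) (hL t t0)); exact: stS'.2.
apply/seteqP; split => w /=; last by case=> -[].
by move=> [Lw h1]; do 2 split => //; apply: le_trans h1; apply: ltW; exact: lt.
Qed.

Definition psi (q : R) (x y : \bar R) : R :=
  ev (P (Some x)) (fun w => ex q (hitting X y w)).

Lemma measurable_hitting y : E y -> measurable_fun setT (T y).
Proof. by move=> Ey; exact: (measurable_stopping HP (stT Ey)). Qed.

Lemma frac_ex q y : 0 < q -> E y -> frac (fun w => ex q (T y w)).
Proof.
move=> q0 Ey; split; first exact: (measurableT_comp (measurable_ex q) (measurable_hitting Ey)).
by move=> w; rewrite ex_ge0 /=; apply: ex_le1; [exact: ltW | exact: hitting_ge0].
Qed.

Lemma measurable_lt_hitting y z : E y -> E z -> measurable [set w | (T y w < T z w)%E].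
Proof.
move=> Ey Ez.
have := measurable_lte measurableT (measurable_hitting Ey) (measurable_hitting Ez).
by rewrite setTI.
Qed.

Lemma measurable_hitting_fin y : E y -> measurable [set w | (T y w < +oo)%E].
Proof.
by move=> Ey; have := emeasurable_fun_infty_o measurableT (measurable_hitting Ey) +oo%E; rewrite setTI.
Qed.

Lemma psi_gt0 q x y : 0 < q -> E x -> E y -> 0 < psi q x y.
Proof.
move=> q0 Ex Ey; apply: (ev_gt0 (frac_ex q0 Ey) (measurable_hitting_fin Ey) (SR Ex Ey)).
move=> w /=; have := hitting_ge0 (X := X) y w; rewrite -/(T y w).
by case: (T y w) => [t||] //= _ _; exact: expR_gt0.
Qed.

(* A level [c] whose superlevel set can only be entered through [z] and is then
   occupied for a positive time. *)
Definition detecting q b z c := [/\ -2 <= c,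
  forall v, E v -> coord b v < coord b z -> coord b v <= c &
  (0 < resolvent (X := X) (P := P) q b c z)%E].

(** A single time above [c] suffices: right-continuity prolongs it to an interval of positive
    length. *)
Lemma resolvent_gt0 q b c z : 0 < q -> -2 <= c -> E z ->
  (exists2 A, measurable A /\ (0 < P (Some z) A)%E &
     forall w, A w -> exists2 t, 0 <= t & c < Y b t w) ->
  (0 < resolvent (X := X) (P := P) q b c z)%E.
Proof.
move=> q0 c2 Ez [A [mA A0] hA]; rewrite (resolventE HP) //.
apply: (integral_gt0 mA A0).
- exact: (measurable_occupation HP).
- by move=> w; exact: occupation_ge0.
move=> w /hA[t t0 ct]; have e0 : 0 < Y b t w - c by rewrite subr_gt0.
have [dl dl0 H] := Y_rc HP b w t0 e0.
apply: (@integral_gt0 _ _ _ lebesgue_measure `[t, t + dl[%classic).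
- exact: measurable_itv.
- have hE : (lebesgue_measure (`[t, (t + dl)%R[%classic : set R) = dl%:E)%E.
    by rewrite lebesgue_measure_itv /= lte_fin ltrDl dl0 -EFinB; congr (_%:E); ring.
  by rewrite [X in (_ < X)%E](_ : _ = dl%:E) ?lte_fin //; exact: hE.
- exact: (measurable_fun_pair1 w (joint_level HP q b c)).
- by move=> u; rewrite lee_fin mulr_ge0 // exponential_pdf_ge0 // ltW.
move=> u /=; rewrite in_itv /= => /andP[tu ud]; have u0 := le_trans t0 tu.
have := H u tu ud; rewrite ltr_norml -/(Y b u w) -/(Y b t w) => /andP[h _].
have cu : c < Y b u w by move: (Y b u w) (Y b t w) h => a a' h; lra.
rewrite /Yp u0 -/(Y b u w) cu mulr1 lte_fin exponential_pdfE //.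
by rewrite mulr_gt0 ?expR_gt0.
Qed.

Lemma Xat_hitting v w : (T v w < +oo)%E -> Xat X (T v w) w = Some v.
Proof.
have := hitting_ge0 (X := X) v w; rewrite -/(T v w).
by case Tv : (T v w) => [t||] // _ _; exact: (hitting_attained HP Tv).
Qed.

Lemma detecting_below q b x z c : E x -> E z -> coord b x < coord b z -> detecting q b z c ->
  {ae P (Some x), forall w, forall u, 0 <= u -> (u%:E < T z w)%E -> Y b u w <= c}.
Proof.
move=> Ex Ez xz [c2 hc _]; apply: filterS (below_hitting Ex Ez xz) => w h u u0 uT.
have := h u u0 uT; rewrite /Y; case Xu : (X u w) => [v'|] //= v'z.
by apply: hc => //; exact: (valE HP u0 Xu).
Qed.

Lemma resolvent_passage q b y z c : 0 < q -> E y -> E z -> coord b y < coord b z ->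
  detecting q b z c -> resolvent (X := X) (P := P) q b c y =
    ((psi q y z)%:E * resolvent (X := X) (P := P) q b c z)%E.
Proof.
move=> q0 Ey Ez yz dc; have [c2 _ _] := dc.
have aez : {ae P (Some y), forall w, setT w ->
    forall u, 0 <= u -> (u%:E < T z w)%E -> Y b u w <= c}.
  by apply: filterS (detecting_below Ey Ez yz dc) => w h _.
have eyz := potential HP q0 c2 Ey (stT Ez) (F_at_setT (stT Ez)) (fun w _ => @Xat_hitting z w) aez.
rewrite (resolventE HP) // -evE; last exact: frac_ex.
transitivity (\int[P (Some y)]_w ((\1_(setT : set Omega) w)%:E * occupation (X := X) q b c w))%E.
  by apply: eq_integral => w _; rewrite indicT mul1e.
rewrite eyz; congr (_ * _)%E; apply: eq_integral => w _.
by rewrite indicT /= mulr1.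
Qed.

Lemma resolvent_fin q b z c : 0 < q -> detecting q b z c ->
  exists2 u, resolvent (X := X) (P := P) q b c z = u%:E & 0 < u.
Proof.
move=> q0 [c2 _ U0].
have : (resolvent (X := X) (P := P) q b c z <= 1)%E.
  rewrite (resolventE HP) // -(probability_setT (P (Some z))) -[X in (_ <= X)%E]mul1e.
  rewrite -(integral_cst _ measurableT 1%E); apply: ge0_le_integral => //.
  - by move=> w _; exact: occupation_ge0.
  - exact: (measurable_occupation HP).
  - by move=> w _; exact: (occupation_le1 HP).
by move: U0; case: (resolvent _ _ _ z) => [u||] //; exists u.
Qed.

(** The occupation on [L] is computed by [potential] at [T z] and again at [T y]. The resolvent at
    [y] is [psi q y z] times the one at [z], which is positive and finite and cancels. *)
Lemma detecting_passage q b x y z c L : 0 < q -> E x -> E y -> E z ->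
  coord b x < coord b z -> coord b y < coord b z -> F_at F (T y) L ->
  (forall w, L w -> (T y w < T z w)%E) -> detecting q b z c ->
  ev (P (Some x)) (fun w => ex q (T z w) * \1_L w) =
  ev (P (Some x)) (fun w => ex q (T y w) * \1_L w) * psi q y z.
Proof.
move=> q0 Ex Ey Ez xz yz FL Llt dc; have [c2 _ _] := dc.
have FLz := F_at_later (stT Ey) (stT Ez) FL Llt.
have [mL _] := FL; have blw := detecting_below Ex Ez xz dc.
have aez : {ae P (Some x), forall w, L w ->
    forall u, 0 <= u -> (u%:E < T z w)%E -> Y b u w <= c}.
  by apply: filterS blw => w h _.
have aey : {ae P (Some x), forall w, L w -> forall u, 0 <= u -> (u%:E < T y w)%E -> Y b u w <= c}.
  apply: filterS blw => w h Lw u u0 uT; apply: h => //.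
  by apply: lt_trans uT _; exact: Llt.
have ez := potential HP q0 c2 Ex (stT Ez) FLz (fun w _ => @Xat_hitting z w) aez.
have ey := potential HP q0 c2 Ex (stT Ey) FL (fun w _ => @Xat_hitting y w) aey.
have fex v : E v -> frac (fun w => ex q (T v w) * \1_L w).
  by move=> Ev; apply: frac_mul; [exact: frac_ex | exact: frac_indic].
move: ez; rewrite ey (resolvent_passage q0 Ey Ez yz dc) (evE _ (fex z Ez)) (evE _ (fex y Ey)).
have [u -> u0] := resolvent_fin q0 dc.
rewrite -!EFinM => -[/esym]; rewrite mulrA; apply: mulIf.
by rewrite gt_eqF.
Qed.

Lemma coord_approx b z (P0 : set (\bar R)) :
  (forall c, c < coord b z -> exists v, [/\ P0 v, c < coord b v & coord b v < coord b z]) ->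
  exists zn : nat -> \bar R, [/\ forall n, P0 (zn n), forall n, coord b (zn n) < coord b z &
    (fun n => coord b (zn n)) @ \oo --> coord b z].
Proof.
move=> h.
have H n : exists v, [/\ P0 v, coord b z - n.+1%:R^-1 < coord b v & coord b v < coord b z].
  by apply: h; rewrite ltrBlDr ltrDl invr_gt0.
pose zn n := sval (cid (H n)); exists zn.
have Hz n : [/\ P0 (zn n), coord b z - n.+1%:R^-1 < coord b (zn n) & coord b (zn n) < coord b z].
  by rewrite /zn; case: cid.
split => [n|n|]; [by case: (Hz n) | by case: (Hz n) |].
apply/cvgrPdist_lt => e e0; have [N hN] := invS_lt e0.
exists N => // n /= Nn; have [_ h1 h2] := Hz n.
have h3 : n.+1%:R^-1 <= N.+1%:R^-1 :> R by rewrite lef_pV2 ?posrE // ler_nat.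
rewrite gtr0_norm ?subr_gt0 //; move: (n.+1%:R^-1) (N.+1%:R^-1) h1 h3 hN => p p' h1 h3 hN.
by lra.
Qed.

(** If [E] has a point beyond [z], the level of [z] itself works, as that point is reached with
    positive probability. If [E] has a gap just below [z], a level in the gap is exceeded already at
    time 0. Otherwise [z] is extreme and is approached by points of the first kind. *)
Lemma detecting_or_limit q b z : 0 < q -> E z ->
  (exists c, detecting q b z c) \/
  exists zn : nat -> \bar R, [/\ forall n, E (zn n) /\ exists c, detecting q b (zn n) c,
    forall n, coord b (zn n) < coord b z &
    (fun n => coord b (zn n)) @ \oo --> coord b z].
Proof.
move=> q0 Ez.
have above v v' : E v -> E v' -> coord b v < coord b v' -> detecting q b v (coord b v).
  move=> Ev Ev' vv'; have c2 : -2 <= coord b v by have := coord_ge b v; lra.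
  split => //; first by move=> u _ /ltW.
  apply: resolvent_gt0 => //; exists [set w | (T v' w < +oo)%E].
    by split; [exact: measurable_hitting_fin | exact: SR].
  move=> w /=; have := hitting_ge0 (X := X) v' w; rewrite -/(T v' w).
  case Tv : (T v' w) => [t||] // t0 _; exists t => //.
  by rewrite /Y (hitting_attained HP Tv).
have [[z' [Ez' zz']]|nmax] := pselect (exists z', E z' /\ coord b z < coord b z').
  by left; exists (coord b z); exact: above zz'.
have [[c [cz hc]]|acc] := pselect (exists c, c < coord b z /\
   forall v, E v -> coord b v < coord b z -> coord b v <= c).
  (* The gap level is raised to at least [-2], the value of the cemetery, which remains below
     [coord b z]. *)
  left; exists (Num.max c (-2)).
  have c2 : -2 <= Num.max c (-2) by rewrite le_max lexx orbT.
  split => //; first by move=> v Ev vz; rewrite le_max hc.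
  apply: resolvent_gt0 => //; exists (X 0 @^-1` (emb E @^-1` [set emb E (Some z)])).
    have m0 : measurable (X 0 @^-1` (emb E @^-1` [set emb E (Some z)])).
      by apply: (F_meas HP (lexx 0)); apply: (hunt_adapted HP) => //; exact: emb_borel.
    split => //; rewrite (_ : _ @^-1` _ = [set w | X 0 w = Some z]).
      by rewrite (hunt_normal HP (x := Some z) Ez) lte01.
    apply/seteqP; split => w /=; last by move=> ->.
    by move/(emb_inj Ez (hunt_values HP w (lexx 0))).
  move=> w /= /(emb_inj Ez (hunt_values HP w (lexx 0))) X0; exists 0 => //.
  by rewrite /Y X0 /= gt_max cz /=; have := coord_ge b z; lra.
right.
have [|zn [h1 h2 h3]] := @coord_approx b z (fun v => E v /\ exists c, detecting q b v c).
  move=> c cz; apply: contrapT => no; apply: acc; exists c; split => // v Ev vz.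
  rewrite leNgt; apply/negP => cv; apply: no; exists v; split => //; split => //.
  by exists (coord b v); exact: above vz.
by exists zn.
Qed.

(* For [z] not detectable, approach it from below by detectable points. *)
Lemma passage q b x y z L : 0 < q -> E x -> E y -> E z ->
  coord b x < coord b z -> coord b y < coord b z -> F_at F (T y) L ->
  (forall w, L w -> (T y w < T z w)%E) ->
  ev (P (Some x)) (fun w => ex q (T z w) * \1_L w) =
  ev (P (Some x)) (fun w => ex q (T y w) * \1_L w) * psi q y z.
Proof.
move=> q0 Ex Ey Ez xz yz FL Llt.
have [[c dc]|[zn [hn zlt zcv]]] := detecting_or_limit b q0 Ez.
  exact: detecting_passage dc.
have Ezn n : E (zn n) by case: (hn n).
(* On [L] only [T y < T z] is known; passing through [zn n] requires [T y < T (zn n)], which holds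
   for large [n] since [T (zn n)] tends to [T z]. *)
pose Ln n := L `&` [set w | (T y w < T (zn n) w)%E].
have FLn n : F_at F (T y) (Ln n).
  by apply: F_at_setI => //; exact: F_at_lt (stT Ey) (stT (Ezn n)).
have mL : measurable L by case: FL.
have mLn n : measurable (Ln n) by case: (FLn n).
have ev_gt c : c < coord b z -> \forall n \near \oo, c < coord b (zn n).
  by move=> cz; exact: (cvgr_gt (coord b z) zcv).
have Tx := hitting_cvg Ex Ez Ezn xz zlt zcv.
have Ty := hitting_cvg Ey Ez Ezn yz zlt zcv.
have fex (M : set Omega) v : measurable M -> E v -> frac (fun w => ex q (T v w) * \1_M w).
  by move=> mM Ev; apply: frac_mul; [exact: frac_ex | exact: frac_indic].
have indn w : (fun n => T (zn n) w) @ \oo --> T z w -> \forall n \near \oo, \1_(Ln n) w = \1_L w :> R.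
  move=> cT; have [Lw|nLw] := pselect (L w); last first.
    by apply: nearW => n; rewrite !indicE !memNset // => -[].
  have := Llt w Lw; have := hitting_ge0 (X := X) y w; rewrite -/(T y w).
  case Tyt : (T y w) => [t||] // _ tz; last by rewrite ltNge leey in tz.
  have : \forall n \near \oo, (t%:E < T (zn n) w)%E by exact: (cvg_ereal_gt tz cT).
  apply: filterS => n tn; rewrite !indicE !mem_set //; split => //=.
  by rewrite Tyt.
have c1 : (fun n => ev (P (Some x)) (fun w => ex q (T (zn n) w) * \1_(Ln n) w)) @ \oo -->
   ev (P (Some x)) (fun w => ex q (T z w) * \1_L w).
  apply: ev_cvg => [n||]; [exact: fex | exact: fex |].
  apply: (filterS _ Tx) => v Tv; apply: cvgM.
    by apply: ex_cvg => //; exact: hitting_ge0.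
  have : (fun=> \1_L v : R) @ \oo --> (\1_L v : R) by exact: cvg_cst.
  by apply: cvg_trans; apply: near_eq_cvg; apply: filterS (indn v Tv) => n ->.
have c2 : (fun n => ev (P (Some x)) (fun w => ex q (T y w) * \1_(Ln n) w)) @ \oo -->
   ev (P (Some x)) (fun w => ex q (T y w) * \1_L w).
  apply: ev_cvg => [n||]; [exact: fex | exact: fex |].
  apply: (filterS _ Tx) => v Tv; apply: cvgM; first exact: cvg_cst.
  have : (fun=> \1_L v : R) @ \oo --> (\1_L v : R) by exact: cvg_cst.
  by apply: cvg_trans; apply: near_eq_cvg; apply: filterS (indn v Tv) => n ->.
have c3 : (fun n => psi q y (zn n)) @ \oo --> psi q y z.
  apply: ev_cvg => [n||]; [exact: frac_ex | exact: frac_ex |].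
  by apply: (filterS _ Ty) => v Tv; exact: (ex_cvg q0 (hitting_ge0 z v) Tv).
have c4 : (fun n => ev (P (Some x)) (fun w => ex q (T y w) * \1_(Ln n) w) * psi q y (zn n)) @ \oo -->
  ev (P (Some x)) (fun w => ex q (T y w) * \1_L w) * psi q y z by exact: cvgM c2 c3.
apply: (cvg_unique (@norm_hausdorff R R) c1).
have c5 : (fun n => ev (P (Some x)) (fun w => ex q (T (zn n) w) * \1_(Ln n) w)) @ \oo -->
  ev (P (Some x)) (fun w => ex q (T y w) * \1_L w) * psi q y z.
  move: c4; apply: cvg_trans; apply: near_eq_cvg.
  apply: filterS2 (ev_gt _ xz) (ev_gt _ yz) => n xn yn; have [c dc] := (hn n).2.
  by apply/esym; apply: detecting_passage dc => // w [].
exact: c5.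
Qed.
End StrongMarkovHitting.

(** * Two-sided passage *)

Section TwoSided.
Context {R : realType} {E : set (\bar R)}
  {d : measure_display} {Omega : measurableType d}
  {F : R -> set (set Omega)} {theta : R -> Omega -> Omega}
  {X : R -> Omega -> @state R} {P : @state R -> probability Omega R}.
Hypothesis HP : hunt_process E F theta X P.
Hypothesis SF : forall x, E x -> {ae P (Some x), forall w, @skip_path R E d Omega X w}.
Hypothesis SR : forall x y, E x -> E y ->
  (0 < P (Some x) [set w | (hitting X y w < +oo)%E])%E.

Let T y w := hitting X y w.
Let psi := @psi R d Omega X P.

Lemma coordN b x : coord (~~ b) x = - coord b x :> R.
Proof. by case: b => //=; rewrite opprK. Qed.

Lemma T_fin_lt b x y z : E x -> E y -> coord b x < coord b y -> coord b y < coord b z ->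
  {ae P (Some x), forall w, (T y w < +oo)%E -> (T y w < T z w)%E}.
Proof.
move=> Ex Ey xy yz; apply: filterS (hitting_order HP SF Ex Ey xy yz) => w h Ty.
have [Tz|] := ltP (T z w) +oo%E; first exact: h.
by rewrite leye_eq => /eqP ->.
Qed.

(** Almost surely [T y < T z] as soon as either time is finite, and the discount vanishes at
    infinite times. The indicator in [passage] therefore changes neither expectation. *)
Lemma psi_mul q b x y z : 0 < q -> E x -> E y -> E z ->
  coord b x < coord b y -> coord b y < coord b z -> psi q x z = psi q x y * psi q y z.
Proof.
move=> q0 Ex Ey Ez xy yz; pose L := [set w | (T y w < T z w)%E].
have mL : measurable L by exact: (measurable_lt_hitting HP).
have FL : F_at F (T y) L.
  exact: (F_at_lt HP (hunt_hitting_stopping HP Ey) (hunt_hitting_stopping HP Ez)).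
have := passage HP SF SR q0 Ex Ey Ez (lt_trans xy yz) yz FL (fun w h => h).
have fex v : E v -> frac (fun w => ex q (T v w)) by move=> Ev; exact: (frac_ex HP).
have fexL v : E v -> frac (fun w => ex q (T v w) * \1_L w).
  by move=> Ev; apply: frac_mul; [exact: fex | exact: frac_indic].
have key v : v = y \/ v = z -> E v ->
  ev (P (Some x)) (fun w => ex q (T v w) * \1_L w) = psi q x v.
  move=> vE Ev; apply: ev_eq; [exact: fexL | exact: fex |].
  apply: filterS2 (T_fin_lt Ex Ey xy yz) (hitting_order HP SF Ex Ey xy yz) => w h1 h2.
  have [Tv|] := ltP (T v w) +oo%E; last first.
    by rewrite leye_eq => /eqP Tv; rewrite /T in Tv *; rewrite Tv /= mul0r.
  rewrite indicE mem_set ?mulr1 // /L /=.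
  by case: vE Tv => ->; [exact: h1 | exact: h2].
by rewrite (key z (or_intror erefl) Ez) (key y (or_introl erefl) Ey).
Qed.

(** The target is [z]; [a] is the point to be avoided. The same convention holds for [hit_first]. *)
Definition passage_first q x a z : R :=
  ev (P (Some x)) (fun w => ex q (T z w) * \1_[set w | (T z w < T a w)%E] w).

Definition hit_first x a z : R :=
  ev (P (Some x)) (\1_[set w | (T z w < T a w)%E]).

Let A := passage_first.
Let H := hit_first.

(** Split according to whether [a] is visited before [z]; a tie means that both times are infinite,
    where the discount is 0. The order of [x] and [a] is free, so reversing [b] also gives the
    equation for target [a]. *)
Lemma psi_split q b x a z : 0 < q -> E x -> E a -> E z ->
  coord b x < coord b z -> coord b a < coord b z ->
  psi q x z = A q x a z + A q x z a * psi q a z.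
Proof.
move=> q0 Ex Ea Ez xz az; pose L := [set w | (T a w < T z w)%E].
have mlt v v' : E v -> E v' -> measurable [set w | (T v w < T v' w)%E].
  by move=> Ev Ev'; exact: (measurable_lt_hitting HP).
have FL : F_at F (T a) L.
  exact: (F_at_lt HP (hunt_hitting_stopping HP Ea) (hunt_hitting_stopping HP Ez)).
have := passage HP SF SR q0 Ex Ea Ez xz az FL (fun w h => h).
rewrite /A /passage_first -/(psi q a z) => <-.
have fex v (M : set Omega) : E v -> measurable M -> frac (fun w => ex q (T v w) * \1_M w).
  by move=> Ev mM; apply: frac_mul; [exact: (frac_ex HP) | exact: frac_indic].
apply: ev_add; [exact: (frac_ex HP)| apply: fex => //; exact: mlt| apply: fex => //; exact: mlt|].
apply: aeW => w; rewrite -mulrDr /L !indic_bool.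
have az' : a <> z by move=> h; rewrite h ltxx in az.
rewrite -/(T z w) -/(T a w).
case: (ltgtP (T a w) (T z w)) => [||e] /=; rewrite ?addr0 ?add0r ?mulr1 // mulr0.
have [Ta|] := ltP (T a w) +oo%E.
  by exfalso; apply: (hitting_neq HP az' Ta); exact: e.
by rewrite leye_eq => /eqP Ta; rewrite -e Ta.
Qed.

(** The hitting time of another point is almost surely positive, because its value is attained and
    the path starts at [x]. *)
Lemma psi_lt1 q x y : 0 < q -> E x -> E y -> x <> y -> psi q x y < 1.
Proof.
move=> q0 Ex Ey xy; pose B := [set w | (0 < T y w)%E].
have mB : measurable B.
  by have := emeasurable_fun_o_infty measurableT (measurable_hitting HP Ey) 0%E; rewrite setTI.
have fex : frac (fun w => ex q (T y w)) by exact: (frac_ex HP).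
have fex' : frac (fun w => 1 - ex q (T y w)).
  split; first by apply: measurable_funB => //; case: fex.
  by move=> w; have /andP[? ?] := fex.2 w; apply/andP; split; lra.
have : ev (P (Some x)) (cst 1) = psi q x y + ev (P (Some x)) (fun w => 1 - ex q (T y w)).
  by apply: ev_add => //; [exact: frac_cst1 | apply: aeW => w /=; rewrite addrC subrK].
rewrite ev_cst1 => h; have : 0 < ev (P (Some x)) (fun w => 1 - ex q (T y w)).
  apply: (ev_gt0 fex' mB).
    have : {ae P (Some x), forall w, B w}.
      apply: filterS (start_ae HP Ex) => w X0; rewrite /B /= lt0e hitting_ge0 andbT.
      by apply/eqP => T0; have := hitting_attained HP T0; rewrite X0 => -[].
    move=> [N [mN N0 hN]].
    have : P (Some x) (~` B) = 0%E.
      by apply: (subset_measure0 (measurableC mB) mN) => // w; exact: hN.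
    rewrite probability_setC // => e; rewrite lt0e measure_ge0 andbT; apply/eqP => B0.
    by move: e; rewrite B0 sube0 => /eqP; rewrite onee_eq0.
  move=> w; rewrite /B /=; case: (T y w) => [t||] /=; rewrite ?subr0 //.
  by rewrite lte_fin subr_gt0 => t0; rewrite expR_lt1 oppr_lt0 mulr_gt0.
by move: (ev _ _) h => e h e0; lra.
Qed.

Lemma psi_le1 q x y : 0 < q -> E y -> psi q x y <= 1.
Proof. by move=> q0 Ey; apply: ev_le1; exact: (frac_ex HP). Qed.

Lemma coord_neq b (x y : \bar R) : coord b x < coord b y -> x <> y.
Proof. by move=> + h; rewrite h ltxx. Qed.

Let pp q x y := psi_gt0 HP SR (q := q) (x := x) (y := y).

Lemma loop_lt1 q x y : 0 < q -> E x -> E y -> x <> y -> 0 < 1 - psi q x y * psi q y x.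
Proof.
move=> q0 Ex Ey xy; rewrite subr_gt0.
have h1 := psi_lt1 q0 Ex Ey xy; have h2 := @psi_le1 q y x q0 Ex.
have h3 := pp q0 Ey Ex; have h4 := pp q0 Ex Ey.
by apply: le_lt_trans h1; rewrite ler_piMr // ltW.
Qed.

(* Solve the equations [psi_split] for the passages to [z] and to [a]. *)
Lemma passage_firstE q b x a z : 0 < q -> E x -> E a -> E z ->
  coord b a < coord b x -> coord b x < coord b z ->
  A q x a z = psi q x z * (1 - psi q a x * psi q x a) / (1 - psi q a z * psi q z a).
Proof.
move=> q0 Ex Ea Ez ax xz; have az := lt_trans ax xz.
have e1 := psi_split q0 Ex Ea Ez xz az.
have e2 : psi q x a = A q x z a + A q x a z * psi q z a.
  by apply: (@psi_split q (~~ b)) => //; rewrite !coordN ltrN2.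
have e3 := psi_mul q0 Ea Ex Ez ax xz.
have l1 := loop_lt1 q0 Ea Ez (coord_neq az).
apply: (mulIf (lt0r_neq0 l1)); rewrite divfK ?lt0r_neq0 //.
transitivity (psi q x z - psi q a z * psi q x a); first by rewrite {1}e1 e2; ring.
by rewrite e3; ring.
Qed.

Lemma frac_lt v v' : E v -> E v' -> frac (\1_[set w | (T v w < T v' w)%E] : Omega -> R).
Proof. by move=> Ev Ev'; apply: frac_indic; exact: (measurable_lt_hitting HP). Qed.

Lemma frac_first q v v' : 0 < q -> E v -> E v' ->
  frac (fun w => ex q (T v w) * \1_[set w | (T v w < T v' w)%E] w).
Proof. by move=> q0 Ev Ev'; apply: frac_mul; [exact: (frac_ex HP) | exact: frac_lt]. Qed.

(** The discounted version at rate 1 is a lower bound, and its closed formula has positive factors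
    only. *)
Lemma hit_first_gt0 b x a z : E x -> E a -> E z ->
  coord b a < coord b x -> coord b x < coord b z -> 0 < H x a z.
Proof.
move=> Ex Ea Ez ax xz; have az := lt_trans ax xz.
apply: (@lt_le_trans _ _ (A 1 x a z)).
  rewrite (passage_firstE ltr01 Ex Ea Ez ax xz) divr_gt0 ?mulr_gt0 //.
  - exact: pp.
  - exact: (loop_lt1 ltr01 Ea Ex (coord_neq ax)).
  - exact: (loop_lt1 ltr01 Ea Ez (coord_neq az)).
apply: ev_le; [exact: (frac_first ltr01) | exact: frac_lt |].
apply: aeW => w; rewrite ler_piMl ?ex_le1 ?ler01 ?hitting_ge0 //.
Qed.

Lemma passage_first_cvg x a z : E x -> E a -> E z ->
  (fun n => A (n.+1%:R^-1) x a z) @ \oo --> H x a z.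
Proof.
move=> Ex Ea Ez; apply: ev_cvg => [n||]; [apply: frac_first => // | exact: frac_lt |].
apply: aeW => w; have [lt|nlt] := pselect ((T z w < T a w)%E); last first.
  rewrite indicE memNset //= ; under eq_fun do rewrite mulr0.
  exact: cvg_cst.
rewrite indicE mem_set //; under eq_fun do rewrite mulr1.
have := ex0_cvg (hitting_ge0 (X := X) z w).
by rewrite -/(T z w) (lt_le_trans lt (leey _)).
Qed.

(** At positive rates this is algebra: in the product of two closed formulas the loop factor between
    [a] and [y] cancels. Then the rate tends to 0. *)
Lemma hit_first_mul b x y a z : E x -> E y -> E a -> E z ->
  coord b a < coord b x -> coord b x < coord b y -> coord b y < coord b z ->
  H x a z = H x a y * H y a z.
Proof.
move=> Ex Ey Ea Ez ax xy yz.
have ay := lt_trans ax xy; have xz := lt_trans xy yz; have az := lt_trans ax xz.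
have e n : A (n.+1%:R^-1) x a z = A (n.+1%:R^-1) x a y * A (n.+1%:R^-1) y a z.
  have q0 : 0 < n.+1%:R^-1 :> R by rewrite invr_gt0.
  rewrite (passage_firstE q0 Ex Ea Ez ax xz) (passage_firstE q0 Ex Ea Ey ax xy).
  rewrite (passage_firstE q0 Ey Ea Ez ay yz) (psi_mul q0 Ex Ey Ez xy yz).
  have l1 := loop_lt1 q0 Ea Ez (coord_neq az).
  have l2 := loop_lt1 q0 Ea Ey (coord_neq ay).
  by field; rewrite !lt0r_neq0.
have c1 : (fun n => A (n.+1%:R^-1) x a z) @ \oo --> H x a y * H y a z.
  under eq_fun do rewrite e.
  by apply: cvgM; exact: passage_first_cvg.
exact: (cvg_unique (@norm_hausdorff R R) (passage_first_cvg Ex Ea Ez) c1).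
Qed.

(* [passage] for [q -> 0] *)
Lemma passage0 b x y z L : E x -> E y -> E z ->
  coord b x < coord b z -> coord b y < coord b z -> F_at F (T y) L ->
  (forall w, L w -> (T y w < T z w)%E) ->
  ev (P (Some x)) (\1_(L `&` [set w | (T z w < +oo)%E])) =
  ev (P (Some x)) (\1_L) * ev (P (Some y)) (\1_[set w | (T z w < +oo)%E]).
Proof.
move=> Ex Ey Ez xz yz FL Llt; have [mL _] := FL.
have mT := measurable_hitting_fin HP Ez.
have q0 n : 0 < n.+1%:R^-1 :> R by rewrite invr_gt0.
have exT v w : (fun n => ex (n.+1%:R^-1) (T v w)) @ \oo --> (\1_[set w | (T v w < +oo)%E] w : R).
  by rewrite indic_bool; exact: (ex0_cvg (hitting_ge0 (X := X) v w)).
have c1 : (fun n => ev (P (Some x)) (fun w => ex (n.+1%:R^-1) (T z w) * \1_L w)) @ \oo -->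
    ev (P (Some x)) (\1_(L `&` [set w | (T z w < +oo)%E])).
  apply: ev_cvg => [n||].
  - by apply: frac_mul; [exact: (frac_ex HP) | exact: frac_indic].
  - by apply: frac_indic; exact: measurableI.
  - apply: aeW => w; rewrite indicI /= mulrC; apply: cvgM; [exact: exT | exact: cvg_cst].
have c2 : (fun n => ev (P (Some x)) (fun w => ex (n.+1%:R^-1) (T y w) * \1_L w)) @ \oo -->
    ev (P (Some x)) (\1_L).
  apply: ev_cvg => [n||].
  - by apply: frac_mul; [exact: (frac_ex HP) | exact: frac_indic].
  - exact: frac_indic.
  - apply: aeW => w; have [Lw|nLw] := pselect (L w); last first.
      rewrite indicE memNset //=; under eq_fun do rewrite mulr0.
      exact: cvg_cst.
    under eq_fun do rewrite indicE mem_set // mulr1.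
    have := @exT y w; rewrite !indicE !mem_set //=.
    by apply: lt_le_trans (Llt w Lw) _; exact: leey.
have c3 : (fun n => psi (n.+1%:R^-1) y z) @ \oo --> ev (P (Some y)) (\1_[set w | (T z w < +oo)%E]).
  apply: ev_cvg => [n||]; [exact: (frac_ex HP) | exact: frac_indic |].
  by apply: aeW => w; exact: exT.
apply: (cvg_unique (@norm_hausdorff R R) c1).
have -> : (fun n => ev (P (Some x)) (fun w => ex (n.+1%:R^-1) (T z w) * \1_L w)) =
  (fun n => ev (P (Some x)) (fun w => ex (n.+1%:R^-1) (T y w) * \1_L w) * psi (n.+1%:R^-1) y z).
  by apply/funext => n; apply: (passage HP SF SR (q0 n) Ex Ey Ez xz yz FL Llt).
exact: cvgM c2 c3.
Qed.
End TwoSided.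

(** * Lower limits of extended real sequences *)

Section LimInf.
Context {R : realType}.
Implicit Types (u : nat -> \bar R) (l : \bar R).

Lemma limn_einf_ge u l : (forall n, l <= u n)%E -> (l <= limn_einf u)%E.
Proof.
move=> h; rewrite limn_einf_lim; apply: lime_ge; first exact: is_cvg_einfs.
by apply: nearW => n; apply/ereal_infP => _ [m _ <-].
Qed.

Lemma limn_einf_le u l : (forall n, u n <= l)%E -> (limn_einf u <= l)%E.
Proof.
move=> h; rewrite limn_einf_lim; apply: lime_le; first exact: is_cvg_einfs.
apply: nearW => n; apply: le_trans (h n).
by apply: ge_ereal_inf; exists (u n) => //; exists n => //=.
Qed.

Lemma limn_einf_near u l : (\forall n \near \oo, u n = l) -> limn_einf u = l.
Proof.
move=> h; suff h' : u @ \oo --> l by case: (cvg_limn_einf_sup h').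
have : (fun=> l) @ \oo --> l by exact: cvg_cst.
by apply: cvg_trans; apply: near_eq_cvg; apply: filterS h => n ->.
Qed.

Lemma measurable_limn_einf {d} {T : measurableType d} (f : nat -> T -> \bar R) :
  (forall n, measurable_fun setT (f n)) -> measurable_fun setT (fun w => limn_einf (f ^~ w)).
Proof.
move=> mf; rewrite /limn_einf; apply: measurableT_comp; first exact: oppe_measurable.
apply: (@measurable_fun_limn_esup _ _ _ _ (fun n w => (- f n w)%E)) => n.
by apply: measurableT_comp => //; exact: oppe_measurable.
Qed.
End LimInf.

(** * Exit from an interval *)

Section ConstantTime.
Context {R : realType} {E : set (\bar R)}
  {d : measure_display} {Omega : measurableType d}
  {F : R -> set (set Omega)} {theta : R -> Omega -> Omega}
  {X : R -> Omega -> @state R} {P : @state R -> probability Omega R}.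
Hypothesis HP : hunt_process E F theta X P.
Notation mu := (@lebesgue_measure R).
Variables (b : bool) (c : R).
Hypothesis c2 : -2 <= c.
Let Z := @Yp R d Omega X b.
Let U q y := resolvent (X := X) (P := P) q b c y.

Let g s t w : \bar R := P (X s w) [set v | (c < Z t v)%R].

Lemma measurable_transition s t : 0 <= s -> measurable_fun setT (g s t).
Proof.
move=> s0; have [t0|t0] := leP 0 t; last first.
  rewrite (_ : g s t = cst 0%E); first exact: measurable_cst.
  apply/funext => w; rewrite /g (_ : [set _ | _] = set0) ?measure0 //.
  by apply/seteqP; split => v //=; rewrite /Z /Yp leNgt t0 /= ltNge c2.
have [B bB HB] := @borelS_coord _ b E c c2.
apply: emeasurable_gt => r; rewrite (_ : [set _ | _] = ~` (X s @^-1` [set x | (P x (X t @^-1` B) <= r%:E)%E])).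
  apply: measurableC; apply: (F_meas HP s0); apply: (hunt_adapted HP) => //.
  exact: (hunt_measurable HP).
have e : [set v | c < Z t v] = X t @^-1` B.
  by apply/seteqP; split => v /=; rewrite /Z /Yp t0; move/(HB _ (hunt_values HP v t0)).
by apply/seteqP; split => w /=; rewrite /g e ltNge => /negP.
Qed.

Lemma markov_constant x s t L : E x -> 0 <= s -> 0 <= t -> F s L ->
  P (Some x) (L `&` [set w | c < Z (s + t) w]) = (\int[P (Some x)]_(w in L) g s t w)%E.
Proof.
move=> Ex s0 t0 FL; have mL := F_meas HP s0 FL.
have stS : stopping_time F (fun=> s%:E).
  split=> [w|u u0]; first by rewrite lee_fin.
  have [su|su] := leP s u.
    rewrite (_ : [set _ | _] = setT); first exact: (sigma_setT (sigmaF HP u0)).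
    by apply/seteqP; split => // w _ /=; rewrite lee_fin.
  rewrite (_ : [set _ | _] = set0); first exact: (sigma_set0 (sigmaF HP u0)).
  by apply/seteqP; split => // w /=; rewrite lee_fin leNgt su.
have FS : F_at F (fun=> s%:E) L.
  split => // u u0; have [su|su] := leP s u.
    rewrite (_ : _ `&` _ = L); first exact: (F_mono HP s0 su FL).
    by apply/seteqP; split => [w []//|w Lw]; split => //=; rewrite lee_fin.
  rewrite (_ : _ `&` _ = set0); first exact: (sigma_set0 (sigmaF HP u0)).
  by apply/seteqP; split => // w /= [_]; rewrite lee_fin leNgt su.
have [B bB HB] := @borelS_coord _ b E c c2.
have := hunt_strong_markov HP (x := Some x) Ex stS FS t0 bB.
have -> : L `&` [set w | (s%:E < +oo)%E] = L.
  by apply/seteqP; split => [w []//|w Lw]; split => //=; rewrite ltry.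
have st0 : 0 <= s + t by exact: addr_ge0.
have -> : L `&` [set w | B (Xat X (s%:E + t%:E)%E w)] = L `&` [set w | c < Z (s + t) w].
  apply/seteqP; split => w [Lw /= h]; split => //=; move: h; rewrite /Z /Yp st0;
    by move/(HB _ (hunt_values HP w st0)).
move=> ->; apply: eq_integral => w _; rewrite /g /=; congr (P _ _).
by apply/seteqP; split => v /=; rewrite /Z /Yp t0; move/(HB _ (hunt_values HP v t0)).
Qed.

(** A path strictly above [c] at [t] stays there for a while by right-continuity, hence at the grid
    times close to [t]; Fatou's lemma transfers this to probabilities. *)
Lemma transition_lsc s t w : 0 <= s -> (g s t w <= limn_einf (fun n => g s (grid n t) w))%E.
Proof.
move=> s0; have mlev u : measurable [set v | c < Z u v] by exact: (measurable_level HP).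
pose f n v : \bar R := (\1_[set v | c < Z (grid n t) v] v : R)%:E.
have gE u : g s u w = (\int[P (X s w)]_v (\1_[set v | c < Z u v] v : R)%:E)%E.
  by rewrite /g probability_indic.
have -> : (fun n => g s (grid n t) w) = (fun n => \int[P (X s w)]_v f n v)%E.
  by apply/funext => n; rewrite gE.
apply: le_trans (fatou (P (X s w)) measurableT (f := f) _ _); last 2 first.
- by move=> n; apply/measurable_EFinP; exact: measurable_indic.
- by move=> n v _; rewrite lee_fin.
have mf n : measurable_fun setT (f n) by apply/measurable_EFinP; exact: measurable_indic.
rewrite gE; apply: ge0_le_integral => //.
- by apply/measurable_EFinP; exact: measurable_indic.
- exact: measurable_limn_einf.
move=> v _; have [cv|ncv] := pselect (c < Z t v); last first.
  by rewrite indicE memNset //; apply: limn_einf_ge => n; rewrite lee_fin.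
rewrite (@limn_einf_near _ _ 1%E) ?indicE ?mem_set //.
have t0 := Yp_gt_time c2 cv.
have e0 : 0 < Z t v - c by rewrite subr_gt0.
have [dl dl0 H] := Y_rc HP b v t0 (e := Z t v - c) e0; have [n hn] := invS_lt dl0.
exists n => // m /= nm; rewrite /f indicE mem_set //=.
have tg := grid_gt m t; have gd : grid m t < t + dl.
  apply: le_lt_trans (grid_le m t) _; rewrite ltrD2l; apply: le_lt_trans hn.
  by rewrite lef_pV2 ?posrE ?ltr0n // ler_nat.
have := H _ (ltW tg) gd; rewrite /Z /Yp t0 (le_trans t0 (ltW tg)) ltr_norml => /andP[h _].
by move: h; set a := coordS _ _; set a' := coordS _ _ => h; lra.
Qed.

(* Fatou's lemma replaces the joint measurability of [(t, w) |-> g s t w]. *)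
Lemma resolvent_fatou q x s L K (v0 : R) : 0 < q -> E x -> 0 <= s -> 0 <= v0 -> F s L ->
  measurable K ->
  {ae P (Some x), forall w, L w -> forall t, 0 <= t -> c < Z (s + t) w -> K w} ->
  {ae P (Some x), forall w, L w -> exists2 y, X s w = Some y & (v0%:E <= U q y)%E} ->
  (v0%:E * P (Some x) L <= P (Some x) (L `&` K))%E.
Proof.
move=> q0 Ex s0 v00 FL mK hK hU; have mL := F_meas HP s0 FL.
have mL1 : measurable_fun setT (\1_L : Omega -> R) by exact: measurable_indic.
have g0 u w : (0 <= g s u w)%E by exact: measure_ge0.
pose h n (t : R) w : \bar R := ((\1_L w)%:E * g s (grid n t) w)%E.
have h0 n t w : (0 <= h n t w)%E by rewrite mule_ge0 // lee_fin.
have mh n t : measurable_fun setT (h n t).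
  by apply: emeasurable_funM; [exact/measurable_EFinP | exact: measurable_transition].
(* Jointly measurable because rounded times take countably many values. *)
pose h2 (p : R * Omega) : \bar R := limn_einf (fun n => h n p.1 p.2).
have h20 p : (0 <= h2 p)%E by exact: limn_einf_ge.
have mh2 : measurable_fun setT h2.
  apply: (measurable_limn_einf (f := fun n (p : R * Omega) => h n p.1 p.2)) => n.
  apply: emeasurable_funM.
    by apply/measurable_EFinP; apply: measurableT_comp => //; exact: measurable_snd.
  by apply: (measurable_grid (Z := g s)) => t; exact: measurable_transition.
have pdf0 t : (0 <= (exponential_pdf q t)%:E)%E by rewrite lee_fin exponential_pdf_ge0 // ltW.
have mpdf : measurable_fun setT (fun t : R => (exponential_pdf q t)%:E).
  by apply/measurable_EFinP; exact: measurable_exponential_pdf.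
pose f (p : R * Omega) : \bar R := ((exponential_pdf q p.1)%:E * h2 p)%E.
have f0 p : (0 <= f p)%E by rewrite mule_ge0.
have mf : measurable_fun setT f.
  apply: emeasurable_funM => //; apply/measurable_EFinP; apply: measurableT_comp; last exact: measurable_fst.
  exact: measurable_exponential_pdf.
(* On [L] the resolvent at [X s w] is at least [v0], and by [transition_lsc] it is at most the inner
   integral. *)
apply: (@le_trans _ _ (\int[P (Some x)]_w \int[mu]_t f (t, w))%E).
  have mL1e : measurable_fun setT (fun w => (\1_L w : R)%:E) by exact/measurable_EFinP.
  have L10 w : setT w -> (0 <= (\1_L w : R)%:E)%E by rewrite lee_fin.
  have v00' : (0 <= v0%:E)%E by rewrite lee_fin.
  rewrite (probability_indic _ mL) -(ge0_integralZl (P (Some x)) measurableT mL1e L10 v00').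
  apply: ae_ge0_le_integral => //.
  - by move=> w _; rewrite mule_ge0 // lee_fin.
  - by apply: emeasurable_funM => //; exact/measurable_EFinP.
  - by move=> w _; exact: integral_ge0.
  - exact: (@measurable_fun_fubini_tonelli_G _ _ _ _ _ mu f mf f0).
  apply: filterS hU => w hU _; have [Lw|nLw] := pselect (L w); last first.
    by rewrite indicE memNset // mule0; exact: integral_ge0.
  rewrite indicE mem_set // mule1; have [y Xy] := hU Lw.
  move=> /le_trans; apply; rewrite /U /resolvent; apply: ge0_le_integral => //.
  - by move=> t _; rewrite mule_ge0.
  - apply: emeasurable_funM => //.
    have := @measurable_fun_fubini_tonelli_F _ _ _ _ _ (P (Some y))
      (fun p : R * Omega => ((c < Z p.1 p.2)%R%:R)%:E).
    rewrite /fubini_F => H; apply: eq_measurable_fun (H _ _) => [t _||//].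
      rewrite /= probability_indic; last exact: (measurable_level HP).
      by apply: eq_integral => v _; rewrite indic_bool.
    apply/measurable_EFinP; apply: measurable_bool; apply: measurable_fun_ltr => //.
    exact: (Yp_joint HP).
  - exact: (measurable_fun_pair1 w mf).
  move=> t _; rewrite /f /=; apply: lee_wpmul2l => //.
  rewrite -/(Z t); apply: le_trans (_ : g s t w <= _)%E; first by rewrite /g Xy.
  apply: le_trans (transition_lsc t w s0) _; rewrite /h2 /h /=.
  by rewrite indicE mem_set //; under [X in (_ <= limn_einf X)%E]eq_fun do rewrite mul1e.
rewrite -(@fubini_tonelli _ _ _ _ _ mu (P (Some x)) f mf f0).
apply: (@le_trans _ _ (\int[mu]_t ((exponential_pdf q t)%:E * P (Some x) (L `&` K)))%E); last first.
  by rewrite ge0_integralZr // integral_exponential_pdf // mul1e.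
have mhw t : measurable_fun setT (fun w => h2 (t, w)).
  exact: (measurable_limn_einf (f := fun n => h n t)).
apply: ge0_le_integral => //.
- by move=> t _; exact: integral_ge0.
- exact: (@measurable_fun_fubini_tonelli_F _ _ _ _ _ (P (Some x)) f mf f0).
- by apply: emeasurable_funM => //; exact: measurable_cst.
(* For fixed [t], Fatou's lemma and the Markov property at time [s] lead to the probability of being
   in [L] and above [c] at a later grid time, an event almost surely contained in [K]. *)
move=> t _; rewrite /f /= ge0_integralZl //.
have [t0|t0] := leP 0 t; last by rewrite lt0_exponential_pdf // !mul0e.
apply: lee_wpmul2l => //; apply: le_trans (fatou (P (Some x)) measurableT (f := fun n => h n t) (fun n => mh n t) _) _ => //.
apply: limn_einf_le => n.
have gt0 : 0 <= grid n t by exact: le_trans t0 (ltW (grid_gt n t)).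
have -> : (\int[P (Some x)]_w h n t w = \int[P (Some x)]_(w in L) g s (grid n t) w)%E.
  rewrite [RHS]integral_mkcond; apply: eq_integral => w _; rewrite /h patchE indicE.
  by case: (w \in L); rewrite ?mul1e ?mul0e.
rewrite -markov_constant //.
have mA : measurable (L `&` [set w | c < Z (s + grid n t) w]).
  by apply: measurableI => //; exact: (measurable_level HP).
have mB : measurable (L `&` K) by exact: measurableI.
rewrite (probability_indic _ mA) (probability_indic _ mB).
apply: ae_ge0_le_integral => //.
- by apply/measurable_EFinP; exact: measurable_indic.
- by apply/measurable_EFinP; exact: measurable_indic.
apply: filterS hK => w hK _; rewrite lee_fin.
have [[Lw cw]|nA] := pselect ((L `&` [set w | c < Z (s + grid n t) w]) w); last first.
  by rewrite indicE memNset.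
by rewrite !indicE !mem_set //; split => //; exact: hK cw.
Qed.
End ConstantTime.

Section Exit.
Context {R : realType} {E : set (\bar R)}
  {d : measure_display} {Omega : measurableType d}
  {F : R -> set (set Omega)} {theta : R -> Omega -> Omega}
  {X : R -> Omega -> @state R} {P : @state R -> probability Omega R}.
Hypothesis HP : hunt_process E F theta X P.
Hypothesis SF : forall x, E x -> {ae P (Some x), forall w, @skip_path R E d Omega X w}.
Hypothesis SR : forall x y, E x -> E y ->
  (0 < P (Some x) [set w | (hitting X y w < +oo)%E])%E.
Hypothesis ND : forall x, E x -> {ae P (Some x), forall w, forall a b, E a -> E b ->
     (forall u, 0 <= u -> X u w <> None -> contract a <= coordS true (X u w) <= contract b) ->
     forall u, 0 <= u -> X u w <> None}.

Let T y w := hitting X y w.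
Let psi := @psi R d Omega X P.

Definition never_exit a b := [set w | ~ (T a w < +oo)%E] `&` [set w | ~ (T b w < +oo)%E].

Lemma measurable_never_exit a b : E a -> E b -> measurable (never_exit a b).
Proof.
by move=> Ea Eb; apply: measurableI; apply: measurableC; exact: (measurable_hitting_fin HP).
Qed.

Lemma F_gt_hitting s y : 0 <= s -> E y -> F s [set w | (s%:E < T y w)%E].
Proof.
move=> s0 Ey; rewrite (_ : [set _ | _] = ~` [set w | (T y w <= s%:E)%E]).
  by apply: (sigma_setC (sigmaF HP s0)); exact: (hunt_hitting_stopping HP Ey).2.
by apply/seteqP; split => w /=; rewrite ltNge => /negP.
Qed.

Lemma hitting_cases y w : T y w = +oo%E \/ exists2 t, 0 <= t & T y w = t%:E.
Proof.
have := hitting_ge0 (X := X) y w; rewrite -/(T y w).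
by case: (T y w) => [t||] // t0; [right; exists t | left].
Qed.

Lemma indic_false (A : set Omega) w : ~ A w -> \1_A w = 0 :> R.
Proof. by move=> h; rewrite indicE memNset. Qed.

Lemma indic_true (A : set Omega) w : A w -> \1_A w = 1 :> R.
Proof. by move=> h; rewrite indicE mem_set. Qed.

Lemma indic_le (A B : set Omega) w : (A w -> B w) -> \1_A w <= \1_B w :> R.
Proof.
have [Aw h|nA _] := pselect (A w); last by rewrite (indic_false nA).
by rewrite (indic_true Aw) (indic_true (h Aw)).
Qed.

(** The events [n < T y < +oo] decrease to the empty set. *)
Lemma cvg_late_hitting y (u : nat -> Omega -> R) (x : @state R) : E y ->
  (forall n, frac (u n)) ->
  (forall n w, u n w <= \1_([set w | (n%:R%:E < T y w)%E] `&` [set w | (T y w < +oo)%E]) w) ->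
  (fun n => ev (P x) (u n)) @ \oo --> (0 : R).
Proof.
move=> Ey fu hu; have f0 : frac (cst 0 : Omega -> R).
  by split; [exact: measurable_cst | move=> w; rewrite /= lexx ler01].
have ev0 : ev (P x) (cst 0) = 0 by rewrite /ev integral0_eq.
rewrite -[X in _ --> X]ev0; apply: ev_cvg => //; apply: aeW => w.
have : (fun=> 0 : R) @ \oo --> (0 : R) by exact: cvg_cst.
apply: cvg_trans; apply: near_eq_cvg; pose N := (Num.trunc (fine (T y w))).+1.
have Nt : fine (T y w) < N%:R by exact: truncnS_gt.
exists N => // n /= Nn; apply/eqP; rewrite eq_le; have /andP[-> _] := (fu n).2 w.
apply: le_trans (hu n w) _; rewrite indic_false // => -[/=].
case: (hitting_cases y w) Nt => [->|[t t0 ->]] Nt; first by rewrite ltxx.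
rewrite lte_fin => nt _; have : N%:R <= n%:R :> R by rewrite ler_nat.
by move: Nt; rewrite /= => h1 /(lt_le_trans h1)/(lt_trans nt); rewrite ltxx.
Qed.

Lemma frac_late y n : E y ->
  frac (\1_([set w | (n%:R%:E < T y w)%E] `&` [set w | (T y w < +oo)%E]) : Omega -> R).
Proof.
move=> Ey; apply: frac_indic; apply: measurableI; last exact: (measurable_hitting_fin HP).
by apply: (F_meas HP (ler0n R n)); apply: F_gt_hitting => //; exact: ler0n.
Qed.

Lemma inside_ae a x b s : E a -> E x -> E b -> contract a < contract x ->
  contract x < contract b -> 0 <= s ->
  {ae P (Some x), forall w, (s%:E < T a w)%E -> (s%:E < T b w)%E ->
     exists2 y, X s w = Some y & E y /\ contract a < contract y < contract b}.
Proof.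
move=> Ea Ex Eb ax xb s0.
have up := below_hitting (b := true) HP SF Ex Eb xb.
have dn : {ae P (Some x), forall w, forall t, 0 <= t -> (t%:E < T a w)%E ->
    coordS false (X t w) < coord false a}.
  by apply: (below_hitting HP SF Ex Ea); rewrite /coord ltrN2.
apply: filterS3 up dn (ND Ex) => w up dn nd sa sb.
have inside u y : 0 <= u -> (u%:E < T a w)%E -> (u%:E < T b w)%E -> X u w = Some y ->
    contract a < contract y < contract b.
  move=> u0 ua ub Xu; have := up u u0 ub; have := dn u u0 ua.
  by rewrite Xu /coordS /coord ltrN2 => -> ->.
case Xs : (X s w) => [y|].
  by exists y => //; split; [exact: (valE HP s0 Xs) | exact: inside Xs].
exfalso; apply: (nd a b Ea Eb _ s s0 Xs) => u u0 Xu.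
have us : u < s by rewrite ltNge; apply/negP => su; apply: Xu; exact: (dead_le HP s0 su Xs).
case Xue : (X u w) Xu => [v|] // _.
have /andP[h1 h2] : contract a < contract v < contract b.
  by apply: inside u0 _ _ Xue; [apply: lt_trans sa | apply: lt_trans sb]; rewrite lte_fin.
by rewrite /coordS /coord (ltW h1) (ltW h2).
Qed.

(* Levy's zero-one law in disguise: on survival up to [s] the conditional
   probability of a later visit to [b] is bounded below. *)
Lemma exit_detecting a x b c : E a -> E x -> E b -> contract a < contract x ->
  contract x < contract b -> detecting (E := E) (X := X) (P := P) 1 true b c ->
  P (Some x) (never_exit a b) = 0%E.
Proof.
move=> Ea Ex Eb ax xb dc; have [c2 _ _] := dc.
have [u Ub u0] := resolvent_fin HP ltr01 dc.
(* A lower bound for the resolvent at every [y] inside []a,b[]: the resolvent at [y] is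
   [psi 1 y b * u], and [psi 1 a b] is [psi 1 y b] times a factor at most 1. *)
pose v0 := psi 1 a b * u.
have v00 : 0 < v0 by rewrite mulr_gt0 //; exact: (psi_gt0 HP SR).
pose L n := [set w | (n%:R%:E < T a w)%E] `&` [set w | (n%:R%:E < T b w)%E].
pose K := [set w | (T b w < +oo)%E].
have mK : measurable K by exact: (measurable_hitting_fin HP).
have FL n : F n%:R (L n).
  by apply: (sigma_setI (sigmaF HP (ler0n R n))); apply: F_gt_hitting.
have mL n : measurable (L n) by exact: (F_meas HP (ler0n R n) (FL n)).
have mG := measurable_never_exit Ea Eb.
have bound n : (v0%:E * P (Some x) (L n) <= P (Some x) (L n `&` K))%E.
  apply: (resolvent_fatou (b := true) HP c2 ltr01 Ex (ler0n R n) (ltW v00) (FL n) mK).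
    have dbl := detecting_below (b := true) HP SF Ex Eb xb dc.
    apply: filterS dbl => w h _ t t0 ct.
    have nt0 : 0 <= n%:R + t by rewrite addr_ge0.
    rewrite /K /= ltNge; apply/negP; rewrite leye_eq => /eqP Tb.
    have := h _ nt0; rewrite -/(T b w) Tb ltry => /(_ isT).
    by move: ct; rewrite /Yp nt0 leNgt => ->.
  apply: filterS (inside_ae Ea Ex Eb ax xb (ler0n R n)) => w h [/= na nb].
  have [y Xy [Ey /andP[ay yb]]] := h na nb; exists y => //.
  have yb' : coord true y < coord true b by [].
  rewrite (resolvent_passage HP SF ltr01 Ey Eb yb' dc) Ub -EFinM lee_fin /v0.
  rewrite ler_pM2r // /psi (psi_mul (b := true) HP SF SR ltr01 Ea Ey Eb ay yb').
  rewrite ler_piMl //; first by apply: ltW; exact: (psi_gt0 HP SR).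
  exact: (psi_le1 HP).
have c0 : (fun n => ev (P (Some x)) (\1_(L n `&` K))) @ \oo --> (0 : R).
  apply: (cvg_late_hitting (y := b)) => // [n|n w].
    by apply: frac_indic; exact: measurableI.
  by apply: indic_le => -[[_ nb] Tb].
(* A path that never exits belongs to every [L n], so [v0] times its probability is at most that of
   [n < T b < +oo], which tends to 0. *)
rewrite -(ev_indic _ mG); apply/eqP; rewrite eqe eq_le ev_ge0 ?andbT; last exact: frac_indic.
rewrite -(pmulr_rle0 _ v00); apply: (cvgr_to_ge c0); apply: nearW => n.
apply: (@le_trans _ _ (v0 * ev (P (Some x)) (\1_(L n)))).
  rewrite ler_pM2l //; apply: ev_le; [exact: frac_indic | exact: frac_indic |].
  apply: aeW => w; apply: indic_le => -[/= Ga Gb]; split => /=.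
    by case: (hitting_cases a w) Ga => [->|[t _ ->]] //; rewrite ltry.
  by case: (hitting_cases b w) Gb => [->|[t _ ->]] //; rewrite ltry.
rewrite -lee_fin EFinM (ev_indic _ (mL n)) ev_indic //; exact: measurableI.
Qed.

Lemma F_at_gt_const S s : 0 <= s -> stopping_time F S -> F_at F S [set w | (s%:E < S w)%E].
Proof.
move=> s0 stS; have gtE : [set w | (s%:E < S w)%E] = ~` [set w | (S w <= s%:E)%E].
  by apply/seteqP; split => w /=; rewrite ltNge => /negP.
split; first by rewrite gtE; apply: measurableC; apply: (F_meas HP s0); exact: stS.2.
move=> t t0; have sF := sigmaF HP t0; have [ts|st] := leP t s.
  rewrite (_ : _ `&` _ = set0); first exact: (sigma_set0 sF).
  apply/seteqP; split => // w [/= h1 h2].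
  by have := lt_le_trans h1 h2; rewrite lte_fin ltNge ts.
apply: (sigma_setI sF); last exact: stS.2.
by rewrite gtE; apply: (sigma_setC sF); apply: (F_mono HP s0 (ltW st)); exact: stS.2.
Qed.

(** If [b] is not detectable, a path that never exits still hits the approximating points [zn n], at
    times tending to infinity. From each of them [b] is reached with probability at least [r], so
    visits to [b] at arbitrarily late times would keep positive probability. *)
Lemma exit_ae a x b : E a -> E x -> E b -> contract a < contract x ->
  contract x < contract b -> P (Some x) (never_exit a b) = 0%E.
Proof.
move=> Ea Ex Eb ax xb; have mG := measurable_never_exit Ea Eb.
have [[c dc]|[zn [hn zlt zcv]]] := detecting_or_limit HP SR true ltr01 Eb.
  exact: exit_detecting dc.
have Ezn n : E (zn n) by case: (hn n).
have xb' : coord true x < coord true b by [].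
have xzn : \forall n \near \oo, coord true x < coord true (zn n).
  exact: (cvgr_gt (coord true b) zcv).
have Tcv := hitting_cvg HP SF Ex Eb Ezn xb' zlt zcv.
have exitn : {ae P (Some x), forall w, forall n, coord true x < coord true (zn n) ->
    ~ never_exit a (zn n) w}.
  apply: ae_foralln => n; have [xz|xz] := ltP (coord true x) (coord true (zn n)).
    have [c dc] := (hn n).2.
    apply: filterS (null_ae (measurable_never_exit Ea (Ezn n)) (exit_detecting Ea Ex (Ezn n) ax xz dc)) => w h _.
    exact: h.
  by apply: aeW.
pose G := never_exit a b.
pose K := [set w | (T b w < +oo)%E].
have mK : measurable K by exact: (measurable_hitting_fin HP).
pose r := ev (P (Some x)) (\1_K).
have r0 : 0 < r by rewrite -lte_fin ev_indic //; exact: SR.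
have stT y : E y -> stopping_time F (T y) by exact: (hunt_hitting_stopping HP).
pose M n := [set w | (T (zn n) w < T b w)%E].
have FM n : F_at F (T (zn n)) (M n) by apply: (F_at_lt HP); exact: stT.
(* Almost every path from [x] to [b] passes through [zn n], so reaching [b] from there is at least
   as likely. *)
have rle n : coord true x < coord true (zn n) -> r <= ev (P (Some (zn n))) (\1_K).
  move=> xz; have mM : measurable (M n) by case: (FM n).
  have <- : ev (P (Some x)) (\1_(M n `&` K)) = r.
    apply: ev_eq; [by apply: frac_indic; exact: measurableI | exact: frac_indic |].
    apply: filterS (hitting_order HP SF Ex (Ezn n) xz (zlt n)) => w h.
    have [Kw|nK] := pselect (K w); last by rewrite !indic_false // => -[].
    by rewrite !indic_true //; split => //; exact: h.
  rewrite (passage0 HP SF SR Ex (Ezn n) Eb xb' (zlt n) (FM n) (fun w h => h)).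
  by rewrite ler_piMl ?ev_ge0 ?ev_le1 //; exact: frac_indic.
(* For fixed [s], the event of hitting [zn n] after time [s] and before [b] eventually contains [G],
   up to a null set. *)
have key (s : nat) : r * ev (P (Some x)) (\1_G) <=
   ev (P (Some x)) (\1_([set w | (s%:R%:E < T b w)%E] `&` K)).
  pose L n := M n `&` [set w | (s%:R%:E < T (zn n) w)%E].
  have FL n : F_at F (T (zn n)) (L n).
    by apply: (F_at_setI HP (FM n)); apply: F_at_gt_const => //; exact: stT.
  have mL n : measurable (L n) by case: (FL n).
  have cG : (fun n => r * ev (P (Some x)) (\1_(G `&` L n))) @ \oo --> r * ev (P (Some x)) (\1_G).
    apply: cvgMl_tmp; apply: ev_cvg => [n||].
    - by apply: frac_indic; exact: measurableI.
    - exact: frac_indic.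
    apply: filterS2 Tcv exitn => w Tw ew.
    have : (fun=> \1_G w : R) @ \oo --> (\1_G w : R) by exact: cvg_cst.
    apply: cvg_trans; apply: near_eq_cvg.
    have [[Ga Gb]|nG] := pselect (G w); last first.
      by apply: nearW => n; rewrite !indic_false // => -[].
    have Tb : T b w = +oo%E by case: (hitting_cases b w) Gb => [//|[t _ /= ->]]; rewrite ltry.
    have late : \forall n \near \oo, (s%:R%:E < T (zn n) w)%E.
      by apply: (cvg_ereal_gt _ Tw); rewrite -/(T b w) Tb ltry.
    apply: filterS2 xzn late => n xz sn; rewrite !indic_true //.
    split => //; split => //; rewrite /M /= Tb ltNge; apply/negP => h.
    apply: (ew n xz); split => //=; rewrite -/(T (zn n) w).
    by move: h; rewrite leye_eq => /eqP ->; rewrite ltxx.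
  apply: (ler_cvg_to cG (cvg_cst _)); apply: filterS xzn => n xz.
  apply: (@le_trans _ _ (ev (P (Some x)) (\1_(L n)) * ev (P (Some (zn n))) (\1_K))).
    rewrite mulrC; apply: ler_pM; last exact: rle.
    - by apply: ev_ge0; apply: frac_indic; exact: measurableI.
    - exact: ltW.
    - apply: ev_le; [by apply: frac_indic; exact: measurableI | exact: frac_indic |].
      by apply: aeW => w; apply: indic_le => -[].
  have Llt w : L n w -> (T (zn n) w < T b w)%E by case.
  rewrite -(passage0 HP SF SR Ex (Ezn n) Eb xb' (zlt n) (FL n) Llt).
  apply: ev_le.
  - by apply: frac_indic; exact: measurableI.
  - by exact: frac_late.
  - apply: aeW => w; apply: indic_le => -[[h1 /= h2] h3]; split => //=.
    exact: lt_trans h2 h1.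
rewrite -(ev_indic _ mG); apply/eqP; rewrite eqe eq_le ev_ge0 ?andbT; last exact: frac_indic.
have c0 : (fun s : nat => ev (P (Some x)) (\1_([set w | (s%:R%:E < T b w)%E] `&` K))) @ \oo -->
    (0 : R).
  by apply: (cvg_late_hitting (y := b)) => // n; exact: frac_late.
by rewrite -(pmulr_rle0 _ r0); apply: (cvgr_to_ge c0); apply: nearW => s; exact: key.
Qed.
End Exit.

(** * The scale function *)

Section Scale.
Context {R : realType} {E : set (\bar R)}
  {d : measure_display} {Omega : measurableType d}
  {F : R -> set (set Omega)} {theta : R -> Omega -> Omega}
  {X : R -> Omega -> @state R} {P : @state R -> probability Omega R}.
Hypothesis HP : hunt_process E F theta X P.
Hypothesis SF : forall x, E x -> {ae P (Some x), forall w, @skip_path R E d Omega X w}.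
Hypothesis SR : forall x y, E x -> E y ->
  (0 < P (Some x) [set w | (hitting X y w < +oo)%E])%E.
Hypothesis ND : forall x, E x -> {ae P (Some x), forall w, forall a b, E a -> E b ->
     (forall u, 0 <= u -> X u w <> None -> contract a <= coordS true (X u w) <= contract b) ->
     forall u, 0 <= u -> X u w <> None}.

Let T y w := hitting X y w.
Let H := @hit_first R d Omega X P.

Lemma exit_either b x a z : E a -> E x -> E z -> coord b a < coord b x -> coord b x < coord b z ->
  {ae P (Some x), forall w, (T a w < +oo)%E \/ (T z w < +oo)%E}.
Proof.
move=> Ea Ex Ez ax xz.
have [N0|N0] : P (Some x) (never_exit (X := X) a z) = 0%E \/
   P (Some x) (never_exit (X := X) z a) = 0%E.
  case: b ax xz => ax xz; [left | right]; apply: (exit_ae HP SF SR ND) => //;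
    by rewrite -ltrN2.
- apply: filterS (null_ae (measurable_never_exit HP Ea Ez) N0) => w h.
  by apply/orP; rewrite -[X in is_true X]negbK negb_or; apply/negP => /andP[/negP ? /negP ?]; apply: h.
- apply: filterS (null_ae (measurable_never_exit HP Ez Ea) N0) => w h.
  by apply/orP; rewrite -[X in is_true X]negbK negb_or; apply/negP => /andP[/negP ? /negP ?]; apply: h.
Qed.

Lemma hit_first_compl b x a z : E a -> E x -> E z ->
  coord b a < coord b x -> coord b x < coord b z -> H x a z + H x z a = 1.
Proof.
move=> Ea Ex Ez ax xz; have az := lt_trans ax xz.
apply/esym; rewrite -(ev_cst1 (P (Some x))); apply: ev_add.
- exact: frac_cst1.
- exact: (frac_lt HP).
- exact: (frac_lt HP).
apply: filterS (exit_either Ea Ex Ez ax xz) => w h.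
rewrite !indic_bool /= -/(T a w) -/(T z w).
case: (ltgtP (T a w) (T z w)) => [||e] /=; rewrite ?addr0 ?add0r //.
exfalso; case: h => h.
  by apply: (hitting_neq HP (coord_neq az) h); exact: e.
by apply: (hitting_neq HP _ h (esym e)) => zx; apply: (coord_neq az).
Qed.

Lemma hit_first_lt1 b x a z : E a -> E x -> E z ->
  coord b a < coord b x -> coord b x < coord b z -> H x a z < 1.
Proof.
move=> Ea Ex Ez ax xz; have e := hit_first_compl Ea Ex Ez ax xz.
have h : 0 < H x z a.
  by apply: (hit_first_gt0 (b := ~~ b) HP SF SR) => //; rewrite !coordN ltrN2.
by move: (H x a z) (H x z a) e h => p p' e h; lra.
Qed.

(** If [T z < T a], the points [zn n] are hit earlier still. Otherwise, by the almost sure exit,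
    [T a] is finite and strictly smaller than [T z], hence eventually smaller than [T (zn n)]. *)
Lemma hit_first_cvg b x a z (zn : nat -> \bar R) : E a -> E x -> E z -> (forall n, E (zn n)) ->
  coord b a < coord b x -> coord b x < coord b z -> (forall n, coord b (zn n) < coord b z) ->
  (fun n => coord b (zn n)) @ \oo --> coord b z ->
  (fun n => H x a (zn n)) @ \oo --> H x a z.
Proof.
move=> Ea Ex Ez Ezn ax xz zlt zcv; have az := lt_trans ax xz.
apply: ev_cvg => [n||]; [exact: (frac_lt HP) | exact: (frac_lt HP) |].
have Tcv := hitting_cvg HP SF Ex Ez Ezn xz zlt zcv.
have cr : {ae P (Some x), forall w, forall n, coord b x < coord b (zn n) ->
   (T z w < +oo)%E -> (T (zn n) w < T z w)%E}.
  apply: ae_foralln => n; have [xn|xn] := ltP (coord b x) (coord b (zn n)).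
    by apply: filterS (hitting_order HP SF Ex (Ezn n) xn (zlt n)) => w h _.
  exact: aeW.
apply: filterS3 Tcv cr (exit_either Ea Ex Ez ax xz) => w Tw cw ew.
have xzn : \forall n \near \oo, coord b x < coord b (zn n).
  exact: (cvgr_gt (coord b z) zcv).
have : (fun=> \1_[set w | (T z w < T a w)%E] w : R) @ \oo --> (\1_[set w | (T z w < T a w)%E] w : R).
  exact: cvg_cst.
apply: cvg_trans; apply: near_eq_cvg.
have [za|az'] := ltP (T z w) (T a w).
  have Tz : (T z w < +oo)%E by apply: lt_le_trans za _; exact: leey.
  apply: filterS xzn => n xn; rewrite !indic_true //=.
  by apply: lt_trans za; exact: cw.
have Ta : (T a w < +oo)%E.
  by case: ew => // Tz; exact: le_lt_trans az' Tz.
have ne := hitting_neq HP (coord_neq az) Ta.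
have {}az' : (T a w < T z w)%E by rewrite lt_neqAle az' andbT; exact/eqP.
have : \forall n \near \oo, (T a w < T (zn n) w)%E.
  case: (hitting_cases (X := X) a w) Ta => [e|[t _ e]]; rewrite /T e ?ltxx // => _.
  by apply: (cvg_ereal_gt _ Tw); rewrite -e.
apply: filterS => n an; rewrite !indic_false //=; apply/negP; rewrite -leNgt ltW //.
Qed.

(** Boundary values are imposed: hitting times ignore time 0, so from [a] itself [P_a(T_b < T_a)]
    need not be 0. *)
Definition hit_prob (a b x : \bar R) : R :=
  if (x <= a)%E then 0 else if (b <= x)%E then 1 else H x a b.

Let HH := hit_prob.

Lemma hit_probE a b x : (a < x)%E -> (x < b)%E -> HH a b x = H x a b.
Proof. by move=> ax xb; rewrite /HH /hit_prob !leNgt ax xb. Qed.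

Lemma hit_prob_l a b : HH a b a = 0.
Proof. by rewrite /HH /hit_prob lexx. Qed.

Lemma hit_prob_r a b : (a < b)%E -> HH a b b = 1.
Proof. by move=> ab; rewrite /HH /hit_prob leNgt ab /= lexx. Qed.

Lemma hit_prob_shrinkr a b b' x : E a -> E b -> E b' -> E x ->
  (a < b')%E -> (b' <= b)%E -> (a <= x)%E -> (x <= b')%E ->
  HH a b x = HH a b b' * HH a b' x.
Proof.
move=> Ea Eb Eb' Ex ab'; rewrite le_eqVlt => /predU1P[<-|b'b].
  by rewrite hit_prob_r // mul1r.
rewrite le_eqVlt => /predU1P[<-|ax]; first by rewrite !hit_prob_l mulr0.
rewrite le_eqVlt => /predU1P[->|xb']; first by rewrite hit_prob_r ?mulr1.
rewrite !hit_probE //; [|exact: lt_trans xb' b'b]; rewrite mulrC.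
by apply: (hit_first_mul (b := true) HP SF SR) => //; rewrite lt_contract.
Qed.

(** The complement is the probability of reaching the left end first, to which the product rule
    applies in the reversed order. *)
Lemma hit_prob_shrinkl a a' b x : E a -> E a' -> E b -> E x ->
  (a <= a')%E -> (a' < b)%E -> (a' <= x)%E -> (x <= b)%E ->
  1 - HH a b x = (1 - HH a b a') * (1 - HH a' b x).
Proof.
move=> Ea Ea' Eb Ex; rewrite le_eqVlt => /predU1P[<-|aa'] a'b.
  by rewrite hit_prob_l subr0 mul1r.
have ab := lt_trans aa' a'b.
rewrite le_eqVlt => /predU1P[<-|a'x]; first by rewrite (hit_prob_l a' b) subr0 mulr1.
rewrite le_eqVlt => /predU1P[->|xb]; first by rewrite !hit_prob_r // subrr mulr0.
have ax := lt_trans aa' a'x; rewrite !hit_probE //.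
have compl u v : E u -> E v -> (v < u)%E -> (u < b)%E -> 1 - H u v b = H u b v.
  move=> Eu Ev vu ub; rewrite -(@hit_first_compl true u v b) ?lt_contract //.
  by rewrite addrC addKr.
rewrite !compl // mulrC.
by apply: (hit_first_mul (b := false) HP SF SR) => //; rewrite ltrN2 lt_contract.
Qed.

(** Move the left end first, then the right end: each product rule is an affine relation, and so is
    their composition. *)
Lemma hit_prob_affine a b a' b' x : E a -> E b -> E a' -> E b' -> E x ->
  (a <= a')%E -> (a' < b')%E -> (b' <= b)%E -> (a' <= x)%E -> (x <= b')%E ->
  HH a b x = HH a b a' + (HH a b b' - HH a b a') * HH a' b' x.
Proof.
move=> Ea Eb Ea' Eb' Ex aa' a'b' b'b a'x xb'.
have a'b := lt_le_trans a'b' b'b.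
have e1 := hit_prob_shrinkl Ea Ea' Eb Ex aa' a'b a'x (le_trans xb' b'b).
have e2 := hit_prob_shrinkl Ea Ea' Eb Eb' aa' a'b (ltW a'b') b'b.
have e3 := hit_prob_shrinkr Ea' Eb Eb' Ex a'b' b'b a'x xb'.
have -> : HH a b x = 1 - (1 - HH a b a') * (1 - HH a' b x) by rewrite -e1; ring.
have -> : HH a b b' = 1 - (1 - HH a b a') * (1 - HH a' b b') by rewrite -e2; ring.
by rewrite e3; ring.
Qed.

Lemma hit_prob_lt a b x y : E a -> E b -> E x -> E y -> (a <= x)%E -> (x < y)%E -> (y <= b)%E ->
  HH a b x < HH a b y.
Proof.
move=> Ea Eb Ex Ey ax xy yb; have ay := le_lt_trans ax xy.
have y0 : 0 < HH a b y.
  move: yb; rewrite le_eqVlt => /predU1P[<-|yb]; first by rewrite hit_prob_r.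
  rewrite hit_probE //.
  by apply: (hit_first_gt0 (b := true) HP SF SR) => //; rewrite lt_contract.
have x1 : HH a y x < 1.
  move: ax; rewrite le_eqVlt => /predU1P[<-|ax]; first by rewrite hit_prob_l.
  by rewrite hit_probE //; apply: (@hit_first_lt1 true) => //; rewrite lt_contract.
by rewrite (hit_prob_shrinkr Ea Eb Ey Ex ay yb ax (ltW xy)) gtr_pMr.
Qed.

Section Construction.
Variables a0 b0 : \bar R.
Hypotheses (Ea0 : E a0) (Eb0 : E b0) (ab0 : (a0 < b0)%E).

(** Hitting probabilities on the least interval containing [a0], [b0] and [x], normalized to 0 at
    [a0] and 1 at [b0]. *)
Definition scale (x : \bar R) : R :=
  let A := Order.min a0 x in let B := Order.max b0 x in
  (HH A B x - HH A B a0) / (HH A B b0 - HH A B a0).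

(** Enlarging the interval acts on hitting probabilities by an increasing affine map, which the
    normalized quotient does not see. *)
Lemma scaleE A B x : E A -> E B -> E x -> (A <= a0)%E -> (b0 <= B)%E ->
  (A <= x)%E -> (x <= B)%E -> scale x = (HH A B x - HH A B a0) / (HH A B b0 - HH A B a0).
Proof.
move=> EA EB Ex Aa bB Ax xB; rewrite /scale.
have Em : E (Order.min a0 x) by case: (leP a0 x).
have EM : E (Order.max b0 x) by case: (leP b0 x).
have Am : (A <= Order.min a0 x)%E by rewrite le_min Aa.
have MB : (Order.max b0 x <= B)%E by rewrite ge_max bB.
have ma : (Order.min a0 x <= a0)%E by rewrite ge_min lexx.
have mx : (Order.min a0 x <= x)%E by rewrite ge_min lexx orbT.
have bM : (b0 <= Order.max b0 x)%E by rewrite le_max lexx.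
have xM : (x <= Order.max b0 x)%E by rewrite le_max lexx orbT.
move: (Order.min a0 x) (Order.max b0 x) Em EM Am MB ma mx bM xM => m M Em EM Am MB ma mx bM xM.
have mb : (m < b0)%E := le_lt_trans ma ab0.
have mM : (m < M)%E := lt_le_trans mb bM.
have aff y : E y -> (m <= y)%E -> (y <= M)%E ->
    HH A B y = HH A B m + (HH A B M - HH A B m) * HH m M y.
  by move=> Ey my yM; exact: hit_prob_affine.
rewrite (aff x Ex mx xM) (aff a0 Ea0 ma (le_trans (ltW ab0) bM)) (aff b0 Eb0 (ltW mb) bM).
have D0 : 0 < HH A B M - HH A B m by rewrite subr_gt0; exact: hit_prob_lt.
have d0 : 0 < HH m M b0 - HH m M a0 by rewrite subr_gt0; exact: hit_prob_lt.
move: (HH A B m) (HH A B M) (HH m M x) (HH m M a0) (HH m M b0) D0 d0 => p p' p1 p2 p3 D0 d0.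
have e u v : p + (p' - p) * u - (p + (p' - p) * v) = (p' - p) * (u - v).
  by rewrite opprD addrACA subrr add0r -mulrBr.
rewrite !e -mulf_div divff ?mul1r; first by [].
exact: lt0r_neq0.
Qed.

Lemma scale_lt x y : E x -> E y -> (x < y)%E -> scale x < scale y.
Proof.
move=> Ex Ey xy.
pose A := Order.min a0 x; pose B := Order.max b0 y.
have EA : E A by rewrite /A; case: (leP a0 x).
have EB : E B by rewrite /B; case: (leP b0 y).
have Aa : (A <= a0)%E by rewrite /A ge_min lexx.
have Ax : (A <= x)%E by rewrite /A ge_min lexx orbT.
have bB : (b0 <= B)%E by rewrite /B le_max lexx.
have yB : (y <= B)%E by rewrite /B le_max lexx orbT.
rewrite (scaleE EA EB Ex) //; last exact: le_trans (ltW xy) yB.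
rewrite (scaleE EA EB Ey) //; last exact: le_trans Ax (ltW xy).
rewrite ltr_pM2r ?ltrD2r; first exact: hit_prob_lt.
by rewrite invr_gt0 subr_gt0; exact: hit_prob_lt.
Qed.

(** In an interval [[A,B]] containing all points involved, [scale] is affine in [HH A B], and
    [H x a b] is [HH A B] renormalized at [a] and [b]. *)
Lemma scale_hit a x b : E a -> E x -> E b -> (a < x)%E -> (x < b)%E ->
  H x a b = (scale x - scale a) / (scale b - scale a).
Proof.
move=> Ea Ex Eb ax xb.
pose A := Order.min a0 a; pose B := Order.max b0 b.
have EA : E A by rewrite /A; case: (leP a0 a).
have EB : E B by rewrite /B; case: (leP b0 b).
have Aa0 : (A <= a0)%E by rewrite /A ge_min lexx.
have Aa : (A <= a)%E by rewrite /A ge_min lexx orbT.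
have bB0 : (b0 <= B)%E by rewrite /B le_max lexx.
have bB : (b <= B)%E by rewrite /B le_max lexx orbT.
have ab := lt_trans ax xb.
rewrite (scaleE EA EB Ex) //; [|exact: le_trans Aa (ltW ax)|exact: le_trans (ltW xb) bB].
rewrite (scaleE EA EB Ea) //; last exact: le_trans (ltW ab) bB.
rewrite (scaleE EA EB Eb) //; last exact: le_trans Aa (ltW ab).
have aff := hit_prob_affine EA EB Ea Eb Ex Aa ab bB (ltW ax) (ltW xb).
have D0 : 0 < HH A B b - HH A B a by rewrite subr_gt0; exact: hit_prob_lt.
have d0 : 0 < HH A B b0 - HH A B a0 by rewrite subr_gt0; exact: hit_prob_lt.
rewrite aff -(hit_probE ax xb).
move: (HH A B a) (HH A B b) (HH a b x) (HH A B a0) (HH A B b0) D0 d0 => p p' p1 p2 p3 D0 d0.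
rewrite -!mulrBl (_ : p + (p' - p) * p1 - p2 - (p - p2) = p1 * (p' - p)); last by ring.
rewrite (_ : p' - p2 - (p - p2) = p' - p); last by ring.
rewrite -[p1 * _ / _]mulrA mulfK; first by [].
by apply: mulf_neq0; rewrite ?invr_eq0; exact: lt0r_neq0.
Qed.
End Construction.
End Scale.

(** * Continuity of the scale function *)

Section Continuity.
Context {R : realType} {E : set (\bar R)}
  {d : measure_display} {Omega : measurableType d}
  {F : R -> set (set Omega)} {theta : R -> Omega -> Omega}
  {X : R -> Omega -> @state R} {P : @state R -> probability Omega R}.
Hypothesis HP : hunt_process E F theta X P.
Hypothesis SF : forall x, E x -> {ae P (Some x), forall w, @skip_path R E d Omega X w}.
Hypothesis SR : forall x y, E x -> E y ->
  (0 < P (Some x) [set w | (hitting X y w < +oo)%E])%E.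
Hypothesis ND : forall x, E x -> {ae P (Some x), forall w, forall a b, E a -> E b ->
     (forall u, 0 <= u -> X u w <> None -> contract a <= coordS true (X u w) <= contract b) ->
     forall u, 0 <= u -> X u w <> None}.

Let H := @hit_first R d Omega X P.

Variable s : \bar R -> R.
Hypothesis s_lt : forall x y, E x -> E y -> (x < y)%E -> s x < s y.
Hypothesis s_hit : forall a x b, E a -> E x -> E b -> (a < x)%E -> (x < b)%E ->
  H x a b = (s x - s a) / (s b - s a).

Let sg (b : bool) (x : \bar R) : R := if b then s x else - s x.

Lemma sg_lt b x y : E x -> E y -> coord b x < coord b y -> sg b x < sg b y.
Proof.
move=> Ex Ey; case: b; rewrite /coord /sg ?ltrN2 lt_contract => h; exact: s_lt.
Qed.

Lemma sg_hit b a x z : E a -> E x -> E z -> coord b a < coord b x -> coord b x < coord b z ->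
  H x a z = (sg b x - sg b a) / (sg b z - sg b a).
Proof.
move=> Ea Ex Ez ax xz; have e := hit_first_compl HP SF SR ND Ea Ex Ez ax xz.
case: b ax xz e; rewrite /coord /sg ?ltrN2 !lt_contract => ax xz e; first exact: s_hit.
rewrite -/(H x a z) -/(H x z a) (s_hit Ez Ex Ea xz ax) in e.
have h : 0 < s a - s z by rewrite subr_gt0 s_lt // (lt_trans xz ax).
have -> : H x a z = 1 - (s x - s z) / (s a - s z) by rewrite -e addrK.
rewrite (_ : - s z - - s a = s a - s z); last by ring.
rewrite -[X in X - _](divff (lt0r_neq0 h)) -mulrBl; congr (_ / _); ring.
Qed.

(** A gap below [x] makes the claim trivial. Otherwise, with [a] and [y] fixed below [x], [sg b z]
    is a continuous function of [H y a z], which converges along a sequence tending to [x];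
    monotonicity fills in the other points. *)
Lemma side_continuous b x (e : R) : E x -> 0 < e -> exists2 c, c < coord b x &
  forall z, E z -> c < coord b z -> coord b z <= coord b x -> `|s z - s x| < e.
Proof.
move=> Ex e0.
have absE z : `|s z - s x| = `|sg b z - sg b x|.
  by rewrite /sg; case: b => //; rewrite -opprD normrN.
have [[c [cx hc]]|acc] := pselect (exists c, c < coord b x /\
   forall v, E v -> coord b v < coord b x -> coord b v <= c).
  exists c => // z Ez cz; rewrite le_eqVlt => /predU1P[/coord_inj ->|zx].
    by rewrite subrr normr0.
  by have := hc z Ez zx; rewrite leNgt cz.
have near_pt c : c < coord b x -> exists v, [/\ E v, c < coord b v & coord b v < coord b x].
  move=> cx; apply: contrapT => no; apply: acc; exists c; split => // v Ev vx.
  by rewrite leNgt; apply/negP => cv; apply: no; exists v.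
(* The bound is arbitrary: only some point of [E] below [x] is wanted. *)
have [a [Ea _ ax]] := near_pt (coord b x - 1) ltac:(by rewrite ltrBlDr ltrDl).
have [y [Ey ay yx]] := near_pt _ ax.
have [zn [Ezn zlt zcv]] := coord_approx near_pt.
have c1 := hit_first_cvg HP SF SR ND Ea Ey Ex Ezn ay yx zlt zcv.
have yzn : \forall n \near \oo, coord b y < coord b (zn n) by exact: (cvgr_gt (coord b x) zcv).
have ay' := sg_lt Ea Ey ay; have yx' := sg_lt Ey Ex yx.
have c2 : (fun n => sg b (zn n)) @ \oo --> sg b x.
  have H0 : H y a x != 0.
    by rewrite gt_eqF //; exact: (hit_first_gt0 HP SF SR Ey Ea Ex ay yx).
  have -> : sg b x = (sg b y - sg b a) / H y a x + sg b a.
    rewrite (sg_hit Ea Ey Ex ay yx) invf_div mulrC divfK ?subrK //.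
    by rewrite gt_eqF // subr_gt0.
  have c3 : (fun n => (sg b y - sg b a) / H y a (zn n) + sg b a) @ \oo -->
     (sg b y - sg b a) / H y a x + sg b a.
    apply: (@cvgD _ R^o); last exact: cvg_cst.
    by apply: cvgMl_tmp; apply: cvgV.
  move: c3; apply: cvg_trans; apply: near_eq_cvg; apply: filterS yzn => n yn.
  rewrite (sg_hit Ea Ey (Ezn n) ay yn) invf_div mulrC divfK ?subrK //.
  by rewrite gt_eqF // subr_gt0.
have /cvgrPdist_lt/(_ e e0)[N _ HN] := c2.
have := HN N (leqnn N); rewrite /= => hN.
exists (coord b (zn N)) => // z Ez cz zx; rewrite absE distrC.
have h1 := sg_lt (Ezn N) Ez cz.
have h2 : sg b z <= sg b x.
  by move: zx; rewrite le_eqVlt => /predU1P[/coord_inj ->//|zx]; apply: ltW; exact: sg_lt.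
have h3 : sg b (zn N) < sg b x by exact: lt_le_trans h2.
rewrite ger0_norm ?subr_ge0 //; apply: le_lt_trans hN.
by rewrite ger0_norm ?subr_ge0 ?(ltW h3) // lerB // ltW.
Qed.

Lemma scale_continuous : {within E, continuous s}.
Proof.
apply/subspace_continuousP => x Ex; apply/cvgrPdist_lt => e e0.
have [c cx hc] := side_continuous true Ex e0.
have [c' cx' hc'] := side_continuous false Ex e0.
have d0 : 0 < Num.min (contract x - c) (- contract x - c').
  by rewrite lt_min !subr_gt0 cx cx'.
(* Balls of the extended line are measured by [contract], so the coordinate bounds from both sides
   give the radius. *)
rewrite /within /=; apply/nbhs_ballP; exists (Num.min (contract x - c) (- contract x - c')) => //.
move=> z /= xz Ez; have {xz} : `|contract x - contract z| < Num.min (contract x - c) (- contract x - c') by [].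
rewrite lt_min => /andP[+ +]; move=> /ltr_normlP[h1 h2] /ltr_normlP[h3 h4].
rewrite distrC.
have [zx|/ltW zx] := leP (contract z) (contract x).
  by apply: hc => //; rewrite /coord; lra.
by apply: hc' => //; rewrite /coord; [lra | rewrite lerN2].
Qed.
End Continuity.

(** Equal hitting probabilities say that for any three points of [E] the pairs [(s, s')] are
    collinear; two fixed points [a < b] then determine the line, wherever [x] lies. *)
Lemma scale_unique {R : realType} {E : set (\bar R)} {d} {Omega : measurableType d}
    {X : R -> Omega -> @state R} {P : @state R -> probability Omega R} (s s' : \bar R -> R) :
  scale_function E X P s -> scale_function E X P s' ->
  exists alpha beta : R, 0 < alpha /\ forall x, E x -> s' x = alpha * s x + beta.
Proof.
move=> [_ lt1 hit1] [_ lt2 hit2].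
have cross a x b : E a -> E x -> E b -> (a < x)%E -> (x < b)%E ->
    (s' x - s' a) * (s b - s a) = (s x - s a) * (s' b - s' a).
  move=> Ea Ex Eb ax xb; have ab := lt_trans ax xb.
  have h1 : s b - s a != 0 by rewrite gt_eqF // subr_gt0 lt1.
  have h2 : s' b - s' a != 0 by rewrite gt_eqF // subr_gt0 lt2.
  have := hit2 a x b Ea Ex Eb ax xb; rewrite (hit1 a x b Ea Ex Eb ax xb) => -[e].
  by apply/esym/eqP; rewrite -eqr_div // e.
have [[a [b [Ea Eb ab]]]|no2] := pselect (exists a b, [/\ E a, E b & (a < b)%E]); last first.
  (* With at most one point the slope is free, and the offset matches the values at that point. *)
  exists 1; have [[x0 Ex0]|no] := pselect (exists x, E x); last first.
    by exists 0; split => // x Ex; case: no; exists x.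
  exists (s' x0 - s x0); split => // x Ex; suff -> : x = x0 by rewrite mul1r addrC subrK.
  case: (ltgtP x x0) => // h; exfalso; apply: no2; [by exists x, x0 | by exists x0, x].
have h1 : 0 < s b - s a by rewrite subr_gt0 lt1.
have h2 : 0 < s' b - s' a by rewrite subr_gt0 lt2.
pose al := (s' b - s' a) / (s b - s a).
exists al, (s' a - al * s a); split; first exact: divr_gt0.
move=> x Ex; suff h : (s' x - s' a) * (s b - s a) = (s' b - s' a) * (s x - s a).
  have e : s' x - s' a = al * (s x - s a).
    by rewrite /al mulrAC -h mulfK // gt_eqF.
  by rewrite -[LHS](subrK (s' a)) e; ring.
case: (ltgtP x a) => [xa|ax|->]; last by rewrite !subrr mul0r mulr0.
  have := cross x a b Ex Ea Eb xa ab => e; apply/eqP; rewrite -subr_eq0; apply/eqP.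
  transitivity (- ((s' a - s' x) * (s b - s x) - (s a - s x) * (s' b - s' x))); first by ring.
  by rewrite e subrr oppr0.
case: (ltgtP x b) => [xb|bx|->]; last by rewrite mulrC.
  by rewrite (cross a x b Ea Ex Eb ax xb) mulrC.
by rewrite mulrC -(cross a b x Ea Eb Ex ab bx) mulrC [RHS]mulrC (mulrC (s x - s a)).
Qed.

Theorem theorem4p5 (R : realType) (E : set (\bar R))
    (d : measure_display) (Omega : measurableType d)
    (F : R -> set (set Omega)) (theta : R -> Omega -> Omega)
    (X : R -> Omega -> @state R) (P : @state R -> probability Omega R) :
  admissible_state_space E ->
  skip_free_hunt E F theta X P ->
  exists s : \bar R -> R, scale_function E X P s /\
    forall s' : \bar R -> R, scale_function E X P s' ->
      exists alpha beta : R, 0 < alpha /\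
        forall x, E x -> s' x = alpha * s x + beta.
Proof.
move=> _ [HP SF0 SR SK].
have SF x : E x -> {ae P (Some x), forall w, @skip_path R E d Omega X w}.
  by move=> Ex; exact: (skip_ae HP Ex (SF0 x Ex)).
have ND := no_death_inside HP SK.
suff [s hs] : exists s, scale_function E X P s.
  by exists s; split => // s'; exact: scale_unique.
have [[a0 [b0 [Ea0 Eb0 ab0]]]|no2] := pselect (exists a b, [/\ E a, E b & (a < b)%E]); last first.
  (* With fewer than two points, monotonicity and the hitting formula are vacuous. *)
  exists (fun=> 0); split.
  - by apply: continuous_subspaceT => x; exact: cvg_cst.
  - by move=> x y Ex Ey xy; exfalso; apply: no2; exists x, y.
  - by move=> a x b Ea Ex _ ax; exfalso; apply: no2; exists a, x.
pose s := scale (X := X) (P := P) a0 b0.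
have s_lt x y : E x -> E y -> (x < y)%E -> s x < s y.
  exact: (scale_lt HP SF SR ND Ea0 Eb0 ab0).
have s_hit a x b : E a -> E x -> E b -> (a < x)%E -> (x < b)%E ->
    hit_first (X := X) (P := P) x a b = (s x - s a) / (s b - s a).
  exact: (scale_hit HP SF SR ND Ea0 Eb0 ab0).
exists s; split => //; first exact: (scale_continuous HP SF SR ND s_lt s_hit).
move=> a x b Ea Ex Eb ax xb; rewrite -s_hit // /hit_first ev_indic //.
exact: (measurable_lt_hitting HP).
Qed.
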